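(* Let $\Lambda\subset\mathbb{R}^2$ be a lattice of rank two, and let $K_t(x,y)$ be the heat kernel on the flat torus $\mathbb{R}^2/\Lambda$. (1) If $\Lambda$ is a regular triangular lattice, then $K_t$ is strictly geodesically decreasing for every $t>0$. (2) Conversely, if there is a sequence of times $t_k\to\infty$ such that $K_{t_k}$ is geodesically decreasing for every $k$, then $\Lambda$ is either a rectangular lattice or a regular triangular lattice.
   Context: The heat kernel $K_t(x,y)$ is the fundamental solution of the heat equation $\partial_t u=\Delta u$, where $\Delta$ is the Laplace-Beltrami operator. A lattice of rank two in $\mathbb{R}^2$ is the set of all integer linear combinations of two linearly independent vectors (a basis); the torus $\mathbb{R}^2/\Lambda$ carries the flat metric induced from $\mathbb{R}^2$. The lattice is rectangular if it has a basis of two orthogonal vectors (square lattices included). It is regular triangular (the honeycomb lattice) if it has a basis of two vectors of equal length forming an angle $2\pi/3$; i.e. up to dilation and rigid motion it is generated by $(1,0)$ and $(-\frac12,\frac{\sqrt3}{2})$. A minimal geodesic is a geodesic whose length equals the distance between its endpoints. A real-valued function $F$ on a Riemannian manifold $M$ decreases geodesically about a point $x\in M$ if $F(\gamma(s))$ is non-increasing in $s$ for every minimal geodesic $\gamma:[0,s_0]\to M$ with $\gamma(0)=x$. A function $G$ on $M\times M$ is geodesically decreasing if for each $x\in M$ the function $G(x,\cdot)$ decreases geodesically about $x$. It is strictly geodesically decreasing if for every $x\in M$ and every non-constant minimal geodesic $\gamma:[0,s_0]\to M$ with $\gamma(0)=x$, the function $s\mapsto G(x,\gamma(s))$ is strictly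 decreasing. *)

(* Defs.v *)
From Stdlib Require Import Reals.
From Coquelicot Require Import Coquelicot.
Open Scope R_scope.

Set Implicit Arguments.

(* Coquelicot's [plus], [minus], [scal] on [R * R] are componentwise, and its
   [norm] on a product is the Euclidean one, not the maximum norm. *)
Definition point := (R * R)%type.

Definition dot (p q : point) : R := fst p * fst q + snd p * snd q.

Definition det (p q : point) : R := fst p * snd q - snd p * fst q.

Definition angle (p q : point) : R := acos (dot p q / (norm p * norm q)).

Definition lin_indep (p q : point) : Prop :=
  forall a b : R, plus (scal a p) (scal b q) = zero -> a = 0 /\ b = 0.

Definition lattice_basis (Lam : point -> Prop) (v w : point) : Prop :=
  lin_indep v w /\
  forall p, Lam p <-> exists m n : Z, p = plus (scal (IZR m) v) (scal (IZR n) w).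

Definition rank_two_lattice (Lam : point -> Prop) : Prop :=
  exists v w, lattice_basis Lam v w.

Definition rectangular (Lam : point -> Prop) : Prop :=
  exists v w, lattice_basis Lam v w /\ dot v w = 0.

Definition regular_triangular (Lam : point -> Prop) : Prop :=
  exists v w, lattice_basis Lam v w /\ norm v = norm w /\ angle v w = 2 * PI / 3.

(* Functions on the torus R^2/Lam are represented by Lam-periodic functions on
   R^2, points of the torus by representatives, and curves by lifts to R^2. *)
Definition periodic (Lam : point -> Prop) (f : point -> R) : Prop :=
  forall l, Lam l -> forall p, f (plus p l) = f p.

(* The integral over the torus with respect to its Riemannian area, computed on
   the fundamental parallelogram spanned by the basis (v, w) of the lattice; it
   is only used for continuous integrands. *)
Definition torus_integral (v w : point) (f : point -> R) : R :=
  Rabs (det v w) *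
  RInt (fun a => RInt (fun b => f (plus (scal a v) (scal b w))) 0 1) 0 1.

Definition partial1 (f : point -> R) (p : point) : R :=
  Derive (fun a => f (a, snd p)) (fst p).

Definition partial2 (f : point -> R) (p : point) : R :=
  Derive (fun b => f (fst p, b)) (snd p).

Definition has_partials (f : point -> R) : Prop :=
  forall p, ex_derive (fun a => f (a, snd p)) (fst p) /\
            ex_derive (fun b => f (fst p, b)) (snd p).

Definition laplacian (f : point -> R) (p : point) : R :=
  partial1 (partial1 f) p + partial2 (partial2 f) p.

Definition time_derivative (u : R -> point -> R) (t : R) (p : point) : R :=
  Derive (fun s => u s p) t.

Definition jointly_continuous (u : R -> point -> R) : Prop :=
  forall t p, 0 < t ->
    continuous (fun z : R * point => u (fst z) (snd z)) (t, p).

(* u is C^1 in time and C^2 in space on (0, oo) x R^2. *)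
Definition class_C12 (u : R -> point -> R) : Prop :=
  (forall t p, 0 < t -> ex_derive (fun s => u s p) t) /\
  (forall t, 0 < t ->
     has_partials (u t) /\
     has_partials (partial1 (u t)) /\
     has_partials (partial2 (u t))) /\
  jointly_continuous u /\
  jointly_continuous (time_derivative u) /\
  jointly_continuous (fun t => partial1 (u t)) /\
  jointly_continuous (fun t => partial2 (u t)) /\
  jointly_continuous (fun t => partial1 (partial1 (u t))) /\
  jointly_continuous (fun t => partial1 (partial2 (u t))) /\
  jointly_continuous (fun t => partial2 (partial1 (u t))) /\
  jointly_continuous (fun t => partial2 (partial2 (u t))).

(* The last clause says that u(t, .) converges to the Dirac mass at x on the
   torus as t -> 0+. *)
Definition fundamental_solution
    (Lam : point -> Prop) (x : point) (u : R -> point -> R) : Prop :=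
  (forall t, 0 < t -> periodic Lam (u t)) /\
  class_C12 u /\
  (forall t y, 0 < t -> time_derivative u t y = laplacian (u t) y) /\
  (forall v w, lattice_basis Lam v w ->
   forall f : point -> R, (forall p, continuous f p) -> periodic Lam f ->
     filterlim (fun t => torus_integral v w (fun y => u t y * f y))
               (at_right 0) (locally (f x))).

(* Only the values at times t > 0 are constrained. *)
Definition heat_kernel
    (Lam : point -> Prop) (K : R -> point -> point -> R) : Prop :=
  (forall t y, 0 < t -> periodic Lam (fun x => K t x y)) /\
  (forall x, fundamental_solution Lam x (fun t y => K t x y)).

(* The distance on R^2/Lam between the classes of p and q; the set is nonempty
   and bounded below by 0, so the infimum is finite. *)
Definition torus_dist (Lam : point -> Prop) (p q : point) : R :=
  real (Glb_Rbar (fun d => exists l, Lam l /\ d = norm (plus (minus q p) l))).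

(* The geodesics of a flat torus are the projections of straight segments
   traversed at constant velocity c; the length is then s0 * |c|. *)
Definition minimal_geodesic
    (Lam : point -> Prop) (s0 : R) (gam : R -> point) : Prop :=
  0 <= s0 /\
  exists c : point,
    (forall s, 0 <= s <= s0 -> gam s = plus (gam 0) (scal s c)) /\
    s0 * norm c = torus_dist Lam (gam 0) (gam s0).

Definition nonconstant
    (Lam : point -> Prop) (s0 : R) (gam : R -> point) : Prop :=
  exists s, 0 <= s <= s0 /\ ~ Lam (minus (gam s) (gam 0)).

Definition decreases_geodesically_about
    (Lam : point -> Prop) (F : point -> R) (x : point) : Prop :=
  forall s0 gam, minimal_geodesic Lam s0 gam -> gam 0 = x ->
  forall s s', 0 <= s -> s <= s' -> s' <= s0 -> F (gam s') <= F (gam s).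

Definition geodesically_decreasing
    (Lam : point -> Prop) (G : point -> point -> R) : Prop :=
  forall x, decreases_geodesically_about Lam (G x) x.

Definition strictly_geodesically_decreasing
    (Lam : point -> Prop) (G : point -> point -> R) : Prop :=
  forall x s0 gam,
  minimal_geodesic Lam s0 gam -> nonconstant Lam s0 gam -> gam 0 = x ->
  forall s s', 0 <= s -> s < s' -> s' <= s0 -> G x (gam s') < G x (gam s).

(* Main.v *)
(* By pairing the heat equation with the characters of the torus one finds the Fourier coefficients
   of the heat kernel, hence K_t(x, x + z) = sum exp (- |xi|^2 t) cos (xi.z) / area over the dual
   lattice.

   (2) As t tends to infinity the variation of K_t is governed by the shortest dual vectors. In a
   reduced basis (v, w) with 0 < 2 v.w < |v|^2, this leading term increases at the end of the segment
   from 0 to a vertex of the Voronoi cell, which is a minimal geodesic.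

   (1) K_t is the limit of the heat flows V of the powers of the trigonometric polynomial
   kappa = cos 2 pi a + cos 2 pi b + cos 2 pi (a + b) + 3/2, normalized to have integral 1: they form
   an approximate identity. On a triangle which is a fundamental domain of the symmetry group of the
   lattice, two partial derivatives of V are nonpositive at time 0, and remain so because the
   reflections give boundary conditions that make them a cooperative system. Therefore K_t is
   nonincreasing along the segments from 0 in the Voronoi cell. It is also real analytic, so if it
   were constant on a piece of such a segment it would be constant on the whole line, whereas the
   Fourier series has a strict maximum on the lattice. *)
Require Import Defs.
From Stdlib Require Import Reals Lra Lia ZArith List FinFun ClassicalEpsilon.
From Coquelicot Require Import Coquelicot.
Open Scope R_scope.

(** * Integration over the unit square *)

(** The kernel is given by axioms and its initial condition is weak, so no value can be read off at
    small times. Testing against characters yields coefficients only; values are recovered by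
    summing with the weights that kappa^j induces on the coefficients. They play the part of the
    Fejer kernel, but kappa also has all the symmetries of the triangular lattice. One summation
    method therefore serves twice: it proves uniqueness for every lattice, and for the triangular
    one its partial results are the functions V. Each V is a finite sum of cosines, smooth up to t =
    0, so the maximum principle needs no regularity theory, and its initial signs follow from kappa
    >= 0 and d(kappa^j) = j kappa^(j-1) d(kappa). The limit in j loses strictness, which analyticity
    restores. In (2), the first coordinate of the vertex exceeds 1/2 because v.w > 0; for v.w = 0 it
    equals 1/2 and the obstruction vanishes. It also vanishes for |v|^2 = 2 v.w, where a third pair
    of dual vectors joins the shortest ones: these are the two families in the conclusion. *)

Lemma continuous_pair (U V W : UniformSpace) (f : U -> V) (g : U -> W) (x : U) :
  continuous f x -> continuous g x -> continuous (fun x => (f x, g x)) x.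
Proof.
  intros Hf Hg. apply filterlim_locally. intros eps.
  generalize (filter_and _ _ (proj1 (filterlim_locally _ _) Hf eps)
                             (proj1 (filterlim_locally _ _) Hg eps)).
  apply filter_imp. intros y [H1 H2]. now split.
Qed.

Lemma continuous_add (U : UniformSpace) (f g : U -> R) (x : U) :
  continuous f x -> continuous g x -> continuous (fun x => f x + g x) x.
Proof. exact (continuous_plus f g x). Qed.

Lemma continuous_sub (U : UniformSpace) (f g : U -> R) (x : U) :
  continuous f x -> continuous g x -> continuous (fun x => f x - g x) x.
Proof. exact (continuous_minus f g x). Qed.

Lemma continuous_mul (U : UniformSpace) (f g : U -> R) (x : U) :
  continuous f x -> continuous g x -> continuous (fun x => f x * g x) x.
Proof. exact (continuous_mult f g x). Qed.

Lemma continuous_power (U : UniformSpace) (f : U -> R) (n : nat) (x : U) :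
  continuous f x -> continuous (fun x => f x ^ n) x.
Proof.
  intros H. induction n; simpl; [apply continuous_const | now apply continuous_mul].
Qed.

Lemma continuous_Rabs_comp (U : UniformSpace) (f : U -> R) (x : U) :
  continuous f x -> continuous (fun x => Rabs (f x)) x.
Proof.
  intros H. apply (continuous_comp f Rabs); [exact H | ].
  apply continuity_pt_filterlim, Rcontinuity_abs.
Qed.

Lemma continuous_fst_comp (U V W : UniformSpace) (f : U -> V * W) (x : U) :
  continuous f x -> continuous (fun x => fst (f x)) x.
Proof.
  intros H. apply (continuous_comp f fst); [exact H | ]. destruct (f x). apply continuous_fst.
Qed.

Lemma continuous_snd_comp (U V W : UniformSpace) (f : U -> V * W) (x : U) :
  continuous f x -> continuous (fun x => snd (f x)) x.
Proof.
  intros H. apply (continuous_comp f snd); [exact H | ]. destruct (f x). apply continuous_snd.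
Qed.

Definition continuous2 (f : R -> R -> R) : Prop :=
  forall z : R * R, continuous (fun z : R * R => f (fst z) (snd z)) z.

Create HintDb continuous2.

Ltac prove_continuous :=
  cbv beta;
  lazymatch goal with
  | |- forall _, _ => intros; prove_continuous
  | |- continuous2 _ =>
      first [solve [auto with continuous2] | intros ?; prove_continuous]
  | |- continuous (fun _ => ?c) _ => apply continuous_const
  | |- continuous (fun x => x) _ => apply continuous_id
  | |- continuous (fun x => (@?f x + @?g x)%R) _ =>
      apply (continuous_add _ f g); prove_continuous
  | |- continuous (fun x => (@?f x - @?g x)%R) _ =>
      apply (continuous_sub _ f g); prove_continuous
  | |- continuous (fun x => (@?f x * @?g x)%R) _ =>
      apply (continuous_mul _ f g); prove_continuous
  | |- continuous (fun x => (@?f x / ?c)%R) _ =>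
      apply (continuous_mul _ f (fun _ => / c)); prove_continuous
  | |- continuous (fun x => (@?f x ^ ?n)%R) _ => apply (continuous_power _ f); prove_continuous
  | |- continuous (fun x => Rabs (@?f x)) _ => apply (continuous_Rabs_comp _ f); prove_continuous
  | |- continuous (fun x => cos (@?f x)) _ =>
      apply (continuous_comp f cos); [prove_continuous | apply continuous_cos]
  | |- continuous (fun x => exp (@?f x)) _ =>
      apply (continuous_comp f exp); [prove_continuous | apply continuous_exp]
  | |- continuous fst _ => apply (continuous_fst_comp _ _ _ (fun x => x)), continuous_id
  | |- continuous snd _ => apply (continuous_snd_comp _ _ _ (fun x => x)), continuous_id
  | |- continuous (fun x => fst (@?f x)) _ =>
      apply (continuous_fst_comp _ _ _ f); prove_continuous
  | |- continuous (fun x => snd (@?f x)) _ =>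
      apply (continuous_snd_comp _ _ _ f); prove_continuous
  | |- continuous (fun x => (@?f x, @?g x)) _ =>
      apply (continuous_pair _ _ _ f g); prove_continuous
  | _ => first [assumption | solve [auto] |
      match goal with
      | |- continuous (fun x => ?f (@?u x) (@?v x)) _ =>
          let H := fresh in assert (H : continuous2 f) by auto with continuous2;
          apply (continuous_comp_2 u v f); [prove_continuous | prove_continuous | apply H]
      | H : forall p, continuous ?f p |- continuous (fun x => ?f (@?u x)) _ =>
          apply (continuous_comp u f); [prove_continuous | apply H]
      end]
  end.

(** A tube argument: by compactness of the unit interval, the neighbourhoods given by joint
    continuity at the points [(p, b)] can be taken with one common radius. *)
Lemma near_uniformly_on_unit_interval (U : UniformSpace) (h : U -> R -> R) (p : U) :
  (forall b, 0 <= b <= 1 -> continuous (fun z : U * R => h (fst z) (snd z)) (p, b)) ->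
  forall eps : posreal,
  locally p (fun q => forall b, 0 <= b <= 1 -> Rabs (h q b - h p b) < eps).
Proof.
  intros Hc eps.
  assert (Hd : forall b, exists d : posreal, 0 <= b <= 1 ->
    forall q b', ball p d q -> Rabs (b' - b) < d -> Rabs (h q b' - h p b) < eps / 2).
  { intros b. destruct (classic (0 <= b <= 1)) as [Hb|Hb].
    2:{ exists (mkposreal 1 Rlt_0_1). tauto. }
    assert (He : 0 < eps / 2) by (destruct eps as [e He]; simpl; lra).
    destruct (proj1 (filterlim_locally _ _) (Hc b Hb) (mkposreal _ He)) as [d Hd].
    exists d. intros _ q b' Hq Hb'.
    apply (Hd (q, b')). split; simpl; [exact Hq | exact Hb']. }
  destruct (choice (fun b (d : posreal) => 0 <= b <= 1 ->
    forall q b', ball p d q -> Rabs (b' - b) < d -> Rabs (h q b' - h p b) < eps / 2)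
    Hd) as [delta Hdelta].
  destruct (compactness_value_1d 0 1 delta) as [d Hcov].
  exists d. intros q Hq b Hb.
  destruct (NNPP _ (Hcov b Hb)) as [t [Ht [Hbt Hdt]]].
  assert (H1 := Hdelta t Ht q b (ball_le _ _ _ Hdt _ Hq) Hbt).
  assert (H2 := Hdelta t Ht p b (ball_center _ _) Hbt).
  apply Rabs_def2 in H1. apply Rabs_def2 in H2. apply Rabs_def1; lra.
Qed.

Lemma continuous_section (U : UniformSpace) (h : U -> R -> R) (p : U) (b : R) :
  continuous (fun z : U * R => h (fst z) (snd z)) (p, b) -> continuous (h p) b.
Proof.
  intros H. apply (continuous_comp_2 (fun _ : R => p) (fun b => b) h).
  - apply continuous_const.
  - apply continuous_id.
  - exact H.
Qed.

Lemma ex_RInt_continuous_unit (f : R -> R) :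
  (forall x, 0 <= x <= 1 -> continuous f x) -> ex_RInt f 0 1.
Proof.
  intros H. apply (ex_RInt_continuous (V := R_CompleteNormedModule)).
  intros z Hz. apply H. rewrite Rmin_left, Rmax_right in Hz; lra.
Qed.

Lemma RInt_unit_bound (f : R -> R) (M : R) :
  (forall x, 0 <= x <= 1 -> continuous f x) ->
  (forall x, 0 <= x <= 1 -> Rabs (f x) <= M) -> Rabs (RInt f 0 1) <= M.
Proof.
  intros Hc HM.
  replace M with ((1 - 0) * M) by ring.
  apply abs_RInt_le_const; [lra | now apply ex_RInt_continuous_unit | exact HM].
Qed.

(** Continuity is asked for all [q] near [p], so that the integral of [h q] exists before it is
    compared with that of [h p]. *)
Lemma continuous_RInt_parameter (U : UniformSpace) (h : U -> R -> R) (p : U) :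
  locally p (fun q => forall b, 0 <= b <= 1 ->
    continuous (fun z : U * R => h (fst z) (snd z)) (q, b)) ->
  continuous (fun q => RInt (h q) 0 1) p.
Proof.
  intros Hl. assert (Hp := locally_singleton _ _ Hl). apply filterlim_locally. intros eps.
  assert (He : 0 < eps / 2) by (destruct eps as [e He]; simpl; lra).
  generalize (filter_and _ _ Hl (near_uniformly_on_unit_interval U h p Hp (mkposreal _ He))).
  apply filter_imp. intros q [Hcont Hq].
  assert (Hcq : forall b, 0 <= b <= 1 -> continuous (h q) b)
    by (intros; now apply continuous_section, Hcont).
  assert (Hcp : forall b, 0 <= b <= 1 -> continuous (h p) b)
    by (intros; now apply continuous_section, Hp).
  change (Rabs (RInt (h q) 0 1 - RInt (h p) 0 1) < eps).
  replace (RInt (h q) 0 1 - RInt (h p) 0 1)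
    with (RInt (fun b => h q b - h p b) 0 1).
  - apply Rle_lt_trans with (eps / 2).
    + apply RInt_unit_bound.
      * intros x Hx. apply (continuous_minus (h q) (h p)); auto.
      * intros x Hx. left. now apply Hq.
    + destruct eps as [e He']; simpl; lra.
  - apply (RInt_minus (V := R_CompleteNormedModule));
      apply ex_RInt_continuous_unit; auto.
Qed.

Definition unit_square_integral (f : R -> R -> R) : R :=
  RInt (fun a => RInt (fun b => f a b) 0 1) 0 1.

Local Notation I2 := unit_square_integral.

Lemma continuous2_section f a b : continuous2 f -> continuous (f a) b.
Proof. intros H. apply (continuous_section R_UniformSpace f a b), H. Qed.

Lemma continuous2_RInt f a : continuous2 f -> continuous (fun a => RInt (f a) 0 1) a.
Proof. intros H. apply (continuous_RInt_parameter R_UniformSpace f).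
  apply filter_forall. intros; apply H. Qed.

Lemma continuous2_add f g :
  continuous2 f -> continuous2 g -> continuous2 (fun a b => f a b + g a b).
Proof. intros Hf Hg. prove_continuous. Qed.

Lemma continuous2_scal c f : continuous2 f -> continuous2 (fun a b => c * f a b).
Proof. intros Hf. prove_continuous. Qed.

Lemma continuous2_shift f x y :
  continuous2 f -> continuous2 (fun a b => f (x + a) (y + b)).
Proof. intros H. prove_continuous. Qed.

Lemma I2_ext f g : (forall a b, f a b = g a b) -> I2 f = I2 g.
Proof.
  intros H. apply RInt_ext. intros a _. apply RInt_ext. intros b _. apply H.
Qed.

Lemma ex_RInt_section f a : continuous2 f -> ex_RInt (f a) 0 1.
Proof. intros H. apply ex_RInt_continuous_unit. intros; now apply continuous2_section. Qed.

Lemma ex_RInt_outer f : continuous2 f -> ex_RInt (fun a => RInt (f a) 0 1) 0 1.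
Proof. intros H. apply ex_RInt_continuous_unit. intros; now apply continuous2_RInt. Qed.

Lemma I2_plus f g :
  continuous2 f -> continuous2 g -> I2 (fun a b => f a b + g a b) = I2 f + I2 g.
Proof.
  intros Hf Hg. unfold I2.
  rewrite <- (RInt_plus (V := R_CompleteNormedModule)) by now apply ex_RInt_outer.
  apply RInt_ext. intros a _.
  apply (RInt_plus (V := R_CompleteNormedModule)); now apply ex_RInt_section.
Qed.

Lemma I2_scal c f : continuous2 f -> I2 (fun a b => c * f a b) = c * I2 f.
Proof.
  intros Hf. unfold I2.
  rewrite <- (RInt_scal (V := R_CompleteNormedModule)) by now apply ex_RInt_outer.
  apply RInt_ext. intros a _.
  apply (RInt_scal (V := R_CompleteNormedModule)); now apply ex_RInt_section.
Qed.

Lemma I2_minus f g :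
  continuous2 f -> continuous2 g -> I2 (fun a b => f a b - g a b) = I2 f - I2 g.
Proof.
  intros Hf Hg.
  rewrite (I2_ext _ (fun a b => f a b + (-1) * g a b)) by (intros; ring).
  rewrite I2_plus, I2_scal; try assumption.
  - ring.
  - prove_continuous.
Qed.

Lemma I2_le f g :
  continuous2 f -> continuous2 g -> (forall a b, f a b <= g a b) -> I2 f <= I2 g.
Proof.
  intros Hf Hg H. apply RInt_le; [lra | now apply ex_RInt_outer | now apply ex_RInt_outer | ].
  intros a _. apply RInt_le; [lra | now apply ex_RInt_section | now apply ex_RInt_section | ].
  intros b _. apply H.
Qed.

Lemma I2_const c : I2 (fun _ _ => c) = c.
Proof.
  unfold I2.
  rewrite (RInt_ext _ (fun _ => c)).
  - rewrite RInt_const. unfold scal; simpl; unfold mult; simpl. ring.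
  - intros a _. rewrite RInt_const. unfold scal; simpl; unfold mult; simpl. ring.
Qed.

Lemma I2_bound f M :
  continuous2 f -> (forall a b, Rabs (f a b) <= M) -> Rabs (I2 f) <= M.
Proof.
  intros Hf HM. apply Rabs_le. split.
  - rewrite <- (I2_const (-M)). apply I2_le; [prove_continuous | assumption | ].
    intros a b. specialize (HM a b). apply Rabs_le_between in HM. lra.
  - rewrite <- (I2_const M). apply I2_le; [assumption | prove_continuous | ].
    intros a b. specialize (HM a b). apply Rabs_le_between in HM. lra.
Qed.

Lemma RInt_unit_pos (f : R -> R) :
  (forall x, continuous f x) -> (forall x, 0 <= f x) -> 0 < f 0 -> 0 < RInt f 0 1.
Proof.
  intros Hc Hp H0.
  destruct (proj1 (filterlim_locally _ _) (Hc 0) (mkposreal _ H0)) as [d Hd].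
  set (r := Rmin (d / 2) 1).
  assert (Hr : 0 < r <= 1 /\ r < d).
  { unfold r. destruct d as [d Hdp]; simpl. destruct (Rle_dec (d / 2) 1).
    - rewrite Rmin_left; lra.
    - rewrite Rmin_right; lra. }
  assert (Hex : forall x y, ex_RInt f x y).
  { intros x y. apply (ex_RInt_continuous (V := R_CompleteNormedModule)). intros; apply Hc. }
  rewrite <- (RInt_Chasles (V := R_CompleteNormedModule) f 0 r 1) by apply Hex.
  change (0 < RInt f 0 r + RInt f r 1).
  assert (0 < RInt f 0 r).
  { apply RInt_gt_0; [tauto | | intros; apply Hc].
    intros x Hx. assert (Hb := Hd x).
    assert (Hx' : ball 0 d x).
    { change (Rabs (x - 0) < d). rewrite Rminus_0_r, Rabs_pos_eq; lra. }
    specialize (Hb Hx'). change (Rabs (f x - f 0) < f 0) in Hb.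
    apply Rabs_def2 in Hb. lra. }
  assert (0 <= RInt f r 1).
  { apply RInt_ge_0; [tauto | apply Hex | intros; apply Hp]. }
  lra.
Qed.

Lemma I2_pos f :
  continuous2 f -> (forall a b, 0 <= f a b) -> 0 < f 0 0 -> 0 < I2 f.
Proof.
  intros Hc Hp H0. apply RInt_unit_pos.
  - intros; now apply continuous2_RInt.
  - intros a. apply RInt_ge_0; [lra | now apply ex_RInt_section | intros; apply Hp].
  - apply RInt_unit_pos; [intros; now apply continuous2_section | apply Hp | exact H0].
Qed.

Lemma is_derive_value (f : R -> R) (x l l' : R) : l = l' -> is_derive f x l -> is_derive f x l'.
Proof. now intros <-. Qed.

Lemma is_derive_sub (f g : R -> R) (x a b : R) :
  is_derive f x a -> is_derive g x b -> is_derive (fun y => f y - g y) x (a - b).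
Proof. exact (is_derive_minus (K := R_AbsRing) (V := R_NormedModule) f g x a b). Qed.

Lemma ex_derive_continuous_R (f : R -> R) (x : R) : ex_derive f x -> continuous f x.
Proof. exact (ex_derive_continuous (K := R_AbsRing) (V := R_NormedModule) f x). Qed.

Lemma derive_zero_constant (f : R -> R) :
  (forall x, is_derive f x 0) -> forall x y, f x = f y.
Proof.
  intros H x y. destruct (MVT_gen f y x (fun _ => 0)) as [c [_ Hc]].
  - intros; apply H.
  - intros z _. apply continuity_pt_filterlim.
    apply ex_derive_continuous_R. now exists 0.
  - lra.
Qed.

(** The integral over the window from [x] to [x + 1] has derivative [f (x + 1) - f x = 0], so it
    does not depend on the window. *)
Lemma RInt_shift_periodic (f : R -> R) (c : R) :
  (forall x, continuous f x) -> (forall x, f (x + 1) = f x) ->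
  RInt (fun x => f (c + x)) 0 1 = RInt f 0 1.
Proof.
  intros Hc Hp.
  assert (Hex : forall x y, ex_RInt f x y).
  { intros x y. apply (ex_RInt_continuous (V := R_CompleteNormedModule)). intros; apply Hc. }
  assert (HG : forall x, is_derive (fun x => RInt f 0 x) x (f x)).
  { intros x. apply (is_derive_RInt (V := R_NormedModule) f _ 0 x).
    - apply filter_forall. intros y. apply (RInt_correct (V := R_CompleteNormedModule)), Hex.
    - apply Hc. }
  assert (Hconst : RInt f 0 (c + 1) - RInt f 0 c = RInt f 0 (0 + 1) - RInt f 0 0).
  { apply (derive_zero_constant (fun x => RInt f 0 (x + 1) - RInt f 0 x)).
    intros x. apply (is_derive_value _ _ (minus (f (x + 1)) (f x)));
      [unfold minus, plus, opp; simpl; rewrite Hp; ring | ].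
    apply (is_derive_minus (fun x => RInt f 0 (x + 1)) (fun x => RInt f 0 x)); [ | apply HG].
    apply (is_derive_value _ _ (scal 1 (f (x + 1)))); [apply (scal_one (K := R_Ring)) | ].
    apply (is_derive_comp (fun x => RInt f 0 x) (fun x => x + 1)); [apply HG | ].
    auto_derive; trivial. }
  assert (Hlin := RInt_comp_lin (V := R_CompleteNormedModule) f 1 c 0 1 (Hex _ _)).
  transitivity (RInt f (1 * 0 + c) (1 * 1 + c)).
  { rewrite <- Hlin. apply RInt_ext. intros x _.
    rewrite (scal_one (K := R_Ring)). f_equal. ring. }
  replace (1 * 0 + c) with c by ring. replace (1 * 1 + c) with (c + 1) by ring.
  rewrite Rplus_0_l in Hconst.
  rewrite (RInt_point (V := R_CompleteNormedModule)) in Hconst.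
  rewrite <- (RInt_Chasles (V := R_CompleteNormedModule) f 0 c (c + 1)) in Hconst by apply Hex.
  change (RInt f 0 c + RInt f c (c + 1) - RInt f 0 c = RInt f 0 1 - 0) in Hconst.
  lra.
Qed.

Definition periodic2 (f : R -> R -> R) : Prop :=
  (forall a b, f (a + 1) b = f a b) /\ (forall a b, f a (b + 1) = f a b).

Lemma I2_shift f x y :
  continuous2 f -> periodic2 f -> I2 (fun a b => f (x + a) (y + b)) = I2 f.
Proof.
  intros Hc [Hp1 Hp2]. unfold I2.
  transitivity (RInt (fun a => RInt (f (x + a)) 0 1) 0 1).
  - apply RInt_ext. intros a _.
    apply RInt_shift_periodic; [intros; now apply continuous2_section | apply Hp2].
  - apply (RInt_shift_periodic (fun a => RInt (f a) 0 1));
      [intros; now apply continuous2_RInt | ].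
    intros a. apply RInt_ext. intros b _. apply Hp1.
Qed.

(** The half-line [lo < s] suits a heat kernel, which is controlled at positive times only
    ([lo = 0]); for translations [lo = -1] is used. *)
Lemma is_derive_RInt_unit (f f' : R -> R -> R) (lo s : R) :
  (forall s b, lo < s -> is_derive (fun s => f s b) s (f' s b)) ->
  (forall s b, lo < s -> continuous (fun z : R * R => f' (fst z) (snd z)) (s, b)) ->
  (forall s, lo < s -> ex_RInt (f s) 0 1) ->
  lo < s -> is_derive (fun s => RInt (f s) 0 1) s (RInt (f' s) 0 1).
Proof.
  intros Hd Hc Hi Hs.
  assert (Hloc : forall P : R -> Prop, (forall x, lo < x -> P x) -> locally s P).
  { intros P HP. apply (locally_interval P s lo p_infty); simpl; trivial.
    intros y Hy _. now apply HP. }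
  apply (is_derive_value _ _ (RInt (fun b => Derive (fun s => f s b) s) 0 1)).
  { apply RInt_ext. intros b _. now apply is_derive_unique, Hd. }
  apply is_derive_RInt_param.
  - apply Hloc. intros x Hx b _. eexists. now apply Hd.
  - intros b _. apply continuity_2d_pt_filterlim.
    change (continuous (fun z : R * R => Derive (fun s => f s (snd z)) (fst z)) (s, b)).
    apply (continuous_ext_loc _ (fun z : R * R => f' (fst z) (snd z))); [ | now apply Hc].
    destruct (Hloc (fun x => lo < x) (fun x H => H)) as [e He].
    exists e. intros [x y] [Hx _]. symmetry. apply is_derive_unique, Hd, He, Hx.
  - now apply Hloc.
Qed.

Lemma is_derive_I2 (g g' : R -> R -> R -> R) (lo s : R) :
  (forall s, lo < s -> continuous2 (g s)) ->
  (forall s a b, lo < s -> is_derive (fun s => g s a b) s (g' s a b)) ->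
  (forall s a b, lo < s ->
     continuous (fun z : R * (R * R) => g' (fst z) (fst (snd z)) (snd (snd z))) (s, (a, b))) ->
  lo < s -> is_derive (fun s => I2 (g s)) s (I2 (g' s)).
Proof.
  intros Hg Hd Hc Hs.
  assert (Hc2 : forall s a b, lo < s ->
    continuous (fun z : R * R => g' (fst z) a (snd z)) (s, b)).
  { intros x a b Hx.
    apply (continuous_comp_2 (fun z : R * R => fst z) (fun z => (a, snd z))
      (fun s p => g' s (fst p) (snd p))); [prove_continuous | prove_continuous | now apply Hc]. }
  assert (Hc3 : forall s a b, lo < s ->
    continuous (fun z : (R * R) * R => g' (fst (fst z)) (snd (fst z)) (snd z)) ((s, a), b)).
  { intros x a b Hx.
    apply (continuous_comp_2 (fun z : (R * R) * R => fst (fst z))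
      (fun z => (snd (fst z), snd z)) (fun s p => g' s (fst p) (snd p)));
      [prove_continuous | prove_continuous | now apply Hc]. }
  apply (is_derive_RInt_unit (fun s a => RInt (g s a) 0 1) (fun s a => RInt (g' s a) 0 1) lo);
    [ | | intros; now apply ex_RInt_outer, Hg | exact Hs].
  - intros x a Hx. apply (is_derive_RInt_unit (fun s b => g s a b) (fun s b => g' s a b) lo).
    + intros; now apply Hd.
    + intros; now apply Hc2.
    + intros; now apply ex_RInt_section, Hg.
    + exact Hx.
  - intros x a Hx.
    apply (continuous_RInt_parameter (prod_UniformSpace R_UniformSpace R_UniformSpace)
      (fun p b => g' (fst p) (snd p) b)).
    destruct (locally_interval (fun y => lo < y) x lo p_infty Hx I (fun y H _ => H)) as [e He].
    exists e. intros [y a'] [Hy _] b _. apply Hc3, He, Hy.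
Qed.

(** * Fourier coefficients of a fundamental solution *)

Definition lattice_point (v w : point) (a b : R) : point := plus (scal a v) (scal b w).

Lemma point_ext (p q : point) : fst p = fst q -> snd p = snd q -> p = q.
Proof. destruct p, q; simpl; congruence. Qed.

Ltac point_ring :=
  apply point_ext; simpl; unfold plus, scal, zero, mult; simpl; unfold mult; simpl.

Lemma continuous_point (U : UniformSpace) (f : U -> point) (x : U) :
  continuous (fun x => fst (f x)) x -> continuous (fun x => snd (f x)) x -> continuous f x.
Proof.
  intros H1 H2.
  apply (continuous_ext (fun x => (fst (f x), snd (f x)))).
  - intros y. now destruct (f y).
  - now apply continuous_pair.
Qed.

Lemma continuous_lattice_point (U : UniformSpace) (v w : point) (f g : U -> R) (x : U) :
  continuous f x -> continuous g x -> continuous (fun x => lattice_point v w (f x) (g x)) x.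
Proof.
  intros Hf Hg. apply continuous_point.
  - change (continuous (fun x => f x * fst v + g x * fst w) x). prove_continuous.
  - change (continuous (fun x => f x * snd v + g x * snd w) x). prove_continuous.
Qed.

Lemma continuous2_lattice_point (v w : point) (f : point -> R) :
  (forall p, continuous f p) -> continuous2 (fun a b => f (lattice_point v w a b)).
Proof.
  intros H z.
  apply (continuous_comp (fun z : R * R => lattice_point v w (fst z) (snd z)) f); [ | apply H].
  apply continuous_lattice_point; prove_continuous.
Qed.

Definition invariant (v w : point) (f : point -> R) : Prop :=
  (forall p, f (plus p v) = f p) /\ (forall p, f (plus p w) = f p).

Lemma invariant_lattice_point v w f :
  invariant v w f -> periodic2 (fun a b => f (lattice_point v w a b)).
Proof.
  intros [Hv Hw]; split; intros a b.
  - rewrite <- (Hv (lattice_point v w a b)). f_equal.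
    point_ring; ring.
  - rewrite <- (Hw (lattice_point v w a b)). f_equal.
    point_ring; ring.
Qed.

Definition coord1 (v w p : point) : R := det p w / det v w.
Definition coord2 (v w p : point) : R := det v p / det v w.

Lemma lattice_point_coords v w p :
  det v w <> 0 -> lattice_point v w (coord1 v w p) (coord2 v w p) = p.
Proof.
  unfold coord1, coord2, det. intros H. destruct v as [v1 v2], w as [w1 w2], p as [p1 p2].
  simpl in *. point_ring; field; lra.
Qed.

(** Integration by parts without boundary terms: translation by [scal s e] preserves the integral of
    an invariant function, and the derivative in [s] of this constant is the integral of [h']. *)
Lemma I2_directional_derivative (v w e : point) (h h' : point -> R) :
  det v w <> 0 -> invariant v w h ->
  (forall p, continuous h p) -> (forall p, continuous h' p) ->
  (forall p s, is_derive (fun s => h (plus p (scal s e))) s (h' (plus p (scal s e)))) ->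
  I2 (fun a b => h' (lattice_point v w a b)) = 0.
Proof.
  intros Hdet Hinv Hc Hc' Hd.
  set (al := coord1 v w e). set (be := coord2 v w e).
  assert (Hpt : forall s a b, plus (lattice_point v w a b) (scal s e)
    = lattice_point v w (s * al + a) (s * be + b)).
  { intros s a b. rewrite <- (lattice_point_coords v w e Hdet). fold al be.
    point_ring; ring. }
  assert (H0 : is_derive (fun s => I2 (fun a b => h (plus (lattice_point v w a b) (scal s e)))) 0
    (I2 (fun a b => h' (plus (lattice_point v w a b) (scal 0 e))))).
  { apply (is_derive_I2 (fun s a b => h (plus (lattice_point v w a b) (scal s e)))
      (fun s a b => h' (plus (lattice_point v w a b) (scal s e))) (-1)); [ | | | lra].
    - intros s _.
      apply (continuous2_lattice_point v w (fun p => h (plus p (scal s e)))).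
      intros p. apply (continuous_comp (fun p : point => plus p (scal s e)) h); [ | apply Hc].
      apply (continuous_plus (fun p : point => p) (fun _ => scal s e));
        [apply continuous_id | apply continuous_const].
    - intros s a b _. apply Hd.
    - intros s a b _.
      apply (continuous_ext (fun z : R * (R * R) =>
        h' (lattice_point v w (fst z * al + fst (snd z)) (fst z * be + snd (snd z))))).
      { intros z. now rewrite Hpt. }
      apply (continuous_comp (fun z : R * (R * R) =>
        lattice_point v w (fst z * al + fst (snd z)) (fst z * be + snd (snd z))) h');
        [ | apply Hc'].
      apply continuous_lattice_point; prove_continuous. }
  transitivity (I2 (fun a b => h' (plus (lattice_point v w a b) (scal 0 e)))).
  { apply I2_ext. intros a b. rewrite Hpt. now rewrite !Rmult_0_l, !Rplus_0_l. }
  rewrite <- (is_derive_unique _ _ _ H0).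
  rewrite (Derive_ext _ (fun _ => I2 (fun a b => h (lattice_point v w a b)))).
  - apply Derive_const.
  - intros s.
    rewrite <- (I2_shift (fun a b => h (lattice_point v w a b)) (s * al) (s * be)).
    + apply I2_ext. intros a b. now rewrite Hpt.
    + now apply continuous2_lattice_point.
    + now apply invariant_lattice_point.
Qed.

Lemma derive_partial1 (f : point -> R) :
  has_partials f -> forall p s,
  is_derive (fun s => f (plus p (scal s (1, 0)))) s (partial1 f (plus p (scal s (1, 0)))).
Proof.
  intros Hf p s.
  assert (Hpt : forall s, plus p (scal s (1, 0)) = (fst p + s, snd p)).
  { intros x. point_ring; ring. }
  rewrite Hpt.
  apply (is_derive_ext (fun s => f (fst p + s, snd p))); [intros; now rewrite Hpt | ].
  apply (is_derive_value _ _ (scal 1 (partial1 f (fst p + s, snd p))));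
    [apply (scal_one (K := R_Ring)) | ].
  apply (is_derive_comp (fun a => f (a, snd p)) (fun s => fst p + s)).
  - apply Derive_correct. apply (proj1 (Hf (fst p + s, snd p))).
  - auto_derive; trivial.
Qed.

Lemma derive_partial2 (f : point -> R) :
  has_partials f -> forall p s,
  is_derive (fun s => f (plus p (scal s (0, 1)))) s (partial2 f (plus p (scal s (0, 1)))).
Proof.
  intros Hf p s.
  assert (Hpt : forall s, plus p (scal s (0, 1)) = (fst p, snd p + s)).
  { intros x. point_ring; ring. }
  rewrite Hpt.
  apply (is_derive_ext (fun s => f (fst p, snd p + s))); [intros; now rewrite Hpt | ].
  apply (is_derive_value _ _ (scal 1 (partial2 f (fst p, snd p + s))));
    [apply (scal_one (K := R_Ring)) | ].
  apply (is_derive_comp (fun b => f (fst p, b)) (fun s => snd p + s)).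
  - apply Derive_correct. apply (proj2 (Hf (fst p, snd p + s))).
  - auto_derive; trivial.
Qed.

(** With a free phase, differentiation amounts to adding [PI / 2] to [th], so one real family
    replaces cosines, sines and complex exponentials. *)
Definition character (xi : point) (th : R) (p : point) : R := cos (dot xi p + th).

Lemma continuous_dot (xi p : point) : continuous (fun p => dot xi p) p.
Proof.
  change (continuous (fun p : point => fst xi * fst p + snd xi * snd p) p). prove_continuous.
Qed.

Lemma continuous_character xi th p : continuous (character xi th) p.
Proof.
  assert (Hd := continuous_dot xi). unfold character. prove_continuous.
Qed.

Lemma derive_character xi th e p s :
  is_derive (fun s => character xi th (plus p (scal s e))) s
    (dot xi e * character xi (th + PI / 2) (plus p (scal s e))).
Proof.
  unfold character, dot, plus, scal; simpl; unfold plus, scal, mult; simpl; unfold mult; simpl.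
  auto_derive; trivial.
  rewrite <- Rplus_assoc, cos_plus, cos_PI2, sin_PI2. ring.
Qed.

Lemma character_half_turn xi th p : character xi (th + PI / 2 + PI / 2) p = - character xi th p.
Proof.
  unfold character. rewrite <- neg_cos. f_equal. field.
Qed.

Lemma I2_second_derivative (v w e xi : point) (th : R) (u u1 u2 : point -> R) :
  det v w <> 0 -> invariant v w u -> invariant v w u1 ->
  (forall th, invariant v w (character xi th)) ->
  (forall p, continuous u p) -> (forall p, continuous u1 p) -> (forall p, continuous u2 p) ->
  (forall p s, is_derive (fun s => u (plus p (scal s e))) s (u1 (plus p (scal s e)))) ->
  (forall p s, is_derive (fun s => u1 (plus p (scal s e))) s (u2 (plus p (scal s e)))) ->
  I2 (fun a b => u2 (lattice_point v w a b) * character xi th (lattice_point v w a b))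
  = - (dot xi e) ^ 2 *
    I2 (fun a b => u (lattice_point v w a b) * character xi th (lattice_point v w a b)).
Proof.
  intros Hdet Hu Hu1 Hchi Hcu Hcu1 Hcu2 Hd Hd1.
  set (k := dot xi e).
  assert (Hcc := continuous_character xi).
  assert (H : I2 (fun a b => u2 (lattice_point v w a b) * character xi th (lattice_point v w a b) +
    k ^ 2 * (u (lattice_point v w a b) * character xi th (lattice_point v w a b))) = 0).
  { apply (I2_directional_derivative v w e
      (fun p => u1 p * character xi th p - k * (u p * character xi (th + PI / 2) p))
      (fun p => u2 p * character xi th p + k ^ 2 * (u p * character xi th p))).
    - exact Hdet.
    - destruct Hu as [Ha Hb], Hu1 as [Hc He], (Hchi th) as [Hf Hg],
        (Hchi (th + PI / 2)) as [Hi Hj].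
      split; intros p.
      + now rewrite Ha, Hc, Hf, Hi.
      + now rewrite Hb, He, Hg, Hj.
    - prove_continuous.
    - prove_continuous.
    - intros p s.
      assert (H1 := derive_character xi th e p s).
      assert (H2 := derive_character xi (th + PI / 2) e p s).
      rewrite character_half_turn in H2.
      apply (is_derive_value _ _ (minus
        (u2 (plus p (scal s e)) * character xi th (plus p (scal s e)) +
         u1 (plus p (scal s e)) * (k * character xi (th + PI / 2) (plus p (scal s e))))
        (k * (u1 (plus p (scal s e)) * character xi (th + PI / 2) (plus p (scal s e)) +
         u (plus p (scal s e)) * (k * - character xi th (plus p (scal s e))))))).
      { unfold minus, plus, opp; simpl. unfold plus; simpl. ring. }
      apply (is_derive_minus
        (fun s => u1 (plus p (scal s e)) * character xi th (plus p (scal s e)))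
        (fun s => k * (u (plus p (scal s e)) * character xi (th + PI / 2) (plus p (scal s e))))).
      + apply (is_derive_mult (fun s => u1 (plus p (scal s e)))
          (fun s => character xi th (plus p (scal s e)))); [apply Hd1 | exact H1 | apply Rmult_comm].
      + apply (is_derive_scal
          (fun s => u (plus p (scal s e)) * character xi (th + PI / 2) (plus p (scal s e)))).
        apply (is_derive_mult (fun s => u (plus p (scal s e)))
          (fun s => character xi (th + PI / 2) (plus p (scal s e))));
          [apply Hd | exact H2 | apply Rmult_comm]. }
  assert (Hc1 : continuous2 (fun a b =>
    u2 (lattice_point v w a b) * character xi th (lattice_point v w a b))).
  { apply (continuous2_lattice_point v w (fun p => u2 p * character xi th p)). prove_continuous. }
  assert (Hc0 : continuous2 (fun a b =>
    u (lattice_point v w a b) * character xi th (lattice_point v w a b))).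
  { apply (continuous2_lattice_point v w (fun p => u p * character xi th p)). prove_continuous. }
  rewrite (I2_plus _ (fun a b => k ^ 2 *
    (u (lattice_point v w a b) * character xi th (lattice_point v w a b)))) in H; trivial.
  - rewrite (I2_scal _ _ Hc0) in H. lra.
  - now apply continuous2_scal.
Qed.

Lemma cos_period_Z (x : R) (k : Z) : cos (x + 2 * PI * IZR k) = cos x.
Proof.
  assert (H : forall (y : R) (n : nat), cos (y + 2 * PI * INR n) = cos y).
  { intros y n. replace (2 * PI * INR n) with (2 * INR n * PI) by ring. apply cos_period. }
  destruct (Z.le_gt_cases 0 k) as [Hk|Hk].
  - rewrite <- (Z2Nat.id k Hk), <- INR_IZR_INZ. apply H.
  - rewrite <- (H (x + 2 * PI * IZR k) (Z.to_nat (- k))).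
    rewrite INR_IZR_INZ, Z2Nat.id, opp_IZR by lia. f_equal. ring.
Qed.

Lemma lattice_basis_det Lam v w : lattice_basis Lam v w -> det v w <> 0.
Proof.
  intros [Hind _] H. destruct v as [v1 v2], w as [w1 w2]. unfold det in H; simpl in H.
  assert (H1 := Hind w2 (- v2)). assert (H2 := Hind (- w1) v1). assert (H3 := Hind 1 0).
  assert (E1 : w2 = 0 /\ - v2 = 0) by (apply H1; point_ring; lra).
  assert (E2 : - w1 = 0 /\ v1 = 0) by (apply H2; point_ring; lra).
  assert (E3 : 1 = 0 /\ 0 = 0) by (apply H3; point_ring; lra).
  lra.
Qed.

Lemma lattice_basis_mem Lam v w (m n : Z) :
  lattice_basis Lam v w -> Lam (lattice_point v w (IZR m) (IZR n)).
Proof. intros [_ H]. apply H. now exists m, n. Qed.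

Lemma lattice_point_1_0 v w : lattice_point v w 1 0 = v.
Proof.
  point_ring; ring.
Qed.

Lemma lattice_point_0_1 v w : lattice_point v w 0 1 = w.
Proof.
  point_ring; ring.
Qed.

Lemma periodic_invariant Lam v w f : lattice_basis Lam v w -> periodic Lam f -> invariant v w f.
Proof.
  intros Hb Hp. split; apply Hp.
  - rewrite <- (lattice_point_1_0 v w). now apply (lattice_basis_mem Lam v w 1 0).
  - rewrite <- (lattice_point_0_1 v w). now apply (lattice_basis_mem Lam v w 0 1).
Qed.

Lemma character_periodic Lam v w xi th (m n : Z) :
  lattice_basis Lam v w -> dot xi v = 2 * PI * IZR m -> dot xi w = 2 * PI * IZR n ->
  periodic Lam (character xi th).
Proof.
  intros [_ Hb] Hv Hw l Hl p. destruct (proj1 (Hb l) Hl) as [i [j ->]].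
  unfold character. rewrite <- (cos_period_Z (dot xi p + th) (i * m + j * n)).
  f_equal. rewrite plus_IZR, !mult_IZR.
  replace (2 * PI * (IZR i * IZR m + IZR j * IZR n))
    with (IZR i * (2 * PI * IZR m) + IZR j * (2 * PI * IZR n)) by ring.
  rewrite <- Hv, <- Hw.
  unfold dot, plus, scal, mult; simpl; unfold plus, scal, mult; simpl; unfold mult; simpl. ring.
Qed.

Lemma partial1_invariant v w f : invariant v w f -> invariant v w (partial1 f).
Proof.
  intros [Hv Hw].
  assert (H : forall e, (forall p, f (plus p e) = f p) ->
    forall p, partial1 f (plus p e) = partial1 f p).
  { intros e He [p1 p2]. destruct e as [e1 e2]. unfold partial1; simpl.
    change (Derive (fun a => f (a, p2 + e2)) (p1 + e1) = Derive (fun a => f (a, p2)) p1).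
    rewrite <- (Derive_ext (fun a => f (a + e1, p2 + e2)) (fun a => f (a, p2)))
      by (intros a; apply (He (a, p2))).
    unfold Derive. f_equal. apply Lim_ext. intros h. do 3 f_equal. f_equal. ring. }
  split; now apply H.
Qed.

Lemma partial2_invariant v w f : invariant v w f -> invariant v w (partial2 f).
Proof.
  intros [Hv Hw].
  assert (H : forall e, (forall p, f (plus p e) = f p) ->
    forall p, partial2 f (plus p e) = partial2 f p).
  { intros e He [p1 p2]. destruct e as [e1 e2]. unfold partial2; simpl.
    change (Derive (fun b => f (p1 + e1, b)) (p2 + e2) = Derive (fun b => f (p1, b)) p2).
    rewrite <- (Derive_ext (fun b => f (p1 + e1, b + e2)) (fun b => f (p1, b)))
      by (intros b; apply (He (p1, b))).
    unfold Derive. f_equal. apply Lim_ext. intros h. do 3 f_equal. f_equal. ring. }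
  split; now apply H.
Qed.

Lemma jointly_continuous_slice u t p : jointly_continuous u -> 0 < t -> continuous (u t) p.
Proof.
  intros H Ht.
  apply (continuous_comp (fun p : point => (t, p)) (fun z : R * point => u (fst z) (snd z))).
  - prove_continuous.
  - now apply H.
Qed.

(* [J' = -|xi|^2 J] for the pairing [J] of [u] with a character, and [J] tends to the value of the
   character at [x] as the time tends to 0. *)
Lemma fundamental_solution_fourier Lam v w x u xi th (m n : Z) t :
  lattice_basis Lam v w -> fundamental_solution Lam x u ->
  dot xi v = 2 * PI * IZR m -> dot xi w = 2 * PI * IZR n -> 0 < t ->
  torus_integral v w (fun y => u t y * character xi th y)
  = exp (- dot xi xi * t) * character xi th x.
Proof.
  intros Hb [Hper [[Htime [Hspace [Hu [Hut [Hu1 [Hu2 [Hu11 [_ [_ Hu22]]]]]]]]] [Heq Hlim]]] Hv Hw Ht.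
  assert (Hdet := lattice_basis_det _ _ _ Hb).
  assert (Hchi : forall th, invariant v w (character xi th)).
  { intros. eapply periodic_invariant; [exact Hb | ]. now apply (character_periodic Lam v w xi _ m n). }
  assert (Hcc := continuous_character xi).
  set (J := fun t => torus_integral v w (fun y => u t y * character xi th y)).
  set (lam := dot xi xi).
  assert (Hcu : forall s, 0 < s -> continuous2 (fun a b =>
    u s (lattice_point v w a b) * character xi th (lattice_point v w a b))).
  { intros s Hs. apply (continuous2_lattice_point v w (fun p => u s p * character xi th p)).
    assert (H := fun p => jointly_continuous_slice u s p Hu Hs). prove_continuous. }
  assert (HJ : forall s, 0 < s -> is_derive J s (- lam * J s)).
  { intros s Hs. unfold J, torus_integral.
    change (is_derive (fun s => Rabs (det v w) * I2 (fun a b =>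
      u s (lattice_point v w a b) * character xi th (lattice_point v w a b))) s
      (- lam * (Rabs (det v w) * I2 (fun a b =>
      u s (lattice_point v w a b) * character xi th (lattice_point v w a b))))).
    apply (is_derive_value _ _ (Rabs (det v w) * I2 (fun a b =>
      time_derivative u s (lattice_point v w a b) * character xi th (lattice_point v w a b)))).
    - rewrite <- Rmult_assoc, (Rmult_comm (- lam)), Rmult_assoc. f_equal.
      destruct (Hspace s Hs) as [Hp0 [Hp1 Hp2]].
      assert (Hsl := fun f Hf p => jointly_continuous_slice f s p Hf Hs).
      assert (Hc0 := Hsl _ Hu). assert (Hc1 := Hsl _ Hu1). assert (Hc2 := Hsl _ Hu2).
      assert (Hc11 := Hsl _ Hu11). assert (Hc22 := Hsl _ Hu22). cbv beta in Hc1, Hc2, Hc11, Hc22.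
      assert (Hinv : invariant v w (u s)) by (apply (periodic_invariant Lam); auto).
      assert (G1 := I2_second_derivative v w (1, 0) xi th (u s) (partial1 (u s))
        (partial1 (partial1 (u s))) Hdet Hinv (partial1_invariant _ _ _ Hinv) Hchi Hc0 Hc1 Hc11
        (derive_partial1 _ Hp0) (derive_partial1 _ Hp1)).
      assert (G2 := I2_second_derivative v w (0, 1) xi th (u s) (partial2 (u s))
        (partial2 (partial2 (u s))) Hdet Hinv (partial2_invariant _ _ _ Hinv) Hchi Hc0 Hc2 Hc22
        (derive_partial2 _ Hp0) (derive_partial2 _ Hp2)).
      rewrite (I2_ext _ (fun a b =>
        partial1 (partial1 (u s)) (lattice_point v w a b) * character xi th (lattice_point v w a b) +
        partial2 (partial2 (u s)) (lattice_point v w a b) * character xi th (lattice_point v w a b))).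
      + rewrite I2_plus.
        * rewrite G1, G2. unfold lam, dot; simpl. ring.
        * apply (continuous2_lattice_point v w
            (fun p => partial1 (partial1 (u s)) p * character xi th p)).
          prove_continuous.
        * apply (continuous2_lattice_point v w
            (fun p => partial2 (partial2 (u s)) p * character xi th p)).
          prove_continuous.
      + intros a b. rewrite (Heq s _ Hs). unfold laplacian. ring.
    - apply (is_derive_scal (fun s => I2 (fun a b =>
        u s (lattice_point v w a b) * character xi th (lattice_point v w a b)))).
      apply (is_derive_I2 (fun s a b =>
        u s (lattice_point v w a b) * character xi th (lattice_point v w a b))
        (fun s a b =>
        time_derivative u s (lattice_point v w a b) * character xi th (lattice_point v w a b)) 0);
        [exact Hcu | | | exact Hs].
      + intros r a b Hr.
        apply (is_derive_ext (fun s => character xi th (lattice_point v w a b) *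
          u s (lattice_point v w a b))); [intros; apply Rmult_comm | ].
        apply (is_derive_value _ _ (character xi th (lattice_point v w a b) *
          time_derivative u r (lattice_point v w a b))); [apply Rmult_comm | ].
        apply (is_derive_scal (fun s => u s (lattice_point v w a b))).
        apply Derive_correct. now apply Htime.
      + intros r a b Hr.
        assert (Hpt : continuous (fun z : R * (R * R) =>
          lattice_point v w (fst (snd z)) (snd (snd z))) (r, (a, b))).
        { apply continuous_lattice_point; prove_continuous. }
        apply (continuous_mul _ (fun z : R * (R * R) => time_derivative u (fst z)
          (lattice_point v w (fst (snd z)) (snd (snd z))))
          (fun z : R * (R * R) => character xi th (lattice_point v w (fst (snd z)) (snd (snd z))))).
        * apply (continuous_comp_2 (fun z : R * (R * R) => fst z)
            (fun z => lattice_point v w (fst (snd z)) (snd (snd z))) (time_derivative u)).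
          -- apply continuous_fst.
          -- exact Hpt.
          -- now apply Hut.
        * apply (continuous_comp (fun z : R * (R * R) =>
            lattice_point v w (fst (snd z)) (snd (snd z))) (character xi th));
            [exact Hpt | apply continuous_character]. }
  (* With the integrating factor, [E] is constant at positive times; hence [E t] is its limit at 0,
     which the initial condition computes. *)
  set (E := fun s => exp (lam * s) * J s).
  assert (HE : forall s, 0 < s -> is_derive E s 0).
  { intros s Hs.
    apply (is_derive_value _ _ (lam * exp (lam * s) * J s + exp (lam * s) * (- lam * J s)));
      [ring | ].
    apply (is_derive_mult (fun s => exp (lam * s)) J); [ | now apply HJ | apply Rmult_comm].
    auto_derive; trivial. ring. }
  assert (Hconst : forall s, 0 < s -> E s = E t).
  { intros s Hs. destruct (MVT_gen E t s (fun _ => 0)) as [c [_ Hc]].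
    - intros y Hy. apply HE. apply Rle_lt_trans with (2 := proj1 Hy).
      apply Rmin_case; lra.
    - intros y Hy. apply continuity_pt_filterlim.
      apply ex_derive_continuous_R. exists 0. apply HE.
      apply Rlt_le_trans with (2 := proj1 Hy). apply Rmin_case; lra.
    - lra. }
  assert (HlimE : filterlim E (at_right 0) (locally (character xi th x))).
  { replace (character xi th x) with (exp (lam * 0) * character xi th x)
      by (rewrite Rmult_0_r, exp_0; ring).
    apply (filterlim_comp_2 (G := locally (exp (lam * 0)))
      (H := locally (character xi th x)) (fun s => exp (lam * s)) J Rmult).
    - apply (filterlim_filter_le_1 (F := locally 0)); [apply filter_le_within | ].
      apply (ex_derive_continuous_R (fun s => exp (lam * s))).
      auto_derive; trivial.
    - apply (Hlim v w Hb (character xi th)).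
      + apply continuous_character.
      + now apply (character_periodic Lam v w xi th m n).
    - apply (filterlim_mult (K := R_AbsRing)). }
  assert (HE2 : filterlim E (at_right 0) (locally (E t))).
  { apply (filterlim_ext_loc (fun _ => E t)); [ | apply filterlim_const].
    exists (mkposreal 1 Rlt_0_1). intros y _ Hy. symmetry. now apply Hconst. }
  assert (Hval : E t = character xi th x).
  { exact (filterlim_locally_unique (K := R_AbsRing) (V := R_NormedModule) E _ _ HE2 HlimE). }
  change (J t = exp (- lam * t) * character xi th x).
  rewrite <- Hval. unfold E. rewrite <- Rmult_assoc, <- exp_plus.
  replace (- lam * t + lam * t) with 0 by ring. rewrite exp_0. ring.
Qed.

(** * An approximate identity on the torus *)

Lemma periodic2_Z f (m n : Z) a b : periodic2 f -> f (a + IZR m) (b + IZR n) = f a b.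
Proof.
  intros [H1 H2].
  assert (H : forall g : R -> R, (forall x, g (x + 1) = g x) -> forall (k : Z) x, g (x + IZR k) = g x).
  { intros g Hg.
    assert (Hn : forall (j : nat) x, g (x + INR j) = g x).
    { induction j; intros x; [simpl; f_equal; ring | ].
      rewrite S_INR, <- Rplus_assoc, Hg. apply IHj. }
    intros k x. destruct (Z.le_gt_cases 0 k) as [Hk|Hk].
    - rewrite <- (Z2Nat.id k Hk), <- INR_IZR_INZ. apply Hn.
    - rewrite <- (Hn (Z.to_nat (- k)) (x + IZR k)).
      rewrite INR_IZR_INZ, Z2Nat.id, opp_IZR by lia. f_equal. ring. }
  rewrite (H (fun a => f a (b + IZR n))) by (intros; apply H1).
  apply (H (f a)). intros; apply H2.
Qed.

Definition wave (m n : Z) (th a b : R) : R := cos (2 * PI * (IZR m * a + IZR n * b) + th).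

Lemma wave_neg m n th a b : wave (- m) (- n) (- th) a b = wave m n th a b.
Proof.
  unfold wave. rewrite <- cos_neg, !opp_IZR. f_equal. ring.
Qed.

Lemma continuous2_wave m n th : continuous2 (wave m n th).
Proof.
  unfold wave. prove_continuous.
Qed.

#[local] Hint Resolve continuous2_wave : continuous2.

Lemma periodic2_wave m n th : periodic2 (wave m n th).
Proof.
  split; intros a b; unfold wave.
  - rewrite <- (cos_period_Z (_ * (IZR m * a + _) + th) m). f_equal. ring.
  - rewrite <- (cos_period_Z (_ * (IZR m * a + IZR n * b) + th) n). f_equal. ring.
Qed.

(** In a basis with [dot v w = dot v v / 2] the frequencies [(1, 0)], [(0, 1)], [(1, 1)] and their
    opposites are the six shortest dual vectors, whence the hexagonal symmetry. The constant 3/2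
    compensates the minimum -3/2 of the three cosines, reached at a = b = 1/3. *)
Definition hexagonal_kernel (a b : R) : R := wave 1 0 0 a b + wave 0 1 0 a b + wave 1 1 0 a b + 3 / 2.

Local Notation kap := hexagonal_kernel.

Lemma continuous2_kernel : continuous2 kap.
Proof.
  unfold kap. prove_continuous.
Qed.

#[local] Hint Resolve continuous2_kernel : continuous2.

Lemma wave_range m n th a b : -1 <= wave m n th a b <= 1.
Proof. apply COS_bound. Qed.

Lemma kernel_at_0 : kap 0 0 = 9 / 2.
Proof.
  unfold kap, wave.
  replace (cos (2 * PI * (1 * 0 + 0 * 0) + 0)) with 1 by (rewrite <- cos_0; f_equal; ring).
  replace (cos (2 * PI * (0 * 0 + 1 * 0) + 0)) with 1 by (rewrite <- cos_0; f_equal; ring).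
  replace (cos (2 * PI * (1 * 0 + 1 * 0) + 0)) with 1 by (rewrite <- cos_0; f_equal; ring).
  field.
Qed.

Lemma kernel_nonneg a b : 0 <= kap a b.
Proof.
  unfold kap, wave.
  set (s := PI * (a + b)). set (d := PI * (a - b)).
  replace (2 * PI * (1 * a + 0 * b) + 0) with (s + d) by (unfold s, d; ring).
  replace (2 * PI * (0 * a + 1 * b) + 0) with (s - d) by (unfold s, d; ring).
  replace (2 * PI * (1 * a + 1 * b) + 0) with (2 * s) by (unfold s; ring).
  rewrite cos_plus, cos_minus, cos_2a_cos.
  assert (H := COS_bound d).
  assert (Hx : cos d * cos d <= 1) by nra.
  (* The kernel equals 2 (cos s + cos d / 2)^2 + (1 - (cos d)^2) / 2. *)
  assert (Hsq := Rle_0_sqr (cos s + cos d / 2)). unfold Rsqr in Hsq. lra.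
Qed.

Lemma kernel_le a b : kap a b <= 9 / 2.
Proof.
  unfold kap. assert (H1 := wave_range 1 0 0 a b). assert (H2 := wave_range 0 1 0 a b).
  assert (H3 := wave_range 1 1 0 a b). lra.
Qed.

Lemma near_integer (d : R) : 0 < d -> exists eta, 0 < eta <= 1 /\
  forall x, 1 - eta < cos (2 * PI * x) -> exists m : Z, Rabs (x - IZR m) < d.
Proof.
  (* The bound 1/4 keeps [2 * PI * r] in the first quadrant, so that [eta] is at most 1. *)
  intros Hd. set (r := Rmin d (1 / 4)).
  assert (Hr : 0 < r <= 1 / 4 /\ r <= d).
  { unfold r. repeat split; [apply Rmin_case; lra | apply Rmin_r | apply Rmin_l]. }
  assert (Hpi := PI_RGT_0).
  assert (Hpr : 0 < 2 * PI * r <= PI / 2) by (split; nra).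
  exists (1 - cos (2 * PI * r)). split.
  - split.
    + assert (H : cos (2 * PI * r) < cos 0) by (apply cos_decreasing_1; lra).
      rewrite cos_0 in H. lra.
    + assert (0 <= cos (2 * PI * r)) by (apply cos_ge_0; lra). lra.
  (* This is an integer nearest to [x], at distance at most 1/2, where the cosine is monotone. *)
  - intros x Hx. exists (up (x - 1 / 2)).
    destruct (archimed (x - 1 / 2)) as [H1 H2].
    set (m := up (x - 1 / 2)) in *.
    apply Rlt_le_trans with r; [ | tauto].
    apply Rnot_le_lt. intros Hle.
    assert (Hc : cos (2 * PI * x) = cos (2 * PI * Rabs (x - IZR m))).
    { rewrite <- (cos_period_Z (2 * PI * x) (- m)), opp_IZR.
      replace (2 * PI * x + 2 * PI * - IZR m) with (2 * PI * (x - IZR m)) by ring.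
      unfold Rabs. destruct (Rcase_abs (x - IZR m)); trivial.
      rewrite <- cos_neg. f_equal. ring. }
    assert (cos (2 * PI * Rabs (x - IZR m)) <= cos (2 * PI * r)).
    { assert (Rabs (x - IZR m) <= 1 / 2) by (apply Rabs_le; lra).
      apply cos_decr_1; nra. }
    lra.
Qed.

(** The set where the kernel exceeds [rho] has positive measure, and [C] is a continuous substitute
    for this measure. *)
Lemma kernel_power_lower_bound (rho : R) : 0 < rho < 9 / 2 ->
  exists C, 0 < C /\ forall j, C * rho ^ j <= I2 (fun a b => kap a b ^ j).
Proof.
  intros Hrho.
  (* This is 2/9 times the positive part of [kap - rho]; as [kap] is at most 9/2, it lies between 0
     and 1 and vanishes where [kap <= rho], so it stands in for an indicator function. *)
  set (psi := fun a b => (kap a b - rho + Rabs (kap a b - rho)) / 9).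
  assert (Hpsi : continuous2 psi).
  { unfold psi. prove_continuous. }
  exists (I2 psi). split.
  - apply I2_pos; trivial.
    + intros a b. unfold psi. assert (H := Rle_abs (- (kap a b - rho))). rewrite Rabs_Ropp in H. lra.
    + unfold psi. rewrite kernel_at_0, Rabs_pos_eq; lra.
  - intros j. rewrite Rmult_comm, <- I2_scal by assumption.
    apply I2_le; [prove_continuous | prove_continuous | ].
    intros a b. assert (Hn := kernel_nonneg a b). assert (Hl := kernel_le a b).
    assert (Hp : 0 < rho ^ j) by (apply pow_lt; lra). unfold psi.
    destruct (Rle_dec rho (kap a b)) as [Hle|Hgt].
    + rewrite Rabs_pos_eq by lra.
      apply Rle_trans with (rho ^ j); [nra | ]. apply pow_incr. lra.
    + rewrite Rabs_left by lra. assert (0 <= kap a b ^ j) by now apply pow_le. nra.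
Qed.

Lemma kernel_power_integral_pos j : 0 < I2 (fun a b => kap a b ^ j).
Proof.
  destruct (kernel_power_lower_bound 1 ltac:(lra)) as [C [HC H]].
  specialize (H j). rewrite pow1 in H. lra.
Qed.

(** Where [kap] is above 9/2 - eta, the point is near a lattice point and [D] is near [D 0 0].
    Elsewhere the power is at most (9/2 - eta)^j, which is negligible against the normalizing
    integral. *)
Lemma approximate_identity (D : R -> R -> R) :
  continuous2 D -> periodic2 D ->
  is_lim_seq (fun j => I2 (fun a b => D a b * kap a b ^ j) / I2 (fun a b => kap a b ^ j)) (D 0 0).
Proof.
  intros Hc Hp. apply is_lim_seq_spec. intros eps.
  assert (He : 0 < eps / 2) by (destruct eps as [e He]; simpl; lra).
  destruct (proj1 (filterlim_locally _ _) (Hc (0, 0)) (mkposreal _ He)) as [d Hd].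
  destruct (near_integer d (cond_pos d)) as [eta [Heta Hnear]].
  assert (Hclose : forall a b, 9 / 2 - eta < kap a b -> Rabs (D a b - D 0 0) < eps / 2).
  { intros a b Hab. unfold kap in Hab.
    assert (H1 := wave_range 1 0 0 a b). assert (H2 := wave_range 0 1 0 a b).
    assert (H3 := wave_range 1 1 0 a b).
    destruct (Hnear a) as [m Hm].
    { replace (2 * PI * a) with (2 * PI * (1 * a + 0 * b) + 0) by ring.
      change (1 - eta < wave 1 0 0 a b). lra. }
    destruct (Hnear b) as [n Hn].
    { replace (2 * PI * b) with (2 * PI * (0 * a + 1 * b) + 0) by ring.
      change (1 - eta < wave 0 1 0 a b). lra. }
    rewrite <- (periodic2_Z D (- m) (- n) a b Hp), !opp_IZR.
    apply (Hd (a + - IZR m, b + - IZR n)). split; simpl.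
    - change (Rabs (a - IZR m - 0) < d). now rewrite Rminus_0_r.
    - change (Rabs (b - IZR n - 0) < d). now rewrite Rminus_0_r. }
  set (M := I2 (fun a b => Rabs (D a b - D 0 0))).
  assert (HcD : continuous2 (fun a b => Rabs (D a b - D 0 0))).
  { prove_continuous. }
  assert (HM : 0 <= M).
  { rewrite <- (I2_const 0). apply I2_le; [prove_continuous | assumption | ].
    intros; apply Rabs_pos. }
  (* The intermediate level 9/2 - eta/2 makes the ratio [q] of the two bounds strictly less than
     1. *)
  destruct (kernel_power_lower_bound (9 / 2 - eta / 2) ltac:(lra)) as [C [HC HlowC]].
  set (q := (9 / 2 - eta) / (9 / 2 - eta / 2)).
  assert (Hq : 0 <= q < 1).
  { unfold q. split; [apply Rle_mult_inv_pos; lra | apply Rlt_div_l; lra]. }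
  destruct (pow_lt_1_zero q ltac:(rewrite Rabs_pos_eq; tauto) (C * (eps / 2) / (M + 1)))
    as [N HN].
  { apply Rdiv_lt_0_compat; [apply Rmult_lt_0_compat | ]; lra. }
  exists N. intros j Hj.
  assert (Hck : continuous2 (fun a b => kap a b ^ j)) by prove_continuous.
  assert (Hpos := kernel_power_integral_pos j).
  set (Z := I2 (fun a b => kap a b ^ j)) in *.
  assert (HcDk : continuous2 (fun a b => D a b * kap a b ^ j)) by prove_continuous.
  assert (Hcsum : continuous2 (fun a b => eps / 2 * kap a b ^ j
      + (9 / 2 - eta) ^ j * Rabs (D a b - D 0 0))).
  { prove_continuous. }
  assert (Hsum : I2 (fun a b => eps / 2 * kap a b ^ j
      + (9 / 2 - eta) ^ j * Rabs (D a b - D 0 0)) = eps / 2 * Z + (9 / 2 - eta) ^ j * M).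
  { rewrite I2_plus by prove_continuous. now rewrite !I2_scal. }
  assert (Hpt : forall a b, Rabs (D a b - D 0 0) * kap a b ^ j <= eps / 2 * kap a b ^ j
      + (9 / 2 - eta) ^ j * Rabs (D a b - D 0 0)).
  { intros a b. assert (Hn := kernel_nonneg a b).
    assert (Hk : 0 <= kap a b ^ j) by now apply pow_le.
    assert (Ha := Rabs_pos (D a b - D 0 0)).
    assert (He' : 0 <= (9 / 2 - eta) ^ j) by (apply pow_le; lra).
    destruct (Rlt_dec (9 / 2 - eta) (kap a b)) as [Hlt|Hge].
    - specialize (Hclose a b Hlt). nra.
    - assert (kap a b ^ j <= (9 / 2 - eta) ^ j) by (apply pow_incr; lra). nra. }
  assert (HD0 : I2 (fun a b => D a b * kap a b ^ j - D 0 0 * kap a b ^ j)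
      = I2 (fun a b => D a b * kap a b ^ j) - D 0 0 * Z).
  { now rewrite I2_minus, I2_scal by prove_continuous. }
  assert (Hcdiff : continuous2 (fun a b => D a b * kap a b ^ j - D 0 0 * kap a b ^ j)).
  { prove_continuous. }
  assert (Hbound : Rabs (I2 (fun a b => D a b * kap a b ^ j) - D 0 0 * Z)
      <= eps / 2 * Z + (9 / 2 - eta) ^ j * M).
  { rewrite <- HD0, <- Hsum. apply Rabs_le. split.
    - rewrite <- (Rmult_1_l (I2 (fun a b => eps / 2 * _ + _))), <- Ropp_mult_distr_l_reverse,
        <- I2_scal by assumption.
      apply I2_le; trivial.
      + prove_continuous.
      + intros a b. specialize (Hpt a b).
        assert (Hk : 0 <= kap a b ^ j) by apply pow_le, kernel_nonneg.
        assert (Ha := Rle_abs (- (D a b - D 0 0))). rewrite Rabs_Ropp in Ha. nra.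
    - apply I2_le; trivial. intros a b. specialize (Hpt a b).
      assert (Hk : 0 <= kap a b ^ j) by apply pow_le, kernel_nonneg.
      assert (Ha := Rle_abs (D a b - D 0 0)). nra. }
  replace (I2 (fun a b => D a b * kap a b ^ j) / Z - D 0 0)
    with ((I2 (fun a b => D a b * kap a b ^ j) - D 0 0 * Z) / Z) by (field; lra).
  unfold Rdiv. rewrite Rabs_mult, (Rabs_pos_eq (/ Z)) by (left; now apply Rinv_0_lt_compat).
  apply Rlt_div_l; [assumption | ].
  assert (Hg : (9 / 2 - eta) ^ j * M < eps / 2 * Z).
  { specialize (HN j Hj). rewrite Rabs_pos_eq in HN by (apply pow_le; tauto).
    specialize (HlowC j). fold Z in HlowC.
    assert (Hrho : 0 < (9 / 2 - eta / 2) ^ j) by (apply pow_lt; lra).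
    assert (Hqj : (9 / 2 - eta) ^ j = q ^ j * (9 / 2 - eta / 2) ^ j).
    { rewrite <- Rpow_mult_distr. f_equal. unfold q. field. lra. }
    rewrite Hqj.
    apply Rlt_div_r in HN; [ | lra]. rewrite Rmult_plus_distr_l, Rmult_1_r in HN.
    assert (Hqn : 0 <= q ^ j) by (apply pow_le; tauto).
    apply Rlt_le_trans with (eps / 2 * (C * (9 / 2 - eta / 2) ^ j));
      [ | apply Rmult_le_compat_l; lra].
    replace (q ^ j * (9 / 2 - eta / 2) ^ j * M) with (q ^ j * M * (9 / 2 - eta / 2) ^ j) by ring.
    rewrite <- Rmult_assoc. apply Rmult_lt_compat_r; lra. }
  lra.
Qed.

(** * Summation of Fourier series *)

(** The arbitrary phase [th] encodes cosine and sine coefficients at once: [th = PI / 2] says that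
    the sine coefficients vanish, as for an even function. *)
Definition has_fourier_coefficients (k : R -> R -> R) (c : Z -> Z -> R) : Prop :=
  continuous2 k /\ periodic2 k /\
  forall m n th, I2 (fun a b => k a b * wave m n th a b) = c m n * cos th.

Lemma periodic2_mult f g : periodic2 f -> periodic2 g -> periodic2 (fun a b => f a b * g a b).
Proof. intros [H1 H2] [H3 H4]; split; intros; now rewrite ?H1, ?H2, ?H3, ?H4. Qed.

Lemma fourier_shift k c x y m n : has_fourier_coefficients k c ->
  I2 (fun a b => k (x + a) (y + b) * wave m n 0 a b) = c m n * wave m n 0 x y.
Proof.
  intros [Hc [Hp H]].
  set (th := - (2 * PI * (IZR m * x + IZR n * y))).
  transitivity (I2 (fun a b => k a b * wave m n th a b)).
  - rewrite <- (I2_shift (fun a b => k a b * wave m n th a b) x y).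
    + apply I2_ext. intros a b. f_equal. unfold wave, th. f_equal. ring.
    + prove_continuous.
    + apply periodic2_mult; [assumption | apply periodic2_wave].
  - rewrite H. f_equal. unfold wave, th. rewrite cos_neg. f_equal. ring.
Qed.

(** Multiplication by [kap], seen on the coefficients: each of the six frequencies of [kap] has
    weight 1/2, and the constant term 3/2 leaves the index fixed. *)
Definition hexagonal_step (f : Z -> Z -> R) (m n : Z) : R :=
  3 / 2 * f m n + 1 / 2 * (f (m + 1)%Z n + f (m - 1)%Z n + f m (n + 1)%Z + f m (n - 1)%Z
    + f (m + 1)%Z (n + 1)%Z + f (m - 1)%Z (n - 1)%Z).

Fixpoint hexagonal_walk (f : Z -> Z -> R) (j : nat) (m n : Z) : R :=
  match j with
  | O => f m n
  | S j => hexagonal_step (hexagonal_walk f j) m n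
  end.

Lemma kernel_times_wave m n a b :
  kap a b * wave m n 0 a b = hexagonal_step (fun m n => wave m n 0 a b) m n.
Proof.
  unfold hexagonal_step, kap, wave. rewrite !plus_IZR, !minus_IZR.
  set (X := 2 * PI * (IZR m * a + IZR n * b) + 0).
  set (x := 2 * PI * a). set (y := 2 * PI * b).
  replace (2 * PI * (1 * a + 0 * b) + 0) with x by (unfold x; ring).
  replace (2 * PI * (0 * a + 1 * b) + 0) with y by (unfold y; ring).
  replace (2 * PI * (1 * a + 1 * b) + 0) with (x + y) by (unfold x, y; ring).
  replace (2 * PI * ((IZR m + 1) * a + IZR n * b) + 0) with (X + x) by (unfold X, x; ring).
  replace (2 * PI * ((IZR m - 1) * a + IZR n * b) + 0) with (X - x) by (unfold X, x; ring).
  replace (2 * PI * (IZR m * a + (IZR n + 1) * b) + 0) with (X + y) by (unfold X, y; ring).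
  replace (2 * PI * (IZR m * a + (IZR n - 1) * b) + 0) with (X - y) by (unfold X, y; ring).
  replace (2 * PI * ((IZR m + 1) * a + (IZR n + 1) * b) + 0) with (X + (x + y))
    by (unfold X, x, y; ring).
  replace (2 * PI * ((IZR m - 1) * a + (IZR n - 1) * b) + 0) with (X - (x + y))
    by (unfold X, x, y; ring).
  rewrite !(cos_plus X), !(cos_minus X). field.
Qed.

(** Moves the power of the kernel from the integrand to the coefficients, where it becomes a finite
    combination; thus the left side depends on [g] only through [c]. *)
Lemma I2_kernel_power_wave g (c : Z -> Z -> R) :
  continuous2 g -> (forall m n, I2 (fun a b => g a b * wave m n 0 a b) = c m n) ->
  forall j m n, I2 (fun a b => g a b * kap a b ^ j * wave m n 0 a b) = hexagonal_walk c j m n.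
Proof.
  intros Hg H. induction j; intros m n; simpl.
  - rewrite <- H. apply I2_ext. intros. ring.
  - unfold hexagonal_step. rewrite <- !IHj.
    assert (Hc : forall m n, continuous2 (fun a b => g a b * kap a b ^ j * wave m n 0 a b)).
    { prove_continuous. }
    rewrite <- !I2_plus by prove_continuous.
    rewrite <- !I2_scal by prove_continuous.
    rewrite <- I2_plus.
    + apply I2_ext. intros a b.
      transitivity (g a b * kap a b ^ j * (kap a b * wave m n 0 a b)); [ring | ].
      rewrite kernel_times_wave. unfold hexagonal_step. ring.
    + prove_continuous.
    + prove_continuous.
Qed.

(** Recovers a value from the coefficients with no assumption on their decay. The shift by [(x, y)]
    moves the peak of the kernel to the wanted point and multiplies each coefficient by a wave. *)
Lemma fourier_summation k c x y : has_fourier_coefficients k c ->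
  is_lim_seq (fun j => hexagonal_walk (fun m n => c m n * wave m n 0 x y) j 0 0
    / I2 (fun a b => kap a b ^ j)) (k x y).
Proof.
  intros Hk. destruct Hk as [Hc [Hp H]].
  assert (Hl := approximate_identity (fun a b => k (x + a) (y + b))
    (continuous2_shift k x y Hc)).
  replace (k x y) with (k (x + 0) (y + 0)) by now rewrite !Rplus_0_r.
  eapply is_lim_seq_ext; [ | apply Hl].
  - intros j. cbv beta. f_equal.
    rewrite <- (I2_kernel_power_wave (fun a b => k (x + a) (y + b))).
    + apply I2_ext. intros a b. unfold wave.
      replace (2 * PI * (0 * a + 0 * b) + 0) with 0 by ring. rewrite cos_0. ring.
    + now apply continuous2_shift.
    + intros. now apply fourier_shift.
  - destruct Hp as [H1 H2]. split; intros; rewrite <- Rplus_assoc; auto.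
Qed.

Lemma hexagonal_walk_ext f g : (forall m n, f m n = g m n) ->
  forall j m n, hexagonal_walk f j m n = hexagonal_walk g j m n.
Proof.
  intros H. induction j; intros; simpl; [apply H | ]. unfold hexagonal_step. now rewrite !IHj.
Qed.

Lemma fourier_uniqueness k k' c :
  has_fourier_coefficients k c -> has_fourier_coefficients k' c -> forall x y, k x y = k' x y.
Proof.
  intros H H' x y.
  assert (L := is_lim_seq_unique _ _ (fourier_summation k c x y H)).
  assert (L' := is_lim_seq_unique _ _ (fourier_summation k' c x y H')).
  rewrite L in L'. now injection L'.
Qed.

Lemma RInt_cos (n : Z) (th : R) :
  RInt (fun x => cos (2 * PI * (IZR n * x) + th)) 0 1 = if Z.eq_dec n 0 then cos th else 0.
Proof.
  destruct (Z.eq_dec n 0) as [->|Hn].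
  - rewrite (RInt_ext _ (fun _ => cos th)).
    + rewrite RInt_const. unfold scal; simpl; unfold mult; simpl. ring.
    + intros x _. f_equal. ring.
  - assert (Hn' : IZR n <> 0) by now apply not_0_IZR.
    assert (Hpi := PI_RGT_0).
    assert (H : is_RInt (fun x => cos (2 * PI * (IZR n * x) + th)) 0 1
      (minus (sin (2 * PI * (IZR n * 1) + th) / (2 * PI * IZR n))
             (sin (2 * PI * (IZR n * 0) + th) / (2 * PI * IZR n)))).
    { apply (is_RInt_derive (V := R_CompleteNormedModule)
        (fun x => sin (2 * PI * (IZR n * x) + th) / (2 * PI * IZR n))).
      - intros x _. auto_derive; trivial. field. lra.
      - intros x _. apply (continuous_comp (fun x => 2 * PI * (IZR n * x) + th) cos);
          [ | apply continuous_cos].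
        apply ex_derive_continuous_R.
        auto_derive; trivial. }
    rewrite (is_RInt_unique _ _ _ _ H). unfold minus, plus, opp; simpl.
    replace (sin (2 * PI * (IZR n * 1) + th)) with (sin (2 * PI * (IZR n * 0) + th)); [ring | ].
    rewrite <- !cos_shift.
    rewrite <- (cos_period_Z _ (- n)), opp_IZR. f_equal. ring.
Qed.

Lemma I2_wave m n th :
  I2 (wave m n th) = if Z.eq_dec m 0 then if Z.eq_dec n 0 then cos th else 0 else 0.
Proof.
  unfold I2, wave.
  rewrite (RInt_ext _ (fun a => if Z.eq_dec n 0 then cos (2 * PI * (IZR m * a) + th) else 0)).
  - destruct (Z.eq_dec n 0).
    + apply RInt_cos.
    + rewrite RInt_const. unfold scal; simpl; unfold mult; simpl.
      destruct (Z.eq_dec m 0); ring.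
  - intros a _. rewrite <- RInt_cos. apply RInt_ext. intros b _. f_equal. ring.
Qed.

(** * Dominated series of functions and their integrals *)

Lemma ex_series_dominated (f B : nat -> R) :
  (forall N, Rabs (f N) <= B N) -> ex_series B -> ex_series f.
Proof. exact (ex_series_le (K := R_AbsRing) (V := R_CompleteNormedModule) f B). Qed.

Lemma ex_series_const_mul (c : R) (f : nat -> R) : ex_series f -> ex_series (fun N => c * f N).
Proof. exact (ex_series_scal (K := R_AbsRing) (V := R_NormedModule) c f). Qed.

Lemma series_tail_bound (f B : nat -> R) :
  (forall N, Rabs (f N) <= B N) -> ex_series B ->
  forall J, Rabs (Series f - sum_n f J) <= Series B - sum_n B J.
Proof.
  intros Hf HB J.
  assert (Hfs : ex_series f).
  { apply (ex_series_dominated f B); assumption. }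
  assert (Hft : ex_series (fun k => f (S J + k)%nat)) by now apply ex_series_incr_n.
  assert (HBt : ex_series (fun k => B (S J + k)%nat)) by now apply ex_series_incr_n.
  rewrite (Series_incr_n f (S J)) by (try lia; assumption).
  rewrite (Series_incr_n B (S J)) by (try lia; assumption).
  simpl pred. rewrite !sum_n_Reals.
  replace (sum_f_R0 f J + Series (fun k => f (S J + k)%nat) - sum_f_R0 f J)
    with (Series (fun k => f (S J + k)%nat)) by ring.
  replace (sum_f_R0 B J + Series (fun k => B (S J + k)%nat) - sum_f_R0 B J)
    with (Series (fun k => B (S J + k)%nat)) by ring.
  assert (Habs : ex_series (fun k => Rabs (f (S J + k)%nat))).
  { apply (ex_series_dominated _
      (fun k => B (S J + k)%nat)); [ | assumption].
    intros k. change (Rabs (Rabs (f (S J + k)%nat)) <= B (S J + k)%nat).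
    rewrite Rabs_Rabsolu. apply Hf. }
  apply Rle_trans with (1 := Series_Rabs _ Habs).
  apply Series_le; [ | assumption]. intros k. split; [apply Rabs_pos | apply Hf].
Qed.

Lemma series_tail_small (B : nat -> R) (eps : R) :
  ex_series B -> 0 < eps -> exists J0, forall J, (J0 <= J)%nat -> Series B - sum_n B J < eps.
Proof.
  intros HB He.
  destruct (proj2 (is_lim_seq_spec (sum_n B) (Series B)) (Series_correct _ HB) (mkposreal _ He))
    as [J0 H].
  exists J0. intros J HJ. specialize (H J HJ). simpl in H. apply Rabs_def2 in H. lra.
Qed.

Section UniformSeries.

Variables (f : nat -> R -> R -> R) (B : nat -> R).
Hypothesis Hcont : forall N, continuous2 (f N).
Hypothesis Hbound : forall N a b, Rabs (f N a b) <= B N.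
Hypothesis HB : ex_series B.

Lemma continuous2_sum_n J : continuous2 (fun a b => sum_n (fun N => f N a b) J).
Proof.
  induction J.
  - intros z. apply (continuous_ext (fun z : R * R => f 0%nat (fst z) (snd z))); [ | apply Hcont].
    intros y. now rewrite sum_O.
  - intros z.
    apply (continuous_ext (fun z : R * R => sum_n (fun N => f N (fst z) (snd z)) J
      + f (S J) (fst z) (snd z))).
    + intros y. now rewrite sum_Sn.
    + exact (continuous2_add _ _ IHJ (Hcont (S J)) z).
Qed.

Lemma continuous2_Series : continuous2 (fun a b => Series (fun N => f N a b)).
Proof.
  intros z. apply filterlim_locally. intros eps.
  assert (He : 0 < eps / 3) by (destruct eps as [e He]; simpl; lra).
  destruct (series_tail_small B (eps / 3) HB He) as [J HJ].
  generalize (proj1 (filterlim_locally _ _) (continuous2_sum_n J z) (mkposreal _ He)).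
  apply filter_imp. intros y Hy.
  change (Rabs (sum_n (fun N => f N (fst y) (snd y)) J - sum_n (fun N => f N (fst z) (snd z)) J)
    < eps / 3) in Hy.
  change (Rabs (Series (fun N => f N (fst y) (snd y)) - Series (fun N => f N (fst z) (snd z))) < eps).
  assert (H1 := series_tail_bound (fun N => f N (fst y) (snd y)) B
    (fun N => Hbound N _ _) HB J).
  assert (H2 := series_tail_bound (fun N => f N (fst z) (snd z)) B
    (fun N => Hbound N _ _) HB J).
  specialize (HJ J (le_n J)).
  apply Rabs_def2 in Hy. apply Rabs_le_between in H1. apply Rabs_le_between in H2.
  apply Rabs_def1; lra.
Qed.

Lemma I2_sum_n J : I2 (fun a b => sum_n (fun N => f N a b) J) = sum_n (fun N => I2 (f N)) J.
Proof.
  induction J.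
  - rewrite sum_O. apply I2_ext. intros. now rewrite sum_O.
  - rewrite sum_Sn, <- IHJ. unfold plus; simpl.
    rewrite <- I2_plus by (apply continuous2_sum_n || apply Hcont).
    apply I2_ext. intros. now rewrite sum_Sn.
Qed.

Lemma I2_Series : I2 (fun a b => Series (fun N => f N a b)) = Series (fun N => I2 (f N)).
Proof.
  symmetry. apply is_series_unique.
  apply (is_lim_seq_spec (sum_n (fun N => I2 (f N)))
    (I2 (fun a b => Series (fun N => f N a b)))). intros eps.
  destruct (series_tail_small B eps HB (cond_pos eps)) as [J0 HJ].
  exists J0. intros J HJJ. specialize (HJ J HJJ).
  rewrite <- I2_sum_n, <- I2_minus by (apply continuous2_sum_n || apply continuous2_Series).
  apply Rle_lt_trans with (2 := HJ).
  apply I2_bound.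
  - assert (H1 := continuous2_sum_n J). assert (H2 := continuous2_Series).
    exact (fun z => continuous_sub _ _ _ z (H1 z) (H2 z)).
  - intros a b. rewrite Rabs_minus_sym.
    apply (series_tail_bound (fun N => f N a b)); [intros; apply Hbound | exact HB].
Qed.

End UniformSeries.

(** * Sums over the square shells of the integer lattice *)

Definition rsum {A : Type} (l : list A) (f : A -> R) : R := fold_right (fun p s => f p + s) 0 l.

Lemma rsum_ext {A} (l : list A) f g : (forall p, In p l -> f p = g p) -> rsum l f = rsum l g.
Proof. induction l; simpl; intros H; [reflexivity | ]. rewrite IHl, H; auto. Qed.

Lemma rsum_le {A} (l : list A) f g : (forall p, In p l -> f p <= g p) -> rsum l f <= rsum l g.
Proof.
  induction l; simpl; intros H; [lra | ]. apply Rplus_le_compat; auto.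
Qed.

Lemma rsum_const {A} (l : list A) c : rsum l (fun _ => c) = INR (length l) * c.
Proof.
  induction l; [simpl; ring | ].
  change (c + rsum l (fun _ => c) = INR (S (length l)) * c). rewrite S_INR, IHl. ring.
Qed.

Lemma rsum_scal {A} (l : list A) c f : rsum l (fun p => c * f p) = c * rsum l f.
Proof. induction l; simpl; [ring | ]. rewrite IHl. ring. Qed.

Lemma rsum_plus {A} (l : list A) f g : rsum l (fun p => f p + g p) = rsum l f + rsum l g.
Proof. induction l; simpl; [ring | ]. rewrite IHl. ring. Qed.

Lemma rsum_Rabs {A} (l : list A) f : Rabs (rsum l f) <= rsum l (fun p => Rabs (f p)).
Proof.
  induction l; simpl; [rewrite Rabs_R0; lra | ].
  apply Rle_trans with (1 := Rabs_triang _ _). lra.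
Qed.

Lemma rsum_nonneg {A} (l : list A) f : (forall p, In p l -> 0 <= f p) -> 0 <= rsum l f.
Proof.
  intros H. apply Rle_trans with (rsum l (fun _ => 0)); [rewrite rsum_const; lra | ].
  now apply rsum_le.
Qed.

Lemma continuous2_rsum {A} (l : list A) (f : A -> R -> R -> R) :
  (forall p, continuous2 (f p)) -> continuous2 (fun a b => rsum l (fun p => f p a b)).
Proof.
  intros H. induction l; simpl; [prove_continuous | now apply continuous2_add].
Qed.

Lemma I2_rsum {A} (l : list A) (f : A -> R -> R -> R) :
  (forall p, continuous2 (f p)) ->
  I2 (fun a b => rsum l (fun p => f p a b)) = rsum l (fun p => I2 (f p)).
Proof.
  intros H. induction l; simpl; [apply I2_const | ].
  rewrite <- IHl. apply I2_plus; [apply H | now apply continuous2_rsum].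
Qed.

Lemma Z_pair_eq_dec (p q : Z * Z) : {p = q} + {p <> q}.
Proof. decide equality; apply Z.eq_dec. Qed.

Lemma rsum_single (l : list (Z * Z)) (q : Z * Z) (f : Z * Z -> R) : NoDup l ->
  rsum l (fun p => if Z_pair_eq_dec p q then f p else 0)
  = if in_dec Z_pair_eq_dec q l then f q else 0.
Proof.
  induction l as [|p l IH]; intros Hl; [reflexivity | ].
  inversion Hl as [|? ? Hp Hl']; subst. specialize (IH Hl').
  change ((if Z_pair_eq_dec p q then f p else 0)
    + rsum l (fun p => if Z_pair_eq_dec p q then f p else 0)
    = if in_dec Z_pair_eq_dec q (p :: l) then f q else 0).
  rewrite IH.
  destruct (Z_pair_eq_dec p q) as [->|Hpq].
  - destruct (in_dec Z_pair_eq_dec q l); [contradiction | ].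
    destruct (in_dec Z_pair_eq_dec q (q :: l)) as [|n0]; [ring | ].
    exfalso; apply n0; now left.
  - destruct (in_dec Z_pair_eq_dec q l); destruct (in_dec Z_pair_eq_dec q (p :: l)) as [Hin|Hin];
      simpl in Hin; try ring; exfalso; tauto.
Qed.

Lemma NoDup_list_prod {A B : Type} (l : list A) (l' : list B) :
  NoDup l -> NoDup l' -> NoDup (list_prod l l').
Proof.
  intros Hl Hl'. induction Hl as [|x l Hx Hl IH]; [constructor | ].
  simpl. apply NoDup_app; [ | exact IH | ].
  - apply Injective_map_NoDup; [ | exact Hl']. intros y y' E. congruence.
  - intros [y z] H1 H2. apply in_map_iff in H1 as [z' [E _]]. apply in_prod_iff in H2.
    injection E as -> _. tauto.
Qed.

Definition integer_range (N : nat) : list Z :=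
  map (fun i => Z.of_nat i - Z.of_nat N)%Z (seq 0 (2 * N + 1)).

(** Grouping by the maximum norm turns a double sum into a series over [nat]; a pair and its
    opposite fall in the same shell. *)
Definition shell (N : nat) : list (Z * Z) :=
  filter (fun p => Z.max (Z.abs (fst p)) (Z.abs (snd p)) =? Z.of_nat N)%Z
    (list_prod (integer_range N) (integer_range N)).

Lemma integer_range_spec N z : In z (integer_range N) <-> (Z.abs z <= Z.of_nat N)%Z.
Proof.
  unfold integer_range. rewrite in_map_iff. split.
  - intros [i [<- Hi]]. apply in_seq in Hi. lia.
  - intros H. exists (Z.to_nat (z + Z.of_nat N)). rewrite in_seq. lia.
Qed.

Lemma shell_spec N p :
  In p (shell N) <-> Z.max (Z.abs (fst p)) (Z.abs (snd p)) = Z.of_nat N.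
Proof.
  unfold shell. rewrite filter_In, Z.eqb_eq. destruct p as [m n]; simpl.
  rewrite in_prod_iff, !integer_range_spec. lia.
Qed.

Lemma shell_NoDup N : NoDup (shell N).
Proof.
  apply NoDup_filter, NoDup_list_prod; apply Injective_map_NoDup;
    try apply seq_NoDup; intros i j; lia.
Qed.

Lemma shell_length N : INR (length (shell N)) <= (2 * INR N + 1) ^ 2.
Proof.
  apply Rle_trans with (INR ((2 * N + 1) * (2 * N + 1))).
  - apply le_INR. unfold shell. eapply Nat.le_trans; [apply filter_length_le | ].
    rewrite length_prod. unfold integer_range. rewrite length_map, length_seq. lia.
  - rewrite mult_INR, plus_INR, mult_INR. simpl (INR 2). simpl (INR 1). lra.
Qed.

Definition shell_sum (e : Z -> Z -> R) (N : nat) : R :=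
  rsum (shell N) (fun p => e (fst p) (snd p)).

Lemma shell_summable (f : Z -> Z -> R) (A c : R) :
  0 < c -> (forall m n, 0 <= f m n) ->
  (forall N m n, In (m, n) (shell N) -> f m n <= A * exp (- c * INR N)) ->
  ex_series (shell_sum f).
Proof.
  intros Hc Hpos Hf.
  assert (HA : 0 <= A).
  { assert (Hin : In (0, 0)%Z (shell 0)) by now apply shell_spec.
    specialize (Hf 0%nat _ _ Hin). simpl in Hf. rewrite Rmult_0_r, exp_0 in Hf.
    specialize (Hpos 0%Z 0%Z). lra. }
  (* Chosen so that [2 * INR N + 1 <= K * exp (c / 4 * INR N)]: the squared bound on the length of
     the shell then uses up half of the exponential decay. *)
  set (K := 1 + 8 / c).
  assert (HK : 1 <= K) by (unfold K; assert (0 < 8 / c) by (apply Rdiv_lt_0_compat; lra); lra).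
  apply (ex_series_dominated _
    (fun N => scal (A * K ^ 2) (exp (- c / 2) ^ N))).
  - intros N. change (Rabs (rsum (shell N) (fun p => f (fst p) (snd p)))
      <= A * K ^ 2 * exp (- c / 2) ^ N).
    rewrite Rabs_pos_eq by (apply rsum_nonneg; intros; apply Hpos).
    apply Rle_trans with (rsum (shell N) (fun _ => A * exp (- c * INR N))).
    { apply rsum_le. intros [m n] H. now apply Hf. }
    rewrite rsum_const.
    replace (exp (- c / 2) ^ N) with (exp (- c / 2 * INR N)).
    2:{ induction N; [simpl; rewrite Rmult_0_r; apply exp_0 | ].
        rewrite S_INR, Rmult_plus_distr_l, exp_plus, IHN, Rmult_1_r. simpl. ring. }
    assert (HN := pos_INR N).
    assert (E1 : exp (- c * INR N) = exp (- c / 2 * INR N) * exp (- c / 2 * INR N))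
      by (rewrite <- exp_plus; f_equal; field).
    assert (E2 : exp (c / 4 * INR N) ^ 2 * exp (- c / 2 * INR N) = 1).
    { simpl. rewrite Rmult_1_r, <- !exp_plus, <- exp_0. f_equal. field. }
    assert (E3 : 2 * INR N + 1 <= K * exp (c / 4 * INR N)).
    { apply Rle_trans with (K * (1 + c / 4 * INR N)).
      - unfold K. replace ((1 + 8 / c) * (1 + c / 4 * INR N))
          with (1 + 8 / c + c / 4 * INR N + 2 * INR N) by (field; lra).
        assert (0 < 8 / c) by (apply Rdiv_lt_0_compat; lra). nra.
      - apply Rmult_le_compat_l; [lra | ]. apply exp_ineq1_le. }
    assert (HL := shell_length N).
    assert (Hsq : INR (length (shell N)) <= K ^ 2 * exp (c / 4 * INR N) ^ 2).
    { apply Rle_trans with (1 := HL). rewrite <- Rpow_mult_distr. apply pow_incr. lra. }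
    rewrite E1.
    assert (He := exp_pos (- c / 2 * INR N)).
    assert (INR (length (shell N)) * exp (- c / 2 * INR N) <= K ^ 2).
    { apply Rle_trans with (K ^ 2 * exp (c / 4 * INR N) ^ 2 * exp (- c / 2 * INR N)).
      - apply Rmult_le_compat_r; lra.
      - rewrite Rmult_assoc, E2. lra. }
    replace (INR (length (shell N)) * (A * (exp (- c / 2 * INR N) * exp (- c / 2 * INR N))))
      with (A * exp (- c / 2 * INR N) * (INR (length (shell N)) * exp (- c / 2 * INR N))) by ring.
    replace (A * K ^ 2 * exp (- c / 2 * INR N)) with (A * exp (- c / 2 * INR N) * K ^ 2) by ring.
    apply Rmult_le_compat_l; nra.
  - apply ex_series_const_mul. apply ex_series_geom.
    rewrite Rabs_pos_eq by (left; apply exp_pos).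
    rewrite <- exp_0. apply exp_increasing. lra.
Qed.

Definition shell_term (e : Z -> Z -> R) (N : nat) (a b : R) : R :=
  rsum (shell N) (fun p => e (fst p) (snd p) * wave (fst p) (snd p) 0 a b).

Definition fourier_series (e : Z -> Z -> R) (a b : R) : R :=
  Series (fun N => shell_term e N a b).

Lemma shell_term_bound e : (forall m n, 0 <= e m n) ->
  forall N a b, Rabs (shell_term e N a b) <= rsum (shell N) (fun p => e (fst p) (snd p)).
Proof.
  intros He N a b. apply Rle_trans with (1 := rsum_Rabs _ _). apply rsum_le.
  intros p _. rewrite Rabs_mult, Rabs_pos_eq by apply He.
  assert (H := wave_range (fst p) (snd p) 0 a b).
  assert (Rabs (wave (fst p) (snd p) 0 a b) <= 1) by now apply Rabs_le.
  specialize (He (fst p) (snd p)). nra.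
Qed.

Lemma continuous2_shell_term e N : continuous2 (shell_term e N).
Proof.
  apply (continuous2_rsum (shell N)
    (fun p a b => e (fst p) (snd p) * wave (fst p) (snd p) 0 a b)).
  prove_continuous.
Qed.

Lemma wave_product m n i j th a b :
  wave m n 0 a b * wave i j th a b
  = 1 / 2 * wave (m + i) (n + j) th a b + 1 / 2 * wave (i - m) (j - n) th a b.
Proof.
  unfold wave. rewrite !plus_IZR, !minus_IZR.
  set (X := 2 * PI * (IZR m * a + IZR n * b) + 0).
  set (Y := 2 * PI * (IZR i * a + IZR j * b) + th).
  replace (2 * PI * ((IZR m + IZR i) * a + (IZR n + IZR j) * b) + th) with (Y + X)
    by (unfold X, Y; ring).
  replace (2 * PI * ((IZR i - IZR m) * a + (IZR j - IZR n) * b) + th) with (Y - X)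
    by (unfold X, Y; ring).
  rewrite cos_plus, cos_minus. field.
Qed.

(** By the product formula only the terms [(i, j)] and [(- i, - j)] survive integration, each with
    half its coefficient; evenness of [e] adds the halves. Both lie in one shell, so the integrated
    series has a single nonzero term. *)
Lemma fourier_series_coefficients (e : Z -> Z -> R) :
  (forall m n, 0 <= e m n) -> (forall m n, e (- m)%Z (- n)%Z = e m n) ->
  ex_series (shell_sum e) ->
  has_fourier_coefficients (fourier_series e) e.
Proof.
  intros Hpos Hsym Hsum.
  assert (Hb := shell_term_bound e Hpos).
  repeat split.
  - exact (continuous2_Series (shell_term e) _ (continuous2_shell_term e) Hb Hsum).
  - intros a b. apply Series_ext. intros N. apply rsum_ext. intros p _. f_equal.
    apply (proj1 (periodic2_wave _ _ _)).
  - intros a b. apply Series_ext. intros N. apply rsum_ext. intros p _. f_equal.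
    apply (proj2 (periodic2_wave _ _ _)).
  - intros i j th. unfold fourier_series.
    assert (Hc : forall N, continuous2 (fun a b => shell_term e N a b * wave i j th a b))
      by (assert (H := continuous2_shell_term e); prove_continuous).
    rewrite (I2_ext _ (fun a b => Series (fun N => shell_term e N a b * wave i j th a b)))
      by (intros; now rewrite Series_scal_r).
    rewrite (I2_Series (fun N a b => shell_term e N a b * wave i j th a b)
      (shell_sum e) Hc); [ | | exact Hsum].
    2:{ intros N a b. rewrite Rabs_mult. specialize (Hb N a b).
        assert (Hr := wave_range i j th a b).
        assert (Rabs (wave i j th a b) <= 1) by now apply Rabs_le.
        assert (Hp := Rabs_pos (wave i j th a b)). assert (Hp' := Rabs_pos (shell_term e N a b)).
        unfold shell_sum in *; nra. }
    assert (Hterm : forall N, I2 (fun a b => shell_term e N a b * wave i j th a b)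
      = if in_dec Z_pair_eq_dec (i, j) (shell N) then e i j * cos th else 0).
    { intros N.
      rewrite (I2_ext _ (fun a b => rsum (shell N) (fun p =>
        e (fst p) (snd p) / 2 * wave (fst p + i) (snd p + j) th a b +
        e (fst p) (snd p) / 2 * wave (i - fst p) (j - snd p) th a b))).
      2:{ intros a b. unfold shell_term. rewrite Rmult_comm, <- rsum_scal. apply rsum_ext.
          intros p _.
          transitivity (e (fst p) (snd p) * (wave (fst p) (snd p) 0 a b * wave i j th a b));
            [ring | ].
          rewrite wave_product. field. }
      assert (Hcw : forall (c : R) m n, continuous2 (fun a b => c * wave m n th a b)).
      { prove_continuous. }
      rewrite (I2_rsum (shell N) (fun p a b =>
        e (fst p) (snd p) / 2 * wave (fst p + i) (snd p + j) th a b +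
        e (fst p) (snd p) / 2 * wave (i - fst p) (j - snd p) th a b))
        by (intros; apply continuous2_add; apply Hcw).
      rewrite (rsum_ext _ _ (fun p =>
        (if Z_pair_eq_dec p (- i, - j)%Z then e (fst p) (snd p) / 2 * cos th else 0) +
        (if Z_pair_eq_dec p (i, j) then e (fst p) (snd p) / 2 * cos th else 0))).
      2:{ intros [m n] _; cbn [fst snd].
          rewrite I2_plus, !I2_scal, !I2_wave by (apply Hcw || apply continuous2_wave).
          f_equal.
          - destruct (Z_pair_eq_dec (m, n) (- i, - j)%Z) as [E|E].
            + injection E as -> ->.
              destruct (Z.eq_dec (- i + i) 0); [ | lia]. destruct (Z.eq_dec (- j + j) 0); [ | lia].
              ring.
            + destruct (Z.eq_dec (m + i) 0); [ | ring]. destruct (Z.eq_dec (n + j) 0); [ | ring].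
              exfalso. apply E. f_equal; lia.
          - destruct (Z_pair_eq_dec (m, n) (i, j)) as [E|E].
            + injection E as -> ->.
              destruct (Z.eq_dec (i - i) 0); [ | lia]. destruct (Z.eq_dec (j - j) 0); [ | lia].
              ring.
            + destruct (Z.eq_dec (i - m) 0); [ | ring]. destruct (Z.eq_dec (j - n) 0); [ | ring].
              exfalso. apply E. f_equal; lia. }
      rewrite rsum_plus, !(rsum_single _ _ (fun p => e (fst p) (snd p) / 2 * cos th))
        by apply shell_NoDup.
      cbn [fst snd]. rewrite Hsym.
      destruct (in_dec Z_pair_eq_dec (i, j) (shell N)) as [H1|H1];
      destruct (in_dec Z_pair_eq_dec (- i, - j)%Z (shell N)) as [H2|H2];
        rewrite shell_spec in H1, H2; simpl in H1, H2; try lra; exfalso; lia. }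
    rewrite (Series_ext _ _ Hterm).
    set (N0 := Z.to_nat (Z.max (Z.abs i) (Z.abs j))).
    apply is_series_unique.
    apply (filterlim_ext_loc (fun _ => e i j * cos th)); [ | apply filterlim_const].
    exists N0. intros J HJ.
    assert (Hz : forall J, (J < N0)%nat ->
      sum_n (fun N => if in_dec Z_pair_eq_dec (i, j) (shell N) then e i j * cos th else 0) J = 0).
    { induction J0 as [|J0 IH]; intros HJ0.
      - rewrite sum_O. destruct (in_dec Z_pair_eq_dec (i, j) (shell 0)) as [H|H]; trivial.
        rewrite shell_spec in H; simpl in H. lia.
      - rewrite sum_Sn, IH by lia. unfold plus; simpl.
        destruct (in_dec Z_pair_eq_dec (i, j) (shell (S J0))) as [H|H]; [ | ring].
        rewrite shell_spec in H; cbn [fst snd] in H. lia. }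
    assert (Hin : In (i, j) (shell N0)) by (apply shell_spec; cbn [fst snd]; unfold N0; lia).
    induction HJ as [|J HJ IH].
    + destruct N0 as [|N1].
      * rewrite sum_O. destruct (in_dec Z_pair_eq_dec (i, j) (shell 0)); tauto.
      * rewrite sum_Sn, Hz by lia. unfold plus; simpl.
        destruct (in_dec Z_pair_eq_dec (i, j) (shell (S N1))); [ring | tauto].
    + rewrite sum_Sn, <- IH. unfold plus; simpl.
      destruct (in_dec Z_pair_eq_dec (i, j) (shell (S J))) as [H|H]; [ | ring].
      rewrite shell_spec in H; cbn [fst snd] in H. unfold N0 in *. lia.
Qed.

(** * The Fourier series of the heat kernel *)

Lemma gram_det (v w : point) : dot v v * dot w w - dot v w ^ 2 = det v w ^ 2.
Proof. unfold dot, det. ring. Qed.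

Lemma dot_nonneg (p : point) : 0 <= dot p p.
Proof. unfold dot. nra. Qed.

Lemma dot_self_pos v w : det v w <> 0 -> 0 < dot v v.
Proof.
  intros Hd. assert (Hg := gram_det v w). assert (Hd2 : 0 < det v w ^ 2) by now apply pow2_gt_0.
  assert (Hv := dot_nonneg v). destruct (Req_dec (dot v v) 0) as [E|E]; [ | lra].
  rewrite E in Hg. assert (H := pow2_ge_0 (dot v w)). lra.
Qed.

(* [4 pi^2 |xi|^2] for the dual lattice vector [xi] with [xi.v = m] and [xi.w = n]. *)
Definition eigenvalue (v w : point) (m n : Z) : R :=
  4 * PI ^ 2 * (IZR m ^ 2 * dot w w - 2 * IZR m * IZR n * dot v w + IZR n ^ 2 * dot v v)
  / det v w ^ 2.

(** For a positive definite form in the plane the smaller eigenvalue is at least determinant over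
    trace. After multiplication by the trace, the difference of the two sides is a sum of two
    squares. *)
Lemma gram_lower_bound (v w : point) (x y : R) : det v w <> 0 ->
  det v w ^ 2 / (dot v v + dot w w) * (x ^ 2 + y ^ 2)
  <= x ^ 2 * dot w w - 2 * x * y * dot v w + y ^ 2 * dot v v.
Proof.
  intros Hd. assert (Hg := gram_det v w).
  assert (Hd2 : 0 < det v w ^ 2) by now apply pow2_gt_0.
  assert (Hs : 0 < dot v v + dot w w)
    by (assert (H1 := dot_self_pos v w Hd); assert (H2 := dot_nonneg w); lra).
  unfold Rdiv. rewrite (Rmult_comm (det v w ^ 2)), Rmult_assoc, Rmult_comm.
  apply Rle_div_l; [assumption | ].
  rewrite <- Hg.
  set (P := dot v v) in *. set (Q := dot w w) in *. set (r := dot v w) in *.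
  assert (H1 := pow2_ge_0 (x * Q - r * y)). assert (H2 := pow2_ge_0 (r * x - P * y)).
  lra.
Qed.

Lemma eigenvalue_lower_bound v w : det v w <> 0 -> exists c, 0 < c /\
  forall N m n, In (m, n) (shell N) -> c * INR N ^ 2 <= eigenvalue v w m n.
Proof.
  intros Hd. assert (Hpi := PI_RGT_0).
  assert (Hd2 : 0 < det v w ^ 2) by now apply pow2_gt_0.
  assert (Hs : 0 < dot v v + dot w w)
    by (assert (H1 := dot_self_pos v w Hd); assert (H2 := dot_nonneg w); lra).
  exists (4 * PI ^ 2 / (dot v v + dot w w)). split.
  { apply Rdiv_lt_0_compat; [nra | assumption]. }
  intros N m n Hin. apply shell_spec in Hin; cbn [fst snd] in Hin.
  assert (Hmn : INR N ^ 2 <= IZR m ^ 2 + IZR n ^ 2).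
  { rewrite INR_IZR_INZ, <- Hin, !pow_IZR, <- plus_IZR. apply IZR_le. simpl. nia. }
  unfold eigenvalue.
  apply Rle_trans with (4 * PI ^ 2 / (dot v v + dot w w) * (IZR m ^ 2 + IZR n ^ 2)).
  { apply Rmult_le_compat_l; [ | assumption]. left. apply Rdiv_lt_0_compat; [nra | assumption]. }
  assert (Hb := gram_lower_bound v w (IZR m) (IZR n) Hd).
  replace (4 * PI ^ 2 / (dot v v + dot w w) * (IZR m ^ 2 + IZR n ^ 2))
    with (4 * PI ^ 2 / det v w ^ 2 *
      (det v w ^ 2 / (dot v v + dot w w) * (IZR m ^ 2 + IZR n ^ 2))) by (field; lra).
  replace (4 * PI ^ 2 * (IZR m ^ 2 * dot w w - 2 * IZR m * IZR n * dot v w + IZR n ^ 2 * dot v v)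
    / det v w ^ 2) with (4 * PI ^ 2 / det v w ^ 2 *
      (IZR m ^ 2 * dot w w - 2 * IZR m * IZR n * dot v w + IZR n ^ 2 * dot v v)) by (field; lra).
  apply Rmult_le_compat_l; [ | assumption]. left. apply Rdiv_lt_0_compat; nra.
Qed.

Lemma exp_le (x y : R) : x <= y -> exp x <= exp y.
Proof. intros [H| ->]; [left; now apply exp_increasing | lra]. Qed.

(** Completing the square; the surplus rate 1 in the exponent leaves a summable factor. *)
Lemma gaussian_below_exponential (c r x : R) : 0 < c ->
  exp (- c * x ^ 2 + r * x) <= exp ((r + 1) ^ 2 / (4 * c)) * exp (- (1) * x).
Proof.
  intros Hc. rewrite <- exp_plus. apply exp_le.
  assert (E : (r + 1) ^ 2 / (4 * c) + - (1) * x - (- c * x ^ 2 + r * x)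
    = c * (x - (r + 1) / (2 * c)) ^ 2) by (field; lra).
  assert (H := pow2_ge_0 (x - (r + 1) / (2 * c))). nra.
Qed.

Definition max_norm (p : Z * Z) : R := IZR (Z.max (Z.abs (fst p)) (Z.abs (snd p))).

(** Decay faster than every exponential is what makes the series entire along each line; plain
    summability would give continuity only. *)
Definition rapidly_summable (e : Z -> Z -> R) : Prop :=
  forall r, ex_series (fun N => rsum (shell N) (fun p => e (fst p) (snd p) * exp (r * max_norm p))).

Lemma rapidly_summable_summable e : rapidly_summable e -> ex_series (shell_sum e).
Proof.
  intros H. refine (ex_series_ext _ _ _ (H 0)). intros N. apply rsum_ext. intros p _.
  rewrite Rmult_0_l, exp_0. ring.
Qed.

Definition heat_coefficient (v w : point) (t : R) (m n : Z) : R :=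
  exp (- eigenvalue v w m n * t) / Rabs (det v w).

Lemma heat_coefficient_pos v w t m n : det v w <> 0 -> 0 < heat_coefficient v w t m n.
Proof. intros H. apply Rdiv_lt_0_compat; [apply exp_pos | now apply Rabs_pos_lt]. Qed.

Lemma heat_coefficient_neg v w t m n :
  heat_coefficient v w t (- m) (- n) = heat_coefficient v w t m n.
Proof.
  unfold heat_coefficient, eigenvalue. rewrite !opp_IZR. do 2 f_equal. unfold Rdiv. ring.
Qed.

Lemma heat_coefficient_rapidly_summable v w t : det v w <> 0 -> 0 < t ->
  rapidly_summable (heat_coefficient v w t).
Proof.
  intros Hd Ht r. destruct (eigenvalue_lower_bound v w Hd) as [c [Hc Hl]].
  assert (Hct : 0 < c * t) by now apply Rmult_lt_0_compat.
  assert (Habs : 0 < / Rabs (det v w)) by now apply Rinv_0_lt_compat, Rabs_pos_lt.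
  apply (shell_summable (fun m n => heat_coefficient v w t m n * exp (r * max_norm (m, n)))
    (/ Rabs (det v w) * exp ((r + 1) ^ 2 / (4 * (c * t)))) 1); [lra | | ].
  { intros m n. assert (H := heat_coefficient_pos v w t m n Hd).
    assert (He := exp_pos (r * max_norm (m, n))). nra. }
  intros N m n Hin. specialize (Hl N m n Hin).
  apply shell_spec in Hin; cbn [fst snd] in Hin.
  unfold heat_coefficient, max_norm; cbn [fst snd]. rewrite Hin, <- INR_IZR_INZ.
  apply Rle_trans with (/ Rabs (det v w) * exp (- eigenvalue v w m n * t + r * INR N)).
  { right. rewrite exp_plus. unfold Rdiv. ring. }
  rewrite Rmult_assoc. apply Rmult_le_compat_l; [lra | ].
  apply Rle_trans with (2 := gaussian_below_exponential (c * t) r (INR N) Hct).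
  apply exp_le. nra.
Qed.

Lemma heat_coefficient_summable v w t : det v w <> 0 -> 0 < t ->
  ex_series (shell_sum (heat_coefficient v w t)).
Proof. intros. now apply rapidly_summable_summable, heat_coefficient_rapidly_summable. Qed.

Lemma heat_series_coefficients v w t : det v w <> 0 -> 0 < t ->
  has_fourier_coefficients (fourier_series (heat_coefficient v w t)) (heat_coefficient v w t).
Proof.
  intros Hd Ht. apply fourier_series_coefficients.
  - intros. left. now apply heat_coefficient_pos.
  - apply heat_coefficient_neg.
  - now apply heat_coefficient_summable.
Qed.

Lemma heat_kernel_coefficients Lam K v w x t : heat_kernel Lam K -> lattice_basis Lam v w -> 0 < t ->
  has_fourier_coefficients (fun a b => K t x (plus x (lattice_point v w a b)))
    (heat_coefficient v w t).
Proof.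
  intros [_ HK] Hb Ht. specialize (HK x). assert (Hd := lattice_basis_det _ _ _ Hb).
  assert (HK' := HK). destruct HK' as [Hper [[_ [_ [Hcont _]]] _]].
  set (u := fun t y => K t x y) in *.
  assert (Hc : forall p, continuous (u t) p) by (intros; now apply jointly_continuous_slice).
  assert (Hinv : invariant v w (u t))
    by exact (periodic_invariant Lam v w (u t) Hb (Hper t Ht)).
  set (x1 := coord1 v w x). set (x2 := coord2 v w x).
  assert (Hx : x = lattice_point v w x1 x2) by (symmetry; now apply lattice_point_coords).
  assert (Hpt : forall a b, plus x (lattice_point v w a b) = lattice_point v w (x1 + a) (x2 + b)).
  { intros a b. rewrite Hx at 1. point_ring; ring. }
  assert (Hc2 : continuous2 (fun a b => u t (lattice_point v w a b)))
    by now apply continuous2_lattice_point.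
  assert (Hp2 := invariant_lattice_point v w (u t) Hinv).
  split; [ | split].
  - intros z. apply (continuous_ext (fun z : R * R =>
      u t (lattice_point v w (x1 + fst z) (x2 + snd z)))).
    + intros y. unfold u. now rewrite Hpt.
    + apply (continuous2_shift _ x1 x2 Hc2).
  - destruct Hp2 as [H1 H2].
    split; intros a b; rewrite !Hpt, <- Rplus_assoc; [apply H1 | apply H2].
  - intros m n th.
    (* The dual vector of index [(m, n)], by Cramer's rule; the factor [2 * PI] is included. *)
    set (xi := (2 * PI * (IZR m * snd w - IZR n * snd v) / det v w,
                2 * PI * (IZR n * fst v - IZR m * fst w) / det v w) : point).
    assert (Hv : dot xi v = 2 * PI * IZR m) by (unfold xi, dot, det in *; simpl; field; assumption).
    assert (Hw : dot xi w = 2 * PI * IZR n) by (unfold xi, dot, det in *; simpl; field; assumption).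
    assert (Hxixi : dot xi xi = eigenvalue v w m n).
    { unfold xi, eigenvalue, dot. simpl. field. assumption. }
    assert (Hdx : dot xi x = 2 * PI * (IZR m * x1 + IZR n * x2)).
    { rewrite Hx. transitivity (x1 * dot xi v + x2 * dot xi w).
      - unfold dot; simpl; unfold plus, scal, mult; simpl; unfold mult; simpl. ring.
      - rewrite Hv, Hw. ring. }
    (* The phase [th - dot xi x] recentres the character at the pole [x], where its value becomes
       [cos th]. *)
    assert (F := fundamental_solution_fourier Lam v w x u xi (th - dot xi x) m n t Hb HK Hv Hw Ht).
    unfold torus_integral in F. unfold heat_coefficient.
    assert (Habs : 0 < Rabs (det v w)) by now apply Rabs_pos_lt.
    apply (Rmult_eq_reg_l (Rabs (det v w))); [ | lra].
    transitivity (exp (- dot xi xi * t) * character xi (th - dot xi x) x).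
    2:{ unfold character. rewrite Hxixi.
        replace (dot xi x + (th - dot xi x)) with th by ring. field. lra. }
    rewrite <- F. f_equal.
    change (I2 (fun a b => u t (plus x (lattice_point v w a b)) * wave m n th a b)
      = I2 (fun a b => u t (lattice_point v w a b) *
          character xi (th - dot xi x) (lattice_point v w a b))).
    assert (Hchar : forall a b, character xi (th - dot xi x) (lattice_point v w a b)
      = wave m n (th - dot xi x) a b).
    { intros a b. unfold character, wave. f_equal. f_equal.
      transitivity (a * dot xi v + b * dot xi w).
      - unfold dot; simpl; unfold plus, scal, mult; simpl; unfold mult; simpl. ring.
      - rewrite Hv, Hw. ring. }
    rewrite (I2_ext (fun a b => u t (lattice_point v w a b) *
      character xi (th - dot xi x) (lattice_point v w a b))
      (fun a b => u t (lattice_point v w a b) * wave m n (th - dot xi x) a b))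
      by (intros; now rewrite Hchar).
    rewrite <- (I2_shift (fun a b => u t (lattice_point v w a b) * wave m n (th - dot xi x) a b) x1 x2).
    + apply I2_ext. intros a b. rewrite Hpt. f_equal. unfold wave. rewrite Hdx. f_equal. ring.
    + exact (fun z => continuous_mul _ _ _ z (Hc2 z) (continuous2_wave m n _ z)).
    + apply periodic2_mult; [exact Hp2 | apply periodic2_wave].
Qed.

(** Both sides are continuous, periodic, and have the same coefficients. From here on the abstract
    kernel is replaced by an explicit series that does not involve [x]. *)
Lemma heat_kernel_series Lam K v w x t a b :
  heat_kernel Lam K -> lattice_basis Lam v w -> 0 < t ->
  K t x (plus x (lattice_point v w a b)) = fourier_series (heat_coefficient v w t) a b.
Proof.
  intros HK Hb Ht. assert (Hd := lattice_basis_det _ _ _ Hb).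
  apply (fourier_uniqueness (fun a b => K t x (plus x (lattice_point v w a b))) _
    (heat_coefficient v w t)).
  - now apply (heat_kernel_coefficients Lam).
  - now apply heat_series_coefficients.
Qed.

(** * Reduced bases *)

Lemma dot_lattice_points v w a b c d :
  dot (lattice_point v w a b) (lattice_point v w c d)
  = a * c * dot v v + (a * d + b * c) * dot v w + b * d * dot w w.
Proof.
  unfold lattice_point, dot, plus, scal, mult; simpl; unfold plus, scal, mult; simpl;
    unfold mult; simpl. ring.
Qed.

Lemma dot_lattice_point v w a b :
  dot (lattice_point v w a b) (lattice_point v w a b)
  = a ^ 2 * dot v v + 2 * a * b * dot v w + b ^ 2 * dot w w.
Proof. rewrite dot_lattice_points. ring. Qed.

Lemma det_lattice_point v w a b c d :
  det (lattice_point v w a b) (lattice_point v w c d) = (a * d - b * c) * det v w.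
Proof.
  unfold lattice_point, det, plus, scal, mult; simpl; unfold plus, scal, mult; simpl;
    unfold mult; simpl. ring.
Qed.

Lemma det_lin_indep v w : det v w <> 0 -> lin_indep v w.
Proof.
  intros Hd a b H. destruct v as [v1 v2], w as [w1 w2]. unfold det in Hd; simpl in Hd.
  assert (H1 : a * v1 + b * w1 = 0) by exact (f_equal fst H).
  assert (H2 : a * v2 + b * w2 = 0) by exact (f_equal snd H).
  split; apply (Rmult_eq_reg_r (v1 * w2 - v2 * w1)); trivial.
  - transitivity (w2 * (a * v1 + b * w1) - w1 * (a * v2 + b * w2)); [ring | ].
    rewrite H1, H2. ring.
  - transitivity (v1 * (a * v2 + b * w2) - v2 * (a * v1 + b * w1)); [ring | ].
    rewrite H1, H2. ring.
Qed.

(** The squared determinant treats the values 1 and -1 together; the inverse matrix is then the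
    determinant times the adjugate. *)
Lemma lattice_basis_change Lam v w (i j k l : Z) :
  lattice_basis Lam v w -> ((i * l - j * k) * (i * l - j * k) = 1)%Z ->
  lattice_basis Lam (lattice_point v w (IZR i) (IZR j)) (lattice_point v w (IZR k) (IZR l)).
Proof.
  intros Hb Hu. assert (Hd := lattice_basis_det _ _ _ Hb). split.
  - apply det_lin_indep. rewrite det_lattice_point.
    apply Rmult_integral_contrapositive. split; trivial.
    rewrite <- !mult_IZR, <- minus_IZR. apply not_0_IZR. intros E. now rewrite E in Hu.
  - intros p. destruct Hb as [_ Hb]. rewrite Hb. split; intros [m [n ->]].
    + set (d := (i * l - j * k)%Z) in *.
      exists (d * (l * m - k * n))%Z, (d * (i * n - j * m))%Z.
      assert (E1 : IZR m = IZR (d * (l * m - k * n) * i + d * (i * n - j * m) * k)).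
      { f_equal. transitivity (d * d * m)%Z; [ | unfold d; ring]. rewrite Hu. ring. }
      assert (E2 : IZR n = IZR (d * (l * m - k * n) * j + d * (i * n - j * m) * l)).
      { f_equal. transitivity (d * d * n)%Z; [ | unfold d; ring]. rewrite Hu. ring. }
      rewrite E1, E2, !plus_IZR, !(mult_IZR (d * _)). point_ring; ring.
    + exists (m * i + n * k)%Z, (m * j + n * l)%Z.
      rewrite !plus_IZR, !mult_IZR. point_ring; ring.
Qed.

Lemma list_argmin {A : Type} (P : A -> Prop) (f : A -> R) (l : list A) :
  (exists x, In x l /\ P x) ->
  exists x, In x l /\ P x /\ forall y, In y l -> P y -> f x <= f y.
Proof.
  induction l as [|z l IH]; intros [x [Hx HP]]; [destruct Hx | ].
  destruct (classic (exists x, In x l /\ P x)) as [Hex|Hex].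
  - destruct (IH Hex) as [y [Hy [HPy Hmin]]].
    destruct (classic (P z /\ f z < f y)) as [[Hz Hlt]|Hz].
    + exists z. split; [now left | split; trivial].
      intros u [<-|Hu] HPu; [lra | ]. specialize (Hmin u Hu HPu). lra.
    + exists y. split; [now right | split; trivial].
      intros u [<-|Hu] HPu; [ | auto]. apply Rnot_lt_le. tauto.
  - destruct Hx as [->|Hx]; [ | exfalso; apply Hex; now exists x].
    exists x. split; [now left | split; trivial].
    intros u [<-|Hu] HPu; [lra | ]. exfalso. apply Hex. now exists u.
Qed.

Definition basis_size (v w : point) (q : (Z * Z) * (Z * Z)) : R :=
  dot (lattice_point v w (IZR (fst (fst q))) (IZR (snd (fst q))))
      (lattice_point v w (IZR (fst (fst q))) (IZR (snd (fst q)))) +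
  dot (lattice_point v w (IZR (fst (snd q))) (IZR (snd (snd q))))
      (lattice_point v w (IZR (fst (snd q))) (IZR (snd (snd q)))).

(** The Gram bound confines the integer coordinates of short vectors to a finite box, so a minimum
    over the bases not larger than [(v, w)] is found in a finite list. *)
Lemma minimal_basis Lam v w : lattice_basis Lam v w ->
  exists v' w', lattice_basis Lam v' w' /\
  forall v'' w'', lattice_basis Lam v'' w'' -> dot v' v' + dot w' w' <= dot v'' v'' + dot w'' w''.
Proof.
  intros Hb. assert (Hd := lattice_basis_det _ _ _ Hb).
  set (C := dot v v + dot w w).
  assert (Hdot := dot_nonneg).
  assert (HC : 0 < C)
    by (unfold C; assert (H1 := dot_self_pos v w Hd); assert (H2 := Hdot w); lra).
  set (c := det v w ^ 2 / C).
  assert (Hc : 0 < c) by (apply Rdiv_lt_0_compat; [now apply pow2_gt_0 | exact HC]).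
  set (N := Z.to_nat (up (C / c))).
  assert (HN : C / c < INR N).
  { unfold N. rewrite INR_IZR_INZ, Z2Nat.id; [apply archimed | ].
    apply le_IZR. assert (0 < C / c) by now apply Rdiv_lt_0_compat.
    destruct (archimed (C / c)). lra. }
  assert (Hsmall : forall i j : Z, dot (lattice_point v w (IZR i) (IZR j))
    (lattice_point v w (IZR i) (IZR j)) <= C ->
    (Z.abs i <= Z.of_nat N)%Z /\ (Z.abs j <= Z.of_nat N)%Z).
  { intros i j H. rewrite dot_lattice_point in H.
    assert (Hl := gram_lower_bound v w (IZR j) (- IZR i) Hd). fold C in Hl. fold c in Hl.
    assert (Hs : c * (IZR j ^ 2 + IZR i ^ 2) <= C).
    { replace (IZR j ^ 2 + IZR i ^ 2) with (IZR j ^ 2 + (- IZR i) ^ 2) by ring. lra. }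
    assert (Hs' : IZR j ^ 2 + IZR i ^ 2 < INR N).
    { apply Rle_lt_trans with (2 := HN). apply Rle_div_r; lra. }
    rewrite !pow_IZR, <- plus_IZR, INR_IZR_INZ in Hs'. apply lt_IZR in Hs'. simpl in Hs'. nia. }
  set (l := list_prod (list_prod (integer_range N) (integer_range N))
                      (list_prod (integer_range N) (integer_range N))).
  assert (Hin : forall i j k m : Z, basis_size v w ((i, j), (k, m)) <= C -> In ((i, j), (k, m)) l).
  { intros i j k m H. unfold basis_size in H; cbn [fst snd] in H.
    assert (H1 := Hdot (lattice_point v w (IZR i) (IZR j))).
    assert (H2 := Hdot (lattice_point v w (IZR k) (IZR m))).
    destruct (Hsmall i j) as [Hi Hj]; [lra | ]. destruct (Hsmall k m) as [Hk Hm]; [lra | ].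
    unfold l. rewrite !in_prod_iff, !integer_range_spec. tauto. }
  assert (Hid : basis_size v w ((1, 0), (0, 1))%Z = C).
  { unfold basis_size; cbn [fst snd]. now rewrite lattice_point_1_0, lattice_point_0_1. }
  destruct (list_argmin (fun q => lattice_basis Lam
    (lattice_point v w (IZR (fst (fst q))) (IZR (snd (fst q))))
    (lattice_point v w (IZR (fst (snd q))) (IZR (snd (snd q))))) (basis_size v w) l)
    as [q [Hq [HqP Hmin]]].
  { exists ((1, 0), (0, 1))%Z. split.
    - apply Hin. rewrite Hid. lra.
    - cbn [fst snd]. now rewrite lattice_point_1_0, lattice_point_0_1. }
  exists (lattice_point v w (IZR (fst (fst q))) (IZR (snd (fst q)))),
         (lattice_point v w (IZR (fst (snd q))) (IZR (snd (snd q)))).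
  split; [exact HqP | ]. intros v'' w'' Hb''.
  assert (Hmem := Hb''). destruct Hmem as [_ Hmem].
  assert (Hv'' : Lam v'').
  { apply Hmem. exists 1%Z, 0%Z. symmetry. apply lattice_point_1_0. }
  assert (Hw'' : Lam w'').
  { apply Hmem. exists 0%Z, 1%Z. symmetry. apply lattice_point_0_1. }
  destruct Hb as [_ Hb]. apply Hb in Hv'' as [i [j Hij]]. apply Hb in Hw'' as [k [m Hkm]].
  change (v'' = lattice_point v w (IZR i) (IZR j)) in Hij.
  change (w'' = lattice_point v w (IZR k) (IZR m)) in Hkm. subst v'' w''.
  change (basis_size v w q <= basis_size v w ((i, j), (k, m))).
  destruct (Rle_dec (basis_size v w ((i, j), (k, m))) C) as [Hle|Hgt].
  - apply Hmin; [now apply Hin | exact Hb''].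
  - apply Rle_trans with C; [ | lra]. rewrite <- Hid.
    apply Hmin; [apply Hin; rewrite Hid; lra | ].
    cbn [fst snd]. rewrite lattice_point_1_0, lattice_point_0_1. split; [now apply det_lin_indep | exact Hb].
Qed.

(** Adding or subtracting one vector of a minimal basis from the other cannot shorten it, which
    bounds [2 * Rabs (dot v w)] by both squared lengths; a sign change and an exchange do the rest.
    Here [w] is the shorter vector, so the shortest dual vector has index [(1, 0)]. *)
Lemma reduced_basis Lam : rank_two_lattice Lam ->
  exists v w, lattice_basis Lam v w /\ 0 <= 2 * dot v w <= dot w w /\ dot w w <= dot v v.
Proof.
  intros [v0 [w0 Hb0]]. destruct (minimal_basis Lam v0 w0 Hb0) as [v [w [Hb Hmin]]].
  assert (Hch : forall i j k l : Z, ((i * l - j * k) * (i * l - j * k) = 1)%Z ->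
    dot v v + dot w w <= (IZR i ^ 2 * dot v v + 2 * IZR i * IZR j * dot v w + IZR j ^ 2 * dot w w)
      + (IZR k ^ 2 * dot v v + 2 * IZR k * IZR l * dot v w + IZR l ^ 2 * dot w w)).
  { intros i j k l H. rewrite <- !dot_lattice_point. now apply Hmin, lattice_basis_change. }
  assert (H1 := Hch 1%Z 1%Z 0%Z 1%Z eq_refl).
  assert (H2 := Hch 1%Z (-1)%Z 0%Z 1%Z eq_refl).
  assert (H3 := Hch 1%Z 0%Z 1%Z 1%Z eq_refl).
  assert (H4 := Hch 1%Z 0%Z (-1)%Z 1%Z eq_refl).
  destruct (Rle_dec 0 (dot v w)) as [Hr|Hr]; destruct (Rle_dec (dot w w) (dot v v)) as [Hq|Hq].
  - exists v, w. split; [exact Hb | lra].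
  - exists (lattice_point v w 0 1), (lattice_point v w 1 0).
    split; [exact (lattice_basis_change Lam v w 0 1 1 0 Hb eq_refl) | rewrite !dot_lattice_points; lra].
  - exists (lattice_point v w 1 0), (lattice_point v w 0 (-1)).
    split; [exact (lattice_basis_change Lam v w 1 0 0 (-1) Hb eq_refl) | rewrite !dot_lattice_points; lra].
  - exists (lattice_point v w 0 (-1)), (lattice_point v w 1 0).
    split; [exact (lattice_basis_change Lam v w 0 (-1) 1 0 Hb eq_refl) | rewrite !dot_lattice_points; lra].
Qed.

Lemma norm_sqrt_dot (p : point) : norm p = sqrt (dot p p).
Proof.
  change (sqrt (Rabs (fst p) ^ 2 + Rabs (snd p) ^ 2) = sqrt (dot p p)).
  rewrite !pow2_abs. f_equal. unfold dot. ring.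
Qed.

(** The member [l0] and the lower bound 0 make the infimum finite, so that [real] does not fall back
    on its default value. *)
Lemma torus_dist_glb Lam p q l0 : Lam l0 ->
  (forall l, Lam l -> torus_dist Lam p q <= norm (plus (minus q p) l)) /\
  (forall d, (forall l, Lam l -> d <= norm (plus (minus q p) l)) -> d <= torus_dist Lam p q).
Proof.
  intros Hl0. unfold torus_dist.
  set (E := fun d => exists l, Lam l /\ d = norm (plus (minus q p) l)).
  destruct (Glb_Rbar_correct E) as [Hlb Hgl].
  assert (H0 : is_lb_Rbar E 0).
  { intros d [l [_ ->]]. apply norm_ge_0. }
  assert (H1 := Hgl 0 H0).
  assert (H2 := Hlb (norm (plus (minus q p) l0)) (ex_intro _ l0 (conj Hl0 eq_refl))).
  destruct (Glb_Rbar E) as [g| |]; simpl in H1, H2 |- *; try contradiction.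
  split.
  - intros l Hl. exact (Hlb _ (ex_intro _ l (conj Hl eq_refl))).
  - intros d Hd. apply (Hgl d). intros x [l [Hl ->]]. now apply Hd.
Qed.

Lemma derive_right_max (f : R -> R) (x l d : R) :
  is_derive f x l -> 0 < d -> (forall h, 0 < h < d -> f (x + h) <= f x) -> l <= 0.
Proof.
  intros Hf Hd Hmax. apply Rnot_lt_le. intros Hl.
  destruct (proj1 (is_derive_Reals f x l) Hf l Hl) as [delta Hdelta].
  set (h := Rmin (delta / 2) (d / 2)).
  assert (Hh : 0 < h < d /\ h < delta).
  { destruct delta as [e He]; simpl in *. unfold h. repeat split.
    - apply Rmin_case; lra.
    - apply Rle_lt_trans with (1 := Rmin_r _ _). lra.
    - apply Rle_lt_trans with (1 := Rmin_l _ _). lra. }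
  specialize (Hdelta h ltac:(lra) ltac:(rewrite Rabs_pos_eq; lra)).
  apply Rabs_def2 in Hdelta. specialize (Hmax h (proj1 Hh)).
  assert (0 < (f (x + h) - f x) / h) by lra.
  assert ((f (x + h) - f x) / h * h = f (x + h) - f x) by (field; lra). nra.
Qed.

Lemma derive_left_max (f : R -> R) (x l d : R) :
  is_derive f x l -> 0 < d -> (forall h, 0 < h < d -> f (x - h) <= f x) -> 0 <= l.
Proof.
  intros Hf Hd Hmax.
  assert (H : is_derive (fun y => f (- y)) (- x) (- l)).
  { apply (is_derive_value _ _ (scal (-1) l)).
    - unfold scal; simpl; unfold mult; simpl. ring.
    - apply (is_derive_comp f (fun y => - y)); [now rewrite Ropp_involutive | ].
      auto_derive; trivial; ring. }
  apply (derive_right_max _ _ _ d) in H; [lra | exact Hd | ].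
  intros h Hh. rewrite Ropp_involutive. replace (- (- x + h)) with (x - h) by ring. auto.
Qed.

(** * Large times *)

Lemma shell_1 : shell 1 =
  ((-1, -1) :: (-1, 0) :: (-1, 1) :: (0, -1) :: (0, 1) :: (1, -1) :: (1, 0) :: (1, 1) :: nil)%Z.
Proof. reflexivity. Qed.

Definition fourier_tail (e : Z -> Z -> R) (a b : R) : R :=
  Series (fun N => shell_term e (2 + N) a b).

Lemma fourier_series_head (e : Z -> Z -> R) a b :
  (forall m n, 0 <= e m n) -> (forall m n, e (- m)%Z (- n)%Z = e m n) ->
  ex_series (shell_sum e) ->
  fourier_series e a b = e 0%Z 0%Z +
    2 * (e 1%Z 0%Z * wave 1 0 0 a b + e 0%Z 1%Z * wave 0 1 0 a b +
         e 1%Z 1%Z * wave 1 1 0 a b + e 1%Z (-1)%Z * wave 1 (-1) 0 a b) + fourier_tail e a b.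
Proof.
  intros Hpos Hsym Hsum.
  assert (Hex : ex_series (fun N => shell_term e N a b)).
  { apply (ex_series_dominated _
      (shell_sum e)); [ | exact Hsum].
    intros N. now apply shell_term_bound. }
  unfold fourier_series, fourier_tail. rewrite (Series_incr_n _ 2) by (lia || exact Hex).
  f_equal. simpl pred. cbn [sum_f_R0].
  assert (W : forall m n, wave (- m) (- n) 0 a b = wave m n 0 a b).
  { intros. rewrite <- wave_neg. f_equal; [lia | lia | ring]. }
  assert (S0 : shell_term e 0 a b = e 0%Z 0%Z).
  { unfold shell_term. change (shell 0) with ((0, 0) :: nil)%Z. unfold rsum; cbn [fold_right fst snd].
    unfold wave. replace (2 * PI * (0 * a + 0 * b) + 0) with 0 by ring. rewrite cos_0. ring. }
  assert (S1 : shell_term e 1 a b = 2 * (e 1%Z 0%Z * wave 1 0 0 a b + e 0%Z 1%Z * wave 0 1 0 a b +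
         e 1%Z 1%Z * wave 1 1 0 a b + e 1%Z (-1)%Z * wave 1 (-1) 0 a b)).
  { unfold shell_term. rewrite shell_1. unfold rsum; cbn [fold_right fst snd].
    assert (E1 := Hsym 1%Z 1%Z). assert (E2 := Hsym 1%Z 0%Z). assert (E3 := Hsym 1%Z (-1)%Z).
    assert (E4 := Hsym 0%Z 1%Z). assert (W1 := W 1%Z 1%Z). assert (W2 := W 1%Z 0%Z).
    assert (W3 := W 1%Z (-1)%Z). assert (W4 := W 0%Z 1%Z).
    cbn [Z.opp] in *. rewrite ?E1, ?E2, ?E3, ?E4, ?W1, ?W2, ?W3, ?W4. ring. }
  rewrite S0, S1. reflexivity.
Qed.

Lemma fourier_tail_bound (e e' : Z -> Z -> R) (C a b : R) :
  (forall m n, 0 <= e m n) ->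
  (forall N m n, (2 <= N)%nat -> In (m, n) (shell N) -> e m n <= C * e' m n) ->
  ex_series (shell_sum e') ->
  Rabs (fourier_tail e a b) <=
  C * Series (fun N => shell_sum e' (2 + N)).
Proof.
  intros Hpos Hle Hsum. unfold fourier_tail. rewrite <- Series_scal_l.
  assert (Hex : ex_series (fun N => C * shell_sum e' (2 + N))).
  { apply ex_series_const_mul.
    now apply (ex_series_incr_n (shell_sum e') 2). }
  assert (Hb : forall N, Rabs (shell_term e (2 + N) a b)
    <= C * shell_sum e' (2 + N)).
  { intros N. apply Rle_trans with (1 := shell_term_bound e Hpos (2 + N) a b).
    unfold shell_sum. rewrite <- rsum_scal. apply rsum_le. intros [m n] Hin. apply (Hle (2 + N)%nat); [lia | exact Hin]. }
  apply Rle_trans with (Series (fun N => Rabs (shell_term e (2 + N) a b))).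
  - apply Series_Rabs.
    apply (ex_series_dominated _ _) with (2 := Hex).
    intros N. change (Rabs (Rabs (shell_term e (2 + N) a b))
      <= C * shell_sum e' (2 + N)).
    rewrite Rabs_Rabsolu. apply Hb.
  - apply Series_le; [ | exact Hex]. intros N. split; [apply Rabs_pos | apply Hb].
Qed.

Lemma is_lim_seq_exp_decay (c : R) (t : nat -> R) :
  0 < c -> is_lim_seq t p_infty -> is_lim_seq (fun k => exp (- c * t k)) 0.
Proof.
  intros Hc Ht.
  apply (is_lim_comp_seq exp (fun k => - c * t k) m_infty 0).
  - apply is_lim_exp_m.
  - exists 0%nat. intros n _. discriminate.
  - replace m_infty with (Rbar_mult (- c) p_infty).
    + now apply is_lim_seq_scal_l.
    + unfold Rbar_mult, Rbar_mult'. destruct (Rle_dec 0 (- c)); [exfalso; lra | reflexivity].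
Qed.

(* After rescaling by [exp (eigenvalue v w 1 0 * t)], only the shortest dual vectors contribute to
   the spatial variation of the heat kernel as [t] tends to infinity. *)
Lemma large_time_comparison v w (t : nat -> R) (chi a b a' b' : R) :
  det v w <> 0 -> 0 < dot w w -> (forall k, 0 < t k) -> is_lim_seq t p_infty ->
  is_lim_seq (fun k => exp (- (eigenvalue v w 0 1 - eigenvalue v w 1 0) * t k)) chi ->
  eigenvalue v w 1 0 < eigenvalue v w 1 1 -> eigenvalue v w 1 0 < eigenvalue v w 1 (-1) ->
  (forall N m n, (2 <= N)%nat -> In (m, n) (shell N) ->
    3 * eigenvalue v w 1 0 <= eigenvalue v w m n) ->
  (forall k, fourier_series (heat_coefficient v w (t k)) a' b'
    <= fourier_series (heat_coefficient v w (t k)) a b) ->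
  cos (2 * PI * a') + chi * cos (2 * PI * b') <= cos (2 * PI * a) + chi * cos (2 * PI * b).
Proof.
  intros Hd Hw Htpos Ht Hchi H11 H1m Htail Hle.
  set (l10 := eigenvalue v w 1 0) in *. set (l01 := eigenvalue v w 0 1) in *.
  set (l11 := eigenvalue v w 1 1) in *. set (l1m := eigenvalue v w 1 (-1)) in *.
  assert (Hl10 : 0 < l10).
  { unfold l10, eigenvalue. apply Rdiv_lt_0_compat; [ | now apply pow2_gt_0].
    replace (1 ^ 2 * dot w w - 2 * 1 * 0 * dot v w + 0 ^ 2 * dot v v) with (dot w w) by ring.
    assert (Hpi := pow_lt PI 2 PI_RGT_0). nra. }
  assert (Habs : 0 < Rabs (det v w)) by now apply Rabs_pos_lt.
  (* The scaling gives the wave of index [(1, 0)] the coefficient 1: the area cancels the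
     normalization of the series, and 1/2 the pairing of opposite indices. *)
  set (R := fun k a b => exp (l10 * t k) * Rabs (det v w) / 2
    * fourier_tail (heat_coefficient v w (t k)) a b).
  set (F := fun k a b => exp (l10 * t k) * Rabs (det v w) / 2
    * (fourier_series (heat_coefficient v w (t k)) a b
       - heat_coefficient v w (t k) 0 0)).
  assert (HF : forall k a b, F k a b = cos (2 * PI * a) + exp (- (l01 - l10) * t k) * cos (2 * PI * b)
    + exp (- (l11 - l10) * t k) * wave 1 1 0 a b + exp (- (l1m - l10) * t k) * wave 1 (-1) 0 a b
    + R k a b).
  { intros k x y. unfold F, R. rewrite fourier_series_head.
    - unfold heat_coefficient. fold l10 l01 l11 l1m.
      replace (wave 1 0 0 x y) with (cos (2 * PI * x)) by (unfold wave; f_equal; ring).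
      replace (wave 0 1 0 x y) with (cos (2 * PI * y)) by (unfold wave; f_equal; ring).
      assert (E : forall l, exp (- (l - l10) * t k) = exp (l10 * t k) * exp (- l * t k)).
      { intros l. rewrite <- exp_plus. f_equal. ring. }
      rewrite !E.
      assert (E' : exp (l10 * t k) * exp (- l10 * t k) = 1).
      { rewrite <- exp_plus, <- exp_0. f_equal. ring. }
      transitivity (exp (l10 * t k) * exp (- l10 * t k) * cos (2 * PI * x)
        + exp (l10 * t k) * exp (- l01 * t k) * cos (2 * PI * y)
        + exp (l10 * t k) * exp (- l11 * t k) * wave 1 1 0 x y
        + exp (l10 * t k) * exp (- l1m * t k) * wave 1 (-1) 0 x y
        + exp (l10 * t k) * Rabs (det v w) / 2 *
          fourier_tail (fun m n => exp (- eigenvalue v w m n * t k) / Rabs (det v w)) x y).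
      + field. lra.
      + rewrite E'. ring.
    - intros. left. now apply heat_coefficient_pos.
    - apply heat_coefficient_neg.
    - now apply heat_coefficient_summable. }
  assert (HR : forall a b, is_lim_seq (fun k => R k a b) 0).
  { intros x y.
    set (B := Series (fun N => shell_sum (heat_coefficient v w 1) (2 + N))).
    set (C := Rabs (det v w) / 2 * (exp (3 * l10) *
      B)).
    apply is_lim_seq_abs_0.
    apply (is_lim_seq_le_le_loc (fun _ => 0) _ (fun k => C * exp (- (2 * l10) * t k))).
    - destruct (proj2 (is_lim_seq_spec _ _) Ht 1) as [k0 Hk0]. exists k0. intros k Hk.
      specialize (Hk0 k Hk). split; [apply Rabs_pos | ].
      unfold R. rewrite Rabs_mult, (Rabs_pos_eq (_ / 2)).
      2:{ assert (He := exp_pos (l10 * t k)). apply Rle_mult_inv_pos; nra. }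
      (* For [t >= 1] the tail is compared with the one at time 1: every eigenvalue in it is at
         least [3 * l10], so it gains the factor [exp (- (3 * l10) * (t - 1))], which beats the
         scaling [exp (l10 * t)]. *)
      assert (Hb := fourier_tail_bound (heat_coefficient v w (t k)) (heat_coefficient v w 1)
        (exp (- (3 * l10) * (t k - 1))) x y
        (fun m n => Rlt_le _ _ (heat_coefficient_pos v w (t k) m n Hd))).
      assert (Hb' : Rabs (fourier_tail (heat_coefficient v w (t k)) x y) <=
        exp (- (3 * l10) * (t k - 1)) * B).
      { apply Hb; [ | apply heat_coefficient_summable; [exact Hd | lra]].
        intros N m n HN Hin. specialize (Htail N m n HN Hin). unfold heat_coefficient, Rdiv.
        rewrite <- Rmult_assoc. apply Rmult_le_compat_r.
        - left. now apply Rinv_0_lt_compat.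
        - rewrite <- exp_plus. apply exp_le. nra. }
      unfold C.
      replace (Rabs (det v w) / 2 * (exp (3 * l10) *
        B) *
        exp (- (2 * l10) * t k)) with
        (exp (l10 * t k) * Rabs (det v w) / 2 * (exp (- (3 * l10) * (t k - 1)) *
        B)).
      + apply Rmult_le_compat_l; [ | exact Hb'].
        assert (He := exp_pos (l10 * t k)). apply Rle_mult_inv_pos; nra.
      + assert (E : exp (l10 * t k) * exp (- (3 * l10) * (t k - 1))
          = exp (3 * l10) * exp (- (2 * l10) * t k)) by (rewrite <- !exp_plus; f_equal; ring).
        transitivity (exp (l10 * t k) * exp (- (3 * l10) * (t k - 1)) * (Rabs (det v w) / 2) *
          B);
          [field | rewrite E; field].
    - apply is_lim_seq_const.
    - replace 0 with (C * 0) at 1 by ring.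
      apply (is_lim_seq_scal_l _ C 0). apply is_lim_seq_exp_decay; [lra | exact Ht]. }
  assert (HlimF : forall a b, is_lim_seq (fun k => F k a b) (cos (2 * PI * a) + chi * cos (2 * PI * b))).
  { intros x y. apply (is_lim_seq_ext _ _ _ (fun k => eq_sym (HF k x y))).
    replace (cos (2 * PI * x) + chi * cos (2 * PI * y))
      with (cos (2 * PI * x) + chi * cos (2 * PI * y) + 0 * wave 1 1 0 x y
        + 0 * wave 1 (-1) 0 x y + 0) by ring.
    repeat apply is_lim_seq_plus'.
    - apply is_lim_seq_const.
    - now apply (is_lim_seq_scal_r _ (cos (2 * PI * y)) chi).
    - apply (is_lim_seq_scal_r _ (wave 1 1 0 x y) 0).
      apply is_lim_seq_exp_decay; [lra | exact Ht].
    - apply (is_lim_seq_scal_r _ (wave 1 (-1) 0 x y) 0).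
      apply is_lim_seq_exp_decay; [lra | exact Ht].
    - apply HR. }
  apply (is_lim_seq_le (fun k => F k a' b') (fun k => F k a b)
    (cos (2 * PI * a') + chi * cos (2 * PI * b')) (cos (2 * PI * a) + chi * cos (2 * PI * b)));
    [ | apply HlimF | apply HlimF].
  intros k. unfold F. apply Rmult_le_compat_l.
  - assert (He := exp_pos (l10 * t k)). apply Rle_mult_inv_pos; nra.
  - specialize (Hle k). lra.
Qed.

Lemma lattice_basis_zero Lam v w : lattice_basis Lam v w -> Lam zero.
Proof.
  intros [_ Hb]. apply Hb. exists 0%Z, 0%Z. point_ring; ring.
Qed.

Lemma angle_obtuse_triangular (v w : point) (P : R) :
  0 < P -> dot v v = P -> dot w w = P -> dot v w = - P / 2 -> norm v = norm w /\ angle v w = 2 * PI / 3.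
Proof.
  intros HP Hv Hw Hr. unfold angle. rewrite !norm_sqrt_dot, Hv, Hw, Hr. split; trivial.
  rewrite sqrt_sqrt by lra.
  replace (- P / 2 / P) with (cos (2 * (PI / 3))).
  - rewrite acos_cos by (assert (Hpi := PI_RGT_0); lra). field.
  - rewrite cos_2PI3. field. lra.
Qed.

Definition in_voronoi_cell (v w : point) (a b : R) : Prop :=
  forall m n : Z, norm (lattice_point v w a b)
    <= norm (plus (lattice_point v w a b) (lattice_point v w (IZR m) (IZR n))).

(* The point [al v + be w] is a vertex of the Voronoi cell of the origin: it is equidistant from
   [0], [v] and [v - w]. *)
Lemma voronoi_vertex v w al be :
  0 <= 2 * dot v w <= dot w w -> dot w w <= dot v v ->
  al * dot v v + be * dot v w = dot v v / 2 ->
  al * dot v w + be * dot w w = dot v w - dot w w / 2 ->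
  in_voronoi_cell v w al be.
Proof.
  intros Hr Hq H1 H2 m n. rewrite !norm_sqrt_dot. apply sqrt_le_1_alt.
  replace (plus (lattice_point v w al be) (lattice_point v w (IZR m) (IZR n)))
    with (lattice_point v w (al + IZR m) (be + IZR n)) by (point_ring; ring).
  rewrite !dot_lattice_point.
  set (P := dot v v) in *. set (Q := dot w w) in *. set (r := dot v w) in *.
  (* The shift by 1 removes the linear terms from the difference of squared distances, up to
     products [z * (z - 1)], nonnegative at integers. If [k * x] is negative, the worst case is
     [P = Q = 2 * r], which leaves an integer inequality. *)
  set (k := IZR m + 1). set (x := IZR n).
  assert (E : (al + IZR m) ^ 2 * P + 2 * (al + IZR m) * (be + IZR n) * r + (be + IZR n) ^ 2 * Q
    - (al ^ 2 * P + 2 * al * be * r + be ^ 2 * Q)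
    = P * (k * (k - 1)) + Q * (x * (x - 1)) + 2 * r * (k * x)).
  { transitivity (IZR m ^ 2 * P + 2 * IZR m * IZR n * r + IZR n ^ 2 * Q
      + 2 * IZR m * (al * P + be * r) + 2 * IZR n * (al * r + be * Q)); [ring | ].
    rewrite H1, H2. unfold k, x. field. }
  assert (Hk : 0 <= k * (k - 1)).
  { unfold k. replace ((IZR m + 1) * (IZR m + 1 - 1)) with (IZR (m * (m + 1)))
      by (rewrite mult_IZR, plus_IZR; ring). apply IZR_le. nia. }
  assert (Hx : 0 <= x * (x - 1)).
  { unfold x. rewrite <- minus_IZR, <- mult_IZR. apply IZR_le. nia. }
  assert (Hkx : 0 <= k * (k - 1) + x * (x - 1) + Rmin 0 (k * x)).
  { apply Rmin_case; [lra | ].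
    unfold k, x. replace ((IZR m + 1) * (IZR m + 1 - 1) + IZR n * (IZR n - 1) + (IZR m + 1) * IZR n)
      with (IZR (m * (m + 1) + n * (n - 1) + (m + 1) * n))
      by (rewrite !plus_IZR, !mult_IZR, minus_IZR, plus_IZR; ring).
    apply IZR_le.
    assert (Hcons : forall z : Z, (0 <= z * (z - 1))%Z) by (intros z; nia).
    assert (H3 := Hcons (m + 1)%Z). assert (H4 := Hcons n). assert (H5 := Hcons (m + 1 + n)%Z).
    destruct (Z.le_gt_cases 0 ((m + 1) * n)); nia. }
  assert (0 <= P * (k * (k - 1)) + Q * (x * (x - 1)) + 2 * r * (k * x)); [ | unfold k, x in *; lra].
  destruct (Rle_dec 0 (k * x)) as [Hs|Hs].
  - assert (0 <= P * (k * (k - 1))) by (apply Rmult_le_pos; lra).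
    assert (0 <= Q * (x * (x - 1))) by (apply Rmult_le_pos; lra).
    assert (0 <= 2 * r * (k * x)) by (apply Rmult_le_pos; lra). lra.
  - rewrite Rmin_right in Hkx by lra.
    apply Rle_trans with (Q * (k * (k - 1) + x * (x - 1) + k * x));
      [apply Rmult_le_pos; lra | ]. nra.
Qed.

Lemma eigenvalue_order v w : det v w <> 0 ->
  forall m n i j,
  IZR m ^ 2 * dot w w - 2 * IZR m * IZR n * dot v w + IZR n ^ 2 * dot v v
  < IZR i ^ 2 * dot w w - 2 * IZR i * IZR j * dot v w + IZR j ^ 2 * dot v v ->
  eigenvalue v w m n < eigenvalue v w i j.
Proof.
  intros Hd m n i j H. unfold eigenvalue, Rdiv. apply Rmult_lt_compat_r.
  - apply Rinv_0_lt_compat. now apply pow2_gt_0.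
  - apply Rmult_lt_compat_l; [ | exact H]. assert (Hpi := pow_lt PI 2 PI_RGT_0). lra.
Qed.

(** For a reduced basis the dual form is at least [dot w w] times m^2 - |m n| + n^2, which is at
    least 3 outside the first shell; the index [(2, 1)] attains 3. *)
Lemma eigenvalue_far v w : det v w <> 0 ->
  0 <= 2 * dot v w <= dot w w -> dot w w <= dot v v ->
  forall N m n, (2 <= N)%nat -> In (m, n) (shell N) ->
    3 * eigenvalue v w 1 0 <= eigenvalue v w m n.
Proof.
  intros Hd Hr Hq N m n HN Hin. apply shell_spec in Hin; cbn [fst snd] in Hin.
  assert (Hmn : 3 <= IZR m ^ 2 - Rabs (IZR m * IZR n) + IZR n ^ 2).
  { rewrite <- mult_IZR, <- abs_IZR, !pow_IZR, <- minus_IZR, <- plus_IZR. apply IZR_le.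
    rewrite Z.abs_mul. change (Z.of_nat 2) with 2%Z.
    change (3 <= m ^ 2 - Z.abs m * Z.abs n + n ^ 2)%Z.
    rewrite (Z.pow_even_abs m 2), (Z.pow_even_abs n 2) by (now exists 1%Z).
    set (x := Z.abs m) in *. set (y := Z.abs n) in *. nia. }
  unfold eigenvalue.
  replace (3 * (4 * PI ^ 2 * (1 ^ 2 * dot w w - 2 * 1 * 0 * dot v w + 0 ^ 2 * dot v v) / det v w ^ 2))
    with (4 * PI ^ 2 * (3 * dot w w) / det v w ^ 2) by (field; exact Hd).
  unfold Rdiv. apply Rmult_le_compat_r.
  { left. apply Rinv_0_lt_compat. now apply pow2_gt_0. }
  apply Rmult_le_compat_l.
  { assert (Hpi := pow_lt PI 2 PI_RGT_0). lra. }
  assert (H1 := Rle_abs (IZR m * IZR n)). assert (H0 := Rabs_pos (IZR m * IZR n)).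
  apply Rle_trans with (dot w w * (IZR m ^ 2 - Rabs (IZR m * IZR n) + IZR n ^ 2)); [nra | ].
  assert (2 * IZR m * IZR n * dot v w <= Rabs (IZR m * IZR n) * dot w w) by nra.
  assert (Hn := pow2_ge_0 (IZR n)). nra.
Qed.

(** No lattice translate of a point of the Voronoi cell is closer to the origin, so the segment from
    the origin to it is a minimal geodesic. *)
Lemma geodesic_comparison Lam K v w al be t s :
  heat_kernel Lam K -> lattice_basis Lam v w -> 0 < t -> geodesically_decreasing Lam (K t) ->
  in_voronoi_cell v w al be ->
  0 <= s <= 1 ->
  fourier_series (heat_coefficient v w t) al be
  <= fourier_series (heat_coefficient v w t) (s * al) (s * be).
Proof.
  intros HK Hb Ht Hdec Hvor Hs.
  set (y := lattice_point v w al be).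
  assert (Hgeo : minimal_geodesic Lam 1 (fun s => scal s y)).
  { split; [lra | ]. exists y. split.
    - intros s' _. rewrite (scal_zero_l (K := R_Ring)), plus_zero_l. reflexivity.
    - destruct (torus_dist_glb Lam (scal 0 y) (scal 1 y) zero (lattice_basis_zero _ _ _ Hb))
        as [H1 H2].
      assert (E : minus (scal 1 y) (scal 0 y) = y).
      { unfold minus, opp; simpl. point_ring; unfold opp; simpl; ring. }
      assert (En : forall l, norm (plus (minus (scal 1 y) (scal 0 y)) l) = norm (plus y l))
        by exact (fun l => f_equal (fun z => norm (plus z l)) E).
      rewrite Rmult_1_l. apply Rle_antisym.
      + apply H2. intros l Hl. apply Rle_trans with (norm (plus y l)); [ | right; symmetry; apply En].
        destruct Hb as [_ Hb]. apply Hb in Hl as [m [n ->]]. apply Hvor.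
      + apply Rle_trans with (1 := H1 zero (lattice_basis_zero _ _ _ Hb)).
        right. transitivity (norm (plus y zero)); [apply En | now rewrite plus_zero_r]. }
  assert (H := Hdec zero 1 _ Hgeo (scal_zero_l (K := R_Ring) y) s 1 (proj1 Hs) (proj2 Hs) (Rle_refl 1)).
  assert (E1 : scal 1 y = plus zero (lattice_point v w al be)).
  { rewrite plus_zero_l. apply (scal_one (K := R_Ring)). }
  assert (E2 : scal s y = plus zero (lattice_point v w (s * al) (s * be))).
  { rewrite plus_zero_l. unfold y. point_ring; ring. }
  change (K t zero (scal 1 y) <= K t zero (scal s y)) in H. rewrite E1, E2 in H.
  rewrite !(heat_kernel_series Lam K v w) in H by assumption. exact H.
Qed.

Lemma decreasing_at_large_times Lam K : rank_two_lattice Lam -> heat_kernel Lam K ->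
  (exists t : nat -> R, (forall k, 0 < t k) /\ is_lim_seq t p_infty /\
     (forall k, geodesically_decreasing Lam (K (t k)))) ->
  rectangular Lam \/ regular_triangular Lam.
Proof.
  intros Hrank HK [t [Htpos [Ht Hdec]]].
  destruct (reduced_basis Lam Hrank) as [v [w [Hb [Hr Hq]]]].
  assert (Hd := lattice_basis_det _ _ _ Hb).
  destruct (Req_dec (dot v w) 0) as [H0|H0]; [left; now exists v, w | ].
  (* Equality forces both squared lengths to be [2 * dot v w], an angle of [PI / 3]; negating [w]
     makes it [2 * PI / 3]. *)
  destruct (Req_dec (dot v v) (2 * dot v w)) as [H1|H1].
  { right. exists (lattice_point v w 1 0), (lattice_point v w 0 (-1)).
    split; [exact (lattice_basis_change Lam v w 1 0 0 (-1) Hb eq_refl) | ].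
    apply (angle_obtuse_triangular _ _ (dot v v)); rewrite ?dot_lattice_points; lra. }
  exfalso.
  assert (Hg := gram_det v w). assert (Hd2 : 0 < det v w ^ 2) by now apply pow2_gt_0.
  assert (Hpi := PI_RGT_0).
  set (P := dot v v) in *. set (Q := dot w w) in *. set (r := dot v w) in *.
  assert (HD : 0 < P * Q - r ^ 2) by lra.
  (* [al0] and [be0] are the coordinates of the circumcentre of 0, [v], [w]. Its image under
     [p -> v - p] is the circumcentre of 0, [v], [v - w], with coordinates [al] and [be]. *)
  set (al0 := Q * (P - r) / (2 * (P * Q - r ^ 2))).
  set (be0 := P * (Q - r) / (2 * (P * Q - r ^ 2))).
  assert (Hal0 : 0 < al0 < 1 / 2).
  { unfold al0. split.
    - apply Rdiv_lt_0_compat; nra.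
    - apply Rlt_div_l; nra. }
  set (al := 1 - al0). set (be := - be0).
  assert (Hvor : in_voronoi_cell v w al be).
  { apply voronoi_vertex; fold P Q r; trivial; unfold al, be, al0, be0; field; lra. }
  assert (Hcmp : forall chi : R, is_lim_seq (fun k =>
      exp (- (eigenvalue v w 0 1 - eigenvalue v w 1 0) * t k)) chi ->
    forall s, 0 <= s <= 1 ->
    cos (2 * PI * al) + chi * cos (2 * PI * be)
    <= cos (2 * PI * (s * al)) + chi * cos (2 * PI * (s * be))).
  { intros chi Hchi s Hs.
    apply (large_time_comparison v w t chi (s * al) (s * be) al be); fold Q; trivial.
    - lra.
    - apply eigenvalue_order; trivial; fold P Q r. lra.
    - apply eigenvalue_order; trivial; fold P Q r. lra.
    - now apply eigenvalue_far.
    - intros k. now apply (geodesic_comparison Lam K). }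
  (* If the lengths agree, both leading waves persist ([chi = 1]) and their sum has positive
     derivative at the vertex. Otherwise [chi = 0], and the remaining wave is already minimal where
     the first coordinate is 1/2, before the vertex. *)
  destruct (Req_dec P Q) as [HPQ|HPQ].
  - assert (Hchi : is_lim_seq (fun k =>
      exp (- (eigenvalue v w 0 1 - eigenvalue v w 1 0) * t k)) 1).
    { apply (is_lim_seq_ext (fun _ => 1)); [ | apply is_lim_seq_const].
      intros k. rewrite <- exp_0. f_equal.
      replace (eigenvalue v w 0 1) with (eigenvalue v w 1 0); [ring | ].
      unfold eigenvalue. fold P Q r. rewrite HPQ. f_equal. ring. }
    assert (Hbe0 : be0 = al0) by (unfold be0, al0; now rewrite HPQ).
    set (g := fun s => cos (2 * PI * (s * al)) + 1 * cos (2 * PI * (s * be))).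
    assert (Hder : is_derive g 1 (2 * PI * (1 - 2 * al0) * sin (2 * PI * al0))).
    { unfold g. auto_derive; trivial. unfold al, be. rewrite Hbe0.
      replace (2 * PI * (1 * (1 - al0))) with (- (2 * PI * al0) + 2 * INR 1 * PI)
        by (simpl; ring).
      replace (2 * PI * (1 * - al0)) with (- (2 * PI * al0)) by ring.
      rewrite sin_period, !sin_neg. simpl. ring. }
    assert (Hsin : 0 < sin (2 * PI * al0)) by (apply sin_gt_0; nra).
    assert (Hneg : 2 * PI * (1 - 2 * al0) * sin (2 * PI * al0) <= 0).
    { assert (Hder' : is_derive (fun s => - g s) 1 (- (2 * PI * (1 - 2 * al0) * sin (2 * PI * al0))))
        by exact (is_derive_opp (K := R_AbsRing) (V := R_NormedModule) g 1 _ Hder).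
      apply (derive_left_max _ _ _ 1) in Hder'; [lra | lra | ].
      intros h Hh. specialize (Hcmp 1 Hchi (1 - h) ltac:(lra)).
      change (- g (1 - h) <= - g 1). unfold g. rewrite !(Rmult_1_l al), !(Rmult_1_l be). lra. }
    assert (0 < 2 * PI * (1 - 2 * al0) * sin (2 * PI * al0))
      by (apply Rmult_lt_0_compat; [nra | exact Hsin]).
    lra.
  - assert (Hchi : is_lim_seq (fun k =>
      exp (- (eigenvalue v w 0 1 - eigenvalue v w 1 0) * t k)) 0).
    { apply is_lim_seq_exp_decay; [ | exact Ht].
      assert (eigenvalue v w 1 0 < eigenvalue v w 0 1); [ | lra].
      apply eigenvalue_order; trivial; fold P Q r. lra. }
    assert (Hal : 1 / 2 < al < 1) by (unfold al; lra).
    assert (Hs : 0 <= / (2 * al) <= 1).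
    { split; [left; apply Rinv_0_lt_compat; lra | ].
      rewrite <- Rinv_1. apply Rinv_le_contravar; lra. }
    specialize (Hcmp 0 Hchi (/ (2 * al)) Hs).
    replace (2 * PI * (/ (2 * al) * al)) with PI in Hcmp by (field; lra).
    rewrite cos_PI, !Rmult_0_l, !Rplus_0_r in Hcmp.
    replace (2 * PI * al) with ((2 * PI * al - PI) + PI) in Hcmp by ring.
    rewrite neg_cos in Hcmp.
    assert (cos (2 * PI * al - PI) < cos 0) by (apply cos_decreasing_1; nra).
    rewrite cos_0 in H. lra.
Qed.

(** * The maximum principle in a fundamental triangle *)

Lemma unit_interval_max (f : R -> R) : (forall x, 0 <= x <= 1 -> continuous f x) ->
  exists m, 0 <= m <= 1 /\ forall x, 0 <= x <= 1 -> f x <= f m.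
Proof.
  intros Hc. destruct (continuity_ab_maj f 0 1) as [m [Hm Hm']]; [lra | | now exists m].
  intros x Hx. now apply continuity_pt_filterlim, Hc.
Qed.

(** The maximizer [m] is chosen with no regularity; only the maximal value depends continuously on
    [q]. This suffices to iterate over the variables. *)
Lemma continuous_fiber_max (U : UniformSpace) (h : U -> R -> R) :
  (forall q b, continuous (fun z : U * R => h (fst z) (snd z)) (q, b)) ->
  exists m : U -> R,
    (forall q, 0 <= m q <= 1 /\ forall b, 0 <= b <= 1 -> h q b <= h q (m q)) /\
    (forall q, continuous (fun q => h q (m q)) q).
Proof.
  intros Hc.
  destruct (choice (fun q m => 0 <= m <= 1 /\ forall b, 0 <= b <= 1 -> h q b <= h q m))
    as [m Hm].
  { intros q. apply unit_interval_max. intros. now apply continuous_section. }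
  exists m. split; [exact Hm | ]. intros p. apply filterlim_locally. intros eps.
  generalize (near_uniformly_on_unit_interval U h p (fun b _ => Hc p b) eps).
  apply filter_imp. intros q Hq.
  change (Rabs (h q (m q) - h p (m p)) < eps).
  destruct (Hm p) as [Hp1 Hp2], (Hm q) as [Hq1 Hq2].
  assert (H1 := Hq _ Hp1). assert (H2 := Hq _ Hq1).
  specialize (Hp2 _ Hq1). specialize (Hq2 _ Hp1).
  apply Rabs_def2 in H1. apply Rabs_def2 in H2. apply Rabs_def1; lra.
Qed.

Lemma unit_cube_max (f : R -> R -> R -> R) :
  (forall z : (R * R) * R, continuous (fun z => f (fst (fst z)) (snd (fst z)) (snd z)) z) ->
  exists x y z, 0 <= x <= 1 /\ 0 <= y <= 1 /\ 0 <= z <= 1 /\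
  forall x' y' z', 0 <= x' <= 1 -> 0 <= y' <= 1 -> 0 <= z' <= 1 -> f x' y' z' <= f x y z.
Proof.
  intros Hc.
  destruct (continuous_fiber_max (prod_UniformSpace R_UniformSpace R_UniformSpace)
    (fun q z => f (fst q) (snd q) z)) as [m3 [H3 C3]]; [intros; apply Hc | ].
  destruct (continuous_fiber_max R_UniformSpace (fun x y => f x y (m3 (x, y)))) as [m2 [H2 C2]].
  { intros x y. apply (continuous_ext (fun q => f (fst q) (snd q) (m3 q))); [ | apply C3].
    now intros [a b]. }
  destruct (unit_interval_max (fun x => f x (m2 x) (m3 (x, m2 x)))) as [x [Hx H1]];
    [intros; apply C2 | ].
  exists x, (m2 x), (m3 (x, m2 x)). repeat split; try apply Hx; try apply H2; try apply H3.
  intros x' y' z' Hx' Hy' Hz'.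
  apply Rle_trans with (f x' y' (m3 (x', y'))); [now apply (proj2 (H3 (x', y'))) | ].
  apply Rle_trans with (f x' (m2 x') (m3 (x', m2 x'))); [now apply (proj2 (H2 x')) | ].
  now apply H1.
Qed.

Lemma second_derivative_max (f f' : R -> R) (x l d : R) :
  (forall y, is_derive f y (f' y)) -> is_derive f' x l -> 0 < d ->
  (forall h, 0 < h < d -> f (x + h) <= f x /\ f (x - h) <= f x) -> l <= 0.
Proof.
  intros Hf Hf' Hd Hmax. apply Rnot_lt_le. intros Hl.
  assert (H0 : f' x = 0).
  { apply Rle_antisym.
    - apply (derive_right_max f x _ d); auto. intros; now apply Hmax.
    - apply (derive_left_max f x _ d); auto. intros; now apply Hmax. }
  destruct (proj1 (is_derive_Reals f' x l) Hf' l Hl) as [delta Hdelta].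
  set (h := Rmin (delta / 2) (d / 2)).
  assert (Hh : 0 < h < d /\ h < delta).
  { destruct delta as [e He]; simpl in *. unfold h. repeat split.
    - apply Rmin_case; lra.
    - apply Rle_lt_trans with (1 := Rmin_r _ _). lra.
    - apply Rle_lt_trans with (1 := Rmin_l _ _). lra. }
  destruct (MVT_cor2 f f' x (x + h)) as [c [Hc1 Hc2]]; [lra | | ].
  { intros c _. apply is_derive_Reals, Hf. }
  specialize (Hdelta (c - x) ltac:(lra) ltac:(rewrite Rabs_pos_eq; lra)).
  replace (x + (c - x)) with c in Hdelta by ring. rewrite H0 in Hdelta.
  apply Rabs_def2 in Hdelta.
  assert (0 < (f' c - 0) / (c - x)) by lra.
  assert ((f' c - 0) / (c - x) * (c - x) = f' c) by (field; lra).
  assert (Hpos : 0 < f' c) by nra.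
  destruct (Hmax h (proj1 Hh)) as [Hm _].
  replace (x + h - x) with h in Hc1 by ring. nra.
Qed.

(* Finite sums of the solutions [c exp (- (mu^2 + nu^2 / 3) t) cos (mu x + nu y + th)] of
   [u_t = u_xx + u_yy / 3], encoded by the lists of their parameters [((c, th), (mu, nu))]. *)
Definition mode : Type := ((R * R) * (R * R))%type.

Definition heat_mode (t x y : R) (q : mode) : R :=
  let '((c, th), (mu, nu)) := q in
  c * exp (- (mu ^ 2 + nu ^ 2 / 3) * t) * cos (mu * x + nu * y + th).

Definition heat_sum (l : list mode) (t x y : R) : R := rsum l (heat_mode t x y).

(** Derivative in the direction [(p, q)]; the phase shift keeps derivatives within the class of
    modes. *)
Definition derive_mode (p q : R) (m : mode) : mode :=
  let '((c, th), (mu, nu)) := m in ((c * (p * mu + q * nu), th + PI / 2), (mu, nu)).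

Definition derive_modes (p q : R) (l : list mode) : list mode := map (derive_mode p q) l.

Lemma heat_sum_derive l p q t x y s :
  is_derive (fun s => heat_sum l t (x + p * s) (y + q * s)) s
    (heat_sum (derive_modes p q l) t (x + p * s) (y + q * s)).
Proof.
  induction l as [|[[c th] [mu nu]] l IH].
  - apply (is_derive_const (K := R_AbsRing) (V := R_NormedModule) 0).
  - apply (is_derive_plus (fun s => heat_mode t (x + p * s) (y + q * s) ((c, th), (mu, nu)))
      (fun s => heat_sum l t (x + p * s) (y + q * s))); [ | exact IH].
    unfold heat_mode, derive_mode. auto_derive; trivial.
    rewrite <- (Rplus_assoc _ th (PI / 2)), cos_plus, cos_PI2, sin_PI2. simpl. ring.
Qed.

Lemma heat_sum_derive_time l t x y :
  is_derive (fun t => heat_sum l t x y) t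
    (heat_sum (derive_modes 1 0 (derive_modes 1 0 l)) t x y +
     heat_sum (derive_modes 0 1 (derive_modes 0 1 l)) t x y / 3).
Proof.
  induction l as [|[[c th] [mu nu]] l IH].
  - apply (is_derive_value _ _ 0); [unfold heat_sum; simpl; field | ].
    apply (is_derive_const (K := R_AbsRing) (V := R_NormedModule) 0).
  - apply (is_derive_value _ _ (- (mu ^ 2 + nu ^ 2 / 3) * heat_mode t x y ((c, th), (mu, nu)) +
      (heat_sum (derive_modes 1 0 (derive_modes 1 0 l)) t x y +
       heat_sum (derive_modes 0 1 (derive_modes 0 1 l)) t x y / 3))).
    + transitivity (heat_mode t x y (derive_mode 1 0 (derive_mode 1 0 ((c, th), (mu, nu)))) +
        heat_sum (derive_modes 1 0 (derive_modes 1 0 l)) t x y +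
        (heat_mode t x y (derive_mode 0 1 (derive_mode 0 1 ((c, th), (mu, nu)))) +
        heat_sum (derive_modes 0 1 (derive_modes 0 1 l)) t x y) / 3); [ | reflexivity].
      unfold derive_mode, heat_mode.
      replace (mu * x + nu * y + (th + PI / 2 + PI / 2)) with (mu * x + nu * y + th + PI) by field.
      rewrite neg_cos. field.
    + apply (is_derive_plus (fun t => heat_mode t x y ((c, th), (mu, nu)))
        (fun t => heat_sum l t x y)); [ | exact IH].
      unfold heat_mode. auto_derive; trivial. simpl. field.
Qed.

Lemma heat_sum_derive_linear l p q t x y :
  heat_sum (derive_modes p q l) t x y
  = p * heat_sum (derive_modes 1 0 l) t x y + q * heat_sum (derive_modes 0 1 l) t x y.
Proof.
  unfold heat_sum. induction l as [|[[c th] [mu nu]] l IH]; simpl; [ring | ].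
  rewrite IH. ring.
Qed.

Lemma heat_sum_derive_linear2 l p q r s t x y :
  heat_sum (derive_modes p q (derive_modes r s l)) t x y
  = r * heat_sum (derive_modes p q (derive_modes 1 0 l)) t x y
    + s * heat_sum (derive_modes p q (derive_modes 0 1 l)) t x y.
Proof.
  unfold heat_sum. induction l as [|[[c th] [mu nu]] l IH]; simpl; [ring | ].
  rewrite IH. ring.
Qed.

Lemma continuous_heat_sum (U : UniformSpace) (l : list mode) (f g h : U -> R) (z : U) :
  continuous f z -> continuous g z -> continuous h z ->
  continuous (fun z => heat_sum l (f z) (g z) (h z)) z.
Proof.
  intros Hf Hg Hh. induction l as [|[[c th] [mu nu]] l IH].
  - apply continuous_const.
  - apply (continuous_plus (fun z => heat_mode (f z) (g z) (h z) ((c, th), (mu, nu)))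
      (fun z => heat_sum l (f z) (g z) (h z))); [ | exact IH].
    unfold heat_mode. prove_continuous.
Qed.

(** Turns a reflection symmetry into a boundary condition: the two directions are exchanged by the
    reflection and the base points lie on its axis. *)
Lemma heat_sum_derive_eq l p q l' p' q' t x y x' y' :
  (forall s, heat_sum l t (x + p * s) (y + q * s) = heat_sum l' t (x' + p' * s) (y' + q' * s)) ->
  heat_sum (derive_modes p q l) t x y = heat_sum (derive_modes p' q' l') t x' y'.
Proof.
  intros H.
  assert (H1 := heat_sum_derive l p q t x y 0). assert (H2 := heat_sum_derive l' p' q' t x' y' 0).
  rewrite !Rmult_0_r, !Rplus_0_r in H1, H2.
  rewrite <- (is_derive_unique _ _ _ H1), <- (is_derive_unique _ _ _ H2).
  now apply Derive_ext.
Qed.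

(** The coefficient 5 exceeds the value 2 + 6/3 of the spatial operator, making this a strict
    supersolution. The centre (2, 1/2) gives positive outward derivatives on all three sides: 3 on
    [y = 0], 2 (PI - 2) on [x = PI], and 1 along (-1, 1) on [x = 3 * y], all times [eps]. *)
Definition barrier (eps t x y : R) : R := eps * ((x - 2) ^ 2 + 3 * (y - 1 / 2) ^ 2 + 5 * t).

(** One twelfth of the hexagonal Voronoi cell. As [y] is the Euclidean ordinate divided by sqrt 3,
    the side [x = 3 * y] makes an angle of 30 degrees with the side [y = 0]. *)
Definition in_chamber (x y : R) : Prop := 0 <= y /\ 3 * y <= x /\ x <= PI.

Lemma barrier_sub_derive l eps t x y p q s :
  is_derive (fun s => heat_sum l t (x + p * s) (y + q * s) - barrier eps t (x + p * s) (y + q * s)) s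
    (heat_sum (derive_modes p q l) t (x + p * s) (y + q * s)
     - eps * (2 * p * (x + p * s - 2) + 6 * q * (y + q * s - 1 / 2))).
Proof.
  apply is_derive_sub; [apply heat_sum_derive | ].
  unfold barrier. auto_derive; trivial. field.
Qed.

Lemma barrier_sub_derive_0 l eps t x y p q :
  is_derive (fun s => heat_sum l t (x + p * s) (y + q * s) - barrier eps t (x + p * s) (y + q * s)) 0
    (heat_sum (derive_modes p q l) t x y - eps * (2 * p * (x - 2) + 6 * q * (y - 1 / 2))).
Proof.
  assert (H := barrier_sub_derive l eps t x y p q 0).
  now rewrite !Rmult_0_r, !Rplus_0_r in H.
Qed.

Lemma barrier_sub_second_max l eps t x y p q d : 0 < d ->
  (forall h, - d < h < d ->
    heat_sum l t (x + p * h) (y + q * h) - barrier eps t (x + p * h) (y + q * h)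
    <= heat_sum l t x y - barrier eps t x y) ->
  heat_sum (derive_modes p q (derive_modes p q l)) t x y <= eps * (2 * p ^ 2 + 6 * q ^ 2).
Proof.
  intros Hd Hmax.
  assert (H : heat_sum (derive_modes p q (derive_modes p q l)) t x y
    - eps * (2 * p ^ 2 + 6 * q ^ 2) <= 0); [ | lra].
  apply (second_derivative_max _ _ 0 _ d (barrier_sub_derive l eps t x y p q)); [ | exact Hd | ].
  - apply is_derive_sub.
    + assert (H := heat_sum_derive (derive_modes p q l) p q t x y 0).
      rewrite !Rmult_0_r, !Rplus_0_r in H. exact H.
    + auto_derive; trivial. ring.
  - intros h Hh. rewrite !Rmult_0_r, !(Rplus_0_r x), !(Rplus_0_r y).
    split; apply Hmax; lra.
Qed.

(** At such a point the second derivatives are at most [2 * eps] and [6 * eps], so the time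
    derivative of the sum is at most [4 * eps]; comparison with earlier times requires at least
    [5 * eps]. *)
Lemma barrier_no_interior_max l eps t1 t x y : 0 < eps ->
  0 < t <= t1 -> 0 < y -> 3 * y < x -> x < PI ->
  ~ (forall t' x' y', 0 <= t' <= t1 -> in_chamber x' y' ->
     heat_sum l t' x' y' - barrier eps t' x' y' <= heat_sum l t x y - barrier eps t x y).
Proof.
  intros He Ht Hy Hxy Hx Hmax.
  set (d := Rmin (Rmin (PI - x) y) ((x - 3 * y) / 3)).
  assert (Hd : 0 < d /\ d <= PI - x /\ d <= y /\ d <= (x - 3 * y) / 3).
  { unfold d. repeat split; [repeat apply Rmin_case; lra | | | apply Rmin_r];
      apply Rle_trans with (1 := Rmin_l _ _); [apply Rmin_l | apply Rmin_r]. }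
  assert (H1 : heat_sum (derive_modes 1 0 (derive_modes 1 0 l)) t x y <= eps * (2 * 1 ^ 2 + 6 * 0 ^ 2)).
  { apply (barrier_sub_second_max _ _ _ _ _ _ _ d); [tauto | ].
    intros h Hh. apply Hmax; [lra | unfold in_chamber; lra]. }
  assert (H2 : heat_sum (derive_modes 0 1 (derive_modes 0 1 l)) t x y <= eps * (2 * 0 ^ 2 + 6 * 1 ^ 2)).
  { apply (barrier_sub_second_max _ _ _ _ _ _ _ d); [tauto | ].
    intros h Hh. apply Hmax; [lra | unfold in_chamber; lra]. }
  assert (H3 := heat_sum_derive_time l t x y).
  set (ft := heat_sum (derive_modes 1 0 (derive_modes 1 0 l)) t x y +
    heat_sum (derive_modes 0 1 (derive_modes 0 1 l)) t x y / 3) in H3.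
  assert (H4 : is_derive (fun t => heat_sum l t x y - barrier eps t x y) t (ft - eps * 5)).
  { apply is_derive_sub; [exact H3 | ].
    unfold barrier. auto_derive; trivial. ring. }
  apply (derive_left_max _ _ _ t) in H4; [unfold ft in H4; lra | lra | ].
  intros h Hh. apply Hmax; [lra | unfold in_chamber; lra].
Qed.

(* The function [V] is symmetric under the reflections in the sides of the triangle, so its
   derivatives [F = V_x] and [G = V_y] satisfy [F_y = G = 0] on [y = 0], [F = G_x = 0] on [x = PI],
   and [F = G], [(3 F + G)_n = 0] for [n = (-1, 1)] on [x = 3 y]: a cooperative system, for which
   the maximum principle holds with a barrier whose outward normal derivatives are positive. *)
Lemma chamber_maximum_principle (l : list mode) :
  (forall t x y, heat_sum l t x (- y) = heat_sum l t x y) ->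
  (forall t x y, heat_sum l t (2 * PI - x) y = heat_sum l t x y) ->
  (forall t x y, heat_sum l t (x / 2 + 3 * y / 2) (x / 2 - y / 2) = heat_sum l t x y) ->
  (forall x y, in_chamber x y ->
     heat_sum (derive_modes 1 0 l) 0 x y <= 0 /\ heat_sum (derive_modes 0 1 l) 0 x y <= 0) ->
  forall t x y, 0 <= t -> in_chamber x y ->
     heat_sum (derive_modes 1 0 l) t x y <= 0 /\ heat_sum (derive_modes 0 1 l) t x y <= 0.
Proof.
  intros Sy Sx Sd Hinit.
  assert (Hpi : 3 < PI) by (assert (H := PI2_3_2); lra).
  set (lF := derive_modes 1 0 l) in *. set (lG := derive_modes 0 1 l) in *.
  assert (HG0 : forall t x, heat_sum lG t x 0 = 0).
  { intros t x. assert (H : heat_sum lG t x 0 = heat_sum (derive_modes 0 (-1) l) t x 0).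
    { apply heat_sum_derive_eq. intros s. rewrite <- Sy. f_equal; ring. }
    rewrite (heat_sum_derive_linear l 0 (-1)) in H. fold lF lG in H. lra. }
  assert (SF : forall t x y, heat_sum lF t x (- y) = heat_sum lF t x y).
  { intros t x y. apply heat_sum_derive_eq. intros s. rewrite <- Sy. f_equal; ring. }
  assert (HF0 : forall t x, heat_sum (derive_modes 0 1 lF) t x 0 = 0).
  { intros t x. assert (H : heat_sum (derive_modes 0 1 lF) t x 0
      = heat_sum (derive_modes 0 (-1) lF) t x 0).
    { apply heat_sum_derive_eq. intros s. rewrite <- SF. f_equal; ring. }
    rewrite (heat_sum_derive_linear lF 0 (-1)) in H. lra. }
  assert (HFpi : forall t y, heat_sum lF t PI y = 0).
  { intros t y. assert (H : heat_sum lF t PI y = heat_sum (derive_modes (-1) 0 l) t PI y).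
    { apply heat_sum_derive_eq. intros s. rewrite <- Sx. f_equal; ring. }
    rewrite (heat_sum_derive_linear l (-1) 0) in H. fold lF lG in H. lra. }
  assert (SG : forall t x y, heat_sum lG t (2 * PI - x) y = heat_sum lG t x y).
  { intros t x y. apply heat_sum_derive_eq. intros s. rewrite <- Sx. f_equal; ring. }
  assert (HGpi : forall t y, heat_sum (derive_modes 1 0 lG) t PI y = 0).
  { intros t y. assert (H : heat_sum (derive_modes 1 0 lG) t PI y
      = heat_sum (derive_modes (-1) 0 lG) t PI y).
    { apply heat_sum_derive_eq. intros s. rewrite <- SG. f_equal; ring. }
    rewrite (heat_sum_derive_linear lG (-1) 0) in H. lra. }
  assert (HFG : forall t y, heat_sum lF t (3 * y) y = heat_sum lG t (3 * y) y).
  { intros t y. assert (H : heat_sum lF t (3 * y) y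
      = heat_sum (derive_modes (1 / 2) (1 / 2) l) t (3 * y) y).
    { apply heat_sum_derive_eq. intros s. rewrite <- Sd. f_equal; field. }
    rewrite (heat_sum_derive_linear l (1 / 2) (1 / 2)) in H. fold lF lG in H. lra. }
  assert (SH : forall t x y, heat_sum (derive_modes 3 1 l) t (x / 2 + 3 * y / 2) (x / 2 - y / 2)
    = heat_sum (derive_modes 3 1 l) t x y).
  { intros t x y. apply heat_sum_derive_eq. intros s.
    rewrite <- (Sd t (x + 3 * s)). f_equal; field. }
  assert (HH : forall t y, 3 * heat_sum (derive_modes 1 (-1) lF) t (3 * y) y
    + heat_sum (derive_modes 1 (-1) lG) t (3 * y) y = 0).
  { intros t y. assert (H : heat_sum (derive_modes 1 (-1) (derive_modes 3 1 l)) t (3 * y) y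
      = heat_sum (derive_modes (-1) 1 (derive_modes 3 1 l)) t (3 * y) y).
    { apply heat_sum_derive_eq. intros s. rewrite <- SH. f_equal; field. }
    rewrite (heat_sum_derive_linear _ 1 (-1)), (heat_sum_derive_linear _ (-1) 1) in H.
    rewrite (heat_sum_derive_linear lF 1 (-1)), (heat_sum_derive_linear lG 1 (-1)).
    rewrite !(heat_sum_derive_linear2 l _ _ 3 1) in H. fold lF lG in H. lra. }
  assert (Hbpos : forall eps t x y, 0 < eps -> 0 <= t -> 0 <= barrier eps t x y).
  { intros eps t x y He Ht. unfold barrier. apply Rmult_le_pos; [lra | ].
    assert (H1 := pow2_ge_0 (x - 2)). assert (H2 := pow2_ge_0 (y - 1 / 2)). lra. }
  (* Since the two functions agree on this side, both are maximal at the same point. Their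
     derivatives along the inward direction (1, -1) are then at most [- eps], while three times the
     first plus the second vanishes. *)
  assert (Hdiag : forall eps t x y, 0 < eps -> 0 < y -> x = 3 * y -> x < PI ->
    (forall x' y', in_chamber x' y' ->
      heat_sum lF t x' y' - barrier eps t x' y' <= heat_sum lF t x y - barrier eps t x y /\
      heat_sum lG t x' y' - barrier eps t x' y' <= heat_sum lG t x y - barrier eps t x y) -> False).
  { intros eps t x y He Hy -> Hx Hmax.
    assert (DF := barrier_sub_derive_0 lF eps t (3 * y) y 1 (-1)).
    assert (DG := barrier_sub_derive_0 lG eps t (3 * y) y 1 (-1)).
    set (d := Rmin y (PI - 3 * y)).
    assert (Hd : 0 < d /\ d <= y /\ d <= PI - 3 * y).
    { unfold d. repeat split; [apply Rmin_case; lra | apply Rmin_l | apply Rmin_r]. }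
    apply (derive_right_max _ _ _ d) in DF; [ | tauto | ].
    2:{ intros h Hh. rewrite !Rmult_0_r, !Rplus_0_r, Rplus_0_l.
        apply Hmax. unfold in_chamber. lra. }
    apply (derive_right_max _ _ _ d) in DG; [ | tauto | ].
    2:{ intros h Hh. rewrite !Rmult_0_r, !Rplus_0_r, Rplus_0_l.
        apply Hmax. unfold in_chamber. lra. }
    specialize (HH t y). nra. }
  assert (Hmain : forall eps t1, 0 < eps -> 0 < t1 -> forall t x y, 0 <= t <= t1 -> in_chamber x y ->
    heat_sum lF t x y - barrier eps t x y <= 0 /\ heat_sum lG t x y - barrier eps t x y <= 0).
  { intros eps t1 He Ht1.
    (* The larger of the two functions minus the barrier, with time interval and triangle
       parametrized by the unit cube so that a maximum exists. *)
    set (M := fun tau xi r =>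
      (heat_sum lF (t1 * tau) (PI * xi) (PI * xi * r / 3)
       + heat_sum lG (t1 * tau) (PI * xi) (PI * xi * r / 3)
       + Rabs (heat_sum lF (t1 * tau) (PI * xi) (PI * xi * r / 3)
               - heat_sum lG (t1 * tau) (PI * xi) (PI * xi * r / 3))) / 2
      - barrier eps (t1 * tau) (PI * xi) (PI * xi * r / 3)).
    destruct (unit_cube_max M) as [tau [xi [r [Htau [Hxi [Hr Hmax]]]]]].
    { intros z.
      assert (CF := fun l => continuous_heat_sum _ l (fun z : (R * R) * R => t1 * fst (fst z))
        (fun z => PI * snd (fst z)) (fun z => PI * snd (fst z) * snd z / 3) z
        ltac:(prove_continuous) ltac:(prove_continuous) ltac:(prove_continuous)).
      assert (CF' := CF lF). assert (CG' := CF lG). unfold M, barrier. prove_continuous. }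
    set (t0 := t1 * tau). set (x0 := PI * xi). set (y0 := PI * xi * r / 3).
    assert (Ht0 : 0 <= t0 <= t1) by (unfold t0; nra).
    assert (Hch : in_chamber x0 y0).
    { unfold in_chamber, x0, y0. assert (0 <= PI * xi <= PI) by nra.
      repeat split; [ | | lra]; unfold Rdiv; nra. }
    set (m := M tau xi r).
    assert (HM : forall t x y, 0 <= t <= t1 -> in_chamber x y ->
      heat_sum lF t x y - barrier eps t x y <= m /\ heat_sum lG t x y - barrier eps t x y <= m).
    { intros t x y Ht [Hy [Hxy Hx]].
      assert (Hr' : exists r', 0 <= r' <= 1 /\ y = PI * (x / PI) * r' / 3).
      { destruct (Req_dec x 0) as [->|Hx0].
        - exists 0. split; [lra | ]. unfold Rdiv. lra.
        - exists (3 * y / x). split.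
          + split; [apply Rle_mult_inv_pos; lra | apply Rle_div_l; lra].
          + field. lra. }
      destruct Hr' as [r' [Hr' Ey]].
      assert (Hle : M (t / t1) (x / PI) r' <= m).
      { apply Hmax; [ | | exact Hr'].
        - split; [apply Rle_mult_inv_pos; lra | apply Rle_div_l; lra].
        - split; [apply Rle_mult_inv_pos; lra | apply Rle_div_l; lra]. }
      unfold M in Hle. rewrite <- Ey in Hle.
      replace (t1 * (t / t1)) with t in Hle by (field; lra).
      replace (PI * (x / PI)) with x in Hle by (field; lra).
      assert (H1 := Rle_abs (heat_sum lF t x y - heat_sum lG t x y)).
      assert (H2 := Rle_abs (- (heat_sum lF t x y - heat_sum lG t x y))).
      rewrite Rabs_Ropp in H2. lra. }
    assert (Hm : m = heat_sum lF t0 x0 y0 - barrier eps t0 x0 y0 \/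
                 m = heat_sum lG t0 x0 y0 - barrier eps t0 x0 y0).
    { unfold m, M. fold y0. fold t0 x0. unfold Rabs. destruct Rcase_abs; [right | left]; lra. }
    intros t x y Ht Hxy.
    assert (Hm0 : m <= 0); [ | destruct (HM t x y Ht Hxy); lra].
    apply Rnot_lt_le. intros Hmpos.
    assert (Hb := Hbpos eps t0 x0 y0 He (proj1 Ht0)).
    assert (Ht0' : 0 < t0).
    { destruct (Req_dec t0 0) as [E|E]; [ | lra]. exfalso.
      rewrite E in Hm, Hb. destruct (Hinit x0 y0 Hch). lra. }
    destruct Hch as [Hy0 [Hxy0 Hx0]].
    (* A positive maximum is excluded on sides where the function vanishes, by the slope of the
       barrier on sides where its normal derivative vanishes, by [Hdiag] on the third side, and by
       the heat equation inside. *)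
    destruct Hm as [Hm|Hm].
    - assert (Hx0' : x0 < PI).
      { destruct (Req_dec x0 PI) as [E|E]; [ | lra]. exfalso. rewrite E, HFpi in Hm. rewrite E in Hb. lra. }
      destruct (Req_dec y0 0) as [Ey|Ey].
      + destruct (Req_dec x0 0) as [Ex|Ex].
        * specialize (HFG t0 0). rewrite HG0, Rmult_0_r in HFG. rewrite Ex, Ey in Hm, Hb. lra.
        * assert (D := barrier_sub_derive_0 lF eps t0 x0 0 0 1). rewrite HF0 in D.
          apply (derive_right_max _ _ _ (x0 / 3)) in D; [lra | lra | ].
          intros h Hh. rewrite !Rmult_0_r, !Rplus_0_r, !Rmult_0_l, !Rplus_0_r, !Rplus_0_l, Rmult_1_l.
          rewrite Ey in Hm. rewrite <- Hm. apply HM; [lra | unfold in_chamber; lra].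
      + destruct (Req_dec x0 (3 * y0)) as [Ed|Ed].
        * apply (Hdiag eps t0 x0 y0 He); [lra | exact Ed | exact Hx0' | ].
          intros x' y' Hc'. assert (E := HFG t0 y0). rewrite <- Ed in E. rewrite <- E, <- Hm.
          now apply HM.
        * apply (barrier_no_interior_max lF eps t1 t0 x0 y0 He); [lra | lra | lra | lra | ].
          intros t' x' y' Ht' Hc'. rewrite <- Hm. now apply HM.
    - assert (Hy0' : 0 < y0).
      { destruct (Req_dec y0 0) as [E|E]; [ | lra]. exfalso. rewrite E, HG0 in Hm. rewrite E in Hb. lra. }
      destruct (Req_dec x0 (3 * y0)) as [Ed|Ed].
      + assert (E := HFG t0 y0). rewrite <- Ed in E.
        assert (Hx0' : x0 < PI).
        { destruct (Req_dec x0 PI) as [E'|E']; [ | lra]. exfalso. rewrite <- E, E', HFpi in Hm.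
          rewrite E' in Hb. lra. }
        apply (Hdiag eps t0 x0 y0 He); [lra | exact Ed | exact Hx0' | ].
        intros x' y' Hc'. rewrite E, <- Hm. now apply HM.
      + destruct (Req_dec x0 PI) as [Ex|Ex].
        * assert (D := barrier_sub_derive_0 lG eps t0 x0 y0 1 0). rewrite Ex, HGpi in D.
          apply (derive_left_max _ _ _ (PI - 3 * y0)) in D; [nra | lra | ].
          intros h Hh. rewrite !Rmult_0_r, !Rplus_0_r, !Rmult_0_l, !Rplus_0_r.
          rewrite Ex in Hm. rewrite <- Hm. apply HM; [lra | unfold in_chamber; lra].
        * apply (barrier_no_interior_max lG eps t1 t0 x0 y0 He); [lra | lra | lra | lra | ].
          intros t' x' y' Ht' Hc'. rewrite <- Hm. now apply HM. }
  intros t x y Ht Hc.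
  assert (Hlim : forall f, (forall eps, 0 < eps -> f - barrier eps t x y <= 0) -> f <= 0).
  { intros f Hf. apply Rnot_lt_le. intros Hpos.
    set (B := (x - 2) ^ 2 + 3 * (y - 1 / 2) ^ 2 + 5 * t).
    assert (HB : 0 <= B).
    { unfold B. assert (H1 := pow2_ge_0 (x - 2)). assert (H2 := pow2_ge_0 (y - 1 / 2)). lra. }
    assert (He : 0 < f / (2 * (B + 1))) by (apply Rdiv_lt_0_compat; lra).
    specialize (Hf _ He). unfold barrier in Hf. fold B in Hf.
    assert (E : f / (2 * (B + 1)) * (B + 1) = f / 2) by (field; lra). nra. }
  split; apply Hlim; intros eps He; now apply (Hmain eps (t + 1) He ltac:(lra) t x y ltac:(lra) Hc).
Qed.

(** * Monotonicity for the triangular lattice *)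

Lemma heat_sum_app l l' t x y : heat_sum (l ++ l') t x y = heat_sum l t x y + heat_sum l' t x y.
Proof.
  unfold heat_sum. induction l as [|m l IH]; simpl; [ring | ]. rewrite IH. ring.
Qed.

Definition scale_modes (k : R) (l : list mode) : list mode :=
  map (fun m : mode => let '((c, th), q) := m in ((k * c, th), q)) l.

Lemma heat_sum_scale k l t x y : heat_sum (scale_modes k l) t x y = k * heat_sum l t x y.
Proof.
  unfold heat_sum. induction l as [|[[c th] [mu nu]] l IH]; simpl; [ring | ].
  rewrite IH. ring.
Qed.

(** In the coordinates x = 2 PI (a + b / 2) and y = PI b its initial value is [wave m n 0 a b]. *)
Definition lattice_mode (m n : Z) : mode := ((1, 0), (IZR m, 2 * IZR n - IZR m)).

(** At index [(0, 0)] this is the heat flow of the j-th power of the kernel, before normalization,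
    as an explicit list to which the maximum principle applies. *)
Fixpoint modes_walk (j : nat) (m n : Z) : list mode :=
  match j with
  | O => lattice_mode m n :: nil
  | S j =>
      scale_modes (3 / 2) (modes_walk j m n) ++
      scale_modes (1 / 2) (modes_walk j (m + 1)%Z n ++ modes_walk j (m - 1)%Z n ++
        modes_walk j m (n + 1)%Z ++ modes_walk j m (n - 1)%Z ++
        modes_walk j (m + 1)%Z (n + 1)%Z ++ modes_walk j (m - 1)%Z (n - 1)%Z)
  end.

Lemma heat_sum_modes_walk j m n t x y :
  heat_sum (modes_walk j m n) t x y
  = hexagonal_walk (fun m n => heat_mode t x y (lattice_mode m n)) j m n.
Proof.
  revert m n. induction j as [|j IH]; intros m n.
  - unfold heat_sum; simpl. ring.
  - cbn [modes_walk hexagonal_walk].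
    rewrite heat_sum_app, !heat_sum_scale, !heat_sum_app, !IH. unfold hexagonal_step. ring.
Qed.

(** A change of indices that permutes the six neighbours commutes with the walk; the symmetries of
    the initial trigonometric polynomial thus pass to all [j] and all times. *)
Lemma hexagonal_walk_reindex (sm sn : Z -> Z -> Z) (f g : Z -> Z -> R) :
  (forall f : Z -> Z -> R, forall m n,
     hexagonal_step (fun m n => f (sm m n) (sn m n)) m n = hexagonal_step f (sm m n) (sn m n)) ->
  (forall m n, g m n = f (sm m n) (sn m n)) ->
  forall j m n, hexagonal_walk g j m n = hexagonal_walk f j (sm m n) (sn m n).
Proof.
  intros Hs Hg. induction j as [|j IH]; intros m n; simpl; [apply Hg | ].
  rewrite <- Hs. unfold hexagonal_step. now rewrite !IH.
Qed.

Lemma modes_walk_even_y j t x y :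
  heat_sum (modes_walk j 0 0) t x (- y) = heat_sum (modes_walk j 0 0) t x y.
Proof.
  rewrite !heat_sum_modes_walk.
  apply (hexagonal_walk_reindex (fun m n => m) (fun m n => (m - n)%Z)).
  - intros f m n. unfold hexagonal_step.
    replace (m + 1 - n)%Z with (m - n + 1)%Z by ring.
    replace (m - 1 - n)%Z with (m - n - 1)%Z by ring.
    replace (m - (n + 1))%Z with (m - n - 1)%Z by ring.
    replace (m - (n - 1))%Z with (m - n + 1)%Z by ring.
    replace (m + 1 - (n + 1))%Z with (m - n)%Z by ring.
    replace (m - 1 - (n - 1))%Z with (m - n)%Z by ring. ring.
  - intros m n. unfold heat_mode, lattice_mode. rewrite minus_IZR.
    f_equal; [f_equal; f_equal; field | f_equal; ring].
Qed.

Lemma modes_walk_even_x j t x y :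
  heat_sum (modes_walk j 0 0) t (- x) y = heat_sum (modes_walk j 0 0) t x y.
Proof.
  rewrite !heat_sum_modes_walk.
  apply (hexagonal_walk_reindex (fun m n => (- m)%Z) (fun m n => (n - m)%Z)).
  - intros f m n. unfold hexagonal_step.
    replace (- (m + 1))%Z with (- m - 1)%Z by ring.
    replace (- (m - 1))%Z with (- m + 1)%Z by ring.
    replace (n - (m + 1))%Z with (n - m - 1)%Z by ring.
    replace (n - (m - 1))%Z with (n - m + 1)%Z by ring.
    replace (n + 1 - m)%Z with (n - m + 1)%Z by ring.
    replace (n - 1 - m)%Z with (n - m - 1)%Z by ring.
    replace (n + 1 - (m + 1))%Z with (n - m)%Z by ring.
    replace (n - 1 - (m - 1))%Z with (n - m)%Z by ring. ring.
  - intros m n. unfold heat_mode, lattice_mode. rewrite minus_IZR, opp_IZR.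
    f_equal; [f_equal; f_equal; field | f_equal; ring].
Qed.

Lemma modes_walk_reflection_x j t x y :
  heat_sum (modes_walk j 0 0) t (2 * PI - x) y = heat_sum (modes_walk j 0 0) t x y.
Proof.
  rewrite <- modes_walk_even_x, !heat_sum_modes_walk.
  apply (hexagonal_walk_reindex (fun m n => m) (fun m n => n)); [reflexivity | ].
  intros m n. unfold heat_mode, lattice_mode. f_equal.
  rewrite <- (cos_period_Z _ m). f_equal. ring.
Qed.

Lemma modes_walk_reflection_diagonal j t x y :
  heat_sum (modes_walk j 0 0) t (x / 2 + 3 * y / 2) (x / 2 - y / 2)
  = heat_sum (modes_walk j 0 0) t x y.
Proof.
  rewrite !heat_sum_modes_walk.
  apply (hexagonal_walk_reindex (fun m n => n) (fun m n => m)).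
  - intros f m n. unfold hexagonal_step. ring.
  - intros m n. unfold heat_mode, lattice_mode.
    f_equal; [f_equal; f_equal; field | f_equal; field].
Qed.

Lemma hexagonal_walk_wave a b j m n :
  hexagonal_walk (fun m n => wave m n 0 a b) j m n = kap a b ^ j * wave m n 0 a b.
Proof.
  revert m n. induction j as [|j IH]; intros m n; simpl; [ring | ].
  transitivity (kap a b ^ j * hexagonal_step (fun m n => wave m n 0 a b) m n).
  - unfold hexagonal_step. rewrite !IH. ring.
  - rewrite <- kernel_times_wave. ring.
Qed.

Lemma heat_mode_wave t a b m n :
  heat_mode t (2 * PI * (a + b / 2)) (PI * b) (lattice_mode m n)
  = exp (- (4 / 3 * (IZR m ^ 2 - IZR m * IZR n + IZR n ^ 2)) * t) * wave m n 0 a b.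
Proof.
  unfold heat_mode, lattice_mode, wave. rewrite Rmult_1_l. f_equal; f_equal; field.
Qed.

Lemma modes_walk_initial j x y :
  heat_sum (modes_walk j 0 0) 0 x y = (2 * cos x * cos y + cos (2 * y) + 3 / 2) ^ j /\
  0 <= 2 * cos x * cos y + cos (2 * y) + 3 / 2.
Proof.
  assert (Hpi := PI_RGT_0).
  set (a := (x - y) / (2 * PI)). set (b := y / PI).
  assert (Hk : kap a b = 2 * cos x * cos y + cos (2 * y) + 3 / 2).
  { unfold kap, wave.
    replace (2 * PI * (1 * a + 0 * b) + 0) with (x - y) by (unfold a, b; field; lra).
    replace (2 * PI * (0 * a + 1 * b) + 0) with (2 * y) by (unfold a, b; field; lra).
    replace (2 * PI * (1 * a + 1 * b) + 0) with (x + y) by (unfold a, b; field; lra).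
    rewrite cos_minus, cos_plus. ring. }
  rewrite <- Hk. split; [ | apply kernel_nonneg].
  rewrite heat_sum_modes_walk.
  rewrite (hexagonal_walk_ext _ (fun m n => wave m n 0 a b)).
  - rewrite hexagonal_walk_wave. unfold wave.
    replace (2 * PI * (0 * a + 0 * b) + 0) with 0 by ring. rewrite cos_0. ring.
  - intros m n.
    replace x with (2 * PI * (a + b / 2)) by (unfold a, b; field; lra).
    replace y with (PI * b) at 1 by (unfold b; field; lra).
    rewrite heat_mode_wave. rewrite Rmult_0_r, exp_0. ring.
Qed.

(** The chain rule leaves a nonnegative power times the derivative of the kernel. The only delicate
    sign is that of [cos x + 2 * cos y], which is nonnegative because [y <= PI / 3] in the
    chamber. *)
Lemma modes_walk_initial_decreasing j x y : in_chamber x y ->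
  heat_sum (derive_modes 1 0 (modes_walk j 0 0)) 0 x y <= 0 /\
  heat_sum (derive_modes 0 1 (modes_walk j 0 0)) 0 x y <= 0.
Proof.
  intros [Hy [Hxy Hx]]. assert (Hpi := PI_RGT_0).
  assert (Hder : forall p q, heat_sum (derive_modes p q (modes_walk j 0 0)) 0 x y
    = INR j * (2 * cos x * cos y + cos (2 * y) + 3 / 2) ^ pred j *
      - 2 * (p * (sin x * cos y) + q * (sin y * (cos x + 2 * cos y)))).
  { intros p q.
    assert (H := heat_sum_derive (modes_walk j 0 0) p q 0 x y 0).
    rewrite !Rmult_0_r, !Rplus_0_r in H. rewrite <- (is_derive_unique _ _ _ H).
    apply is_derive_unique.
    apply (is_derive_ext (fun s => (2 * cos (x + p * s) * cos (y + q * s)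
      + cos (2 * (y + q * s)) + 3 / 2) ^ j)).
    { intros s. symmetry. apply modes_walk_initial. }
    auto_derive; trivial. rewrite !Rmult_0_r, !Rplus_0_r, sin_2a.
    set (B := (2 * cos x * cos y + cos (2 * y) + 3 / 2) ^ pred j).
    ring_simplify. ring. }
  rewrite !Hder.
  assert (HB : 0 <= (2 * cos x * cos y + cos (2 * y) + 3 / 2) ^ pred j)
    by apply pow_le, (modes_walk_initial j x y).
  assert (HBj : 0 <= INR j * (2 * cos x * cos y + cos (2 * y) + 3 / 2) ^ pred j)
    by (apply Rmult_le_pos; [apply pos_INR | exact HB]).
  assert (H1 : 0 <= sin x) by (apply sin_ge_0; lra).
  assert (H2 : 0 <= sin y) by (apply sin_ge_0; lra).
  assert (H3 : 1 / 2 <= cos y).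
  { rewrite <- cos_PI3. apply cos_decr_1; lra. }
  assert (H4 := COS_bound x).
  assert (0 <= sin x * cos y) by (apply Rmult_le_pos; lra).
  assert (0 <= sin y * (cos x + 2 * cos y)) by (apply Rmult_le_pos; lra).
  split; nra.
Qed.

Definition radially_decreasing (f : R -> R -> R) (x y : R) : Prop :=
  forall s s', 0 <= s -> s <= s' -> s' <= 1 -> f (s' * x) (s' * y) <= f (s * x) (s * y).

Lemma decreasing_of_derive (f f' : R -> R) (a b : R) : a <= b ->
  (forall s, a <= s <= b -> is_derive f s (f' s)) ->
  (forall s, a <= s <= b -> f' s <= 0) -> f b <= f a.
Proof.
  intros Hab Hf Hf'. destruct (Req_dec a b) as [->|Hne]; [lra | ].
  destruct (MVT_cor2 f f' a b) as [c [Hc1 Hc2]]; [lra | | ].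
  { intros c Hc. now apply is_derive_Reals, Hf. }
  assert (f' c <= 0) by (apply Hf'; lra). nra.
Qed.

(** The derivative along the ray is a combination of the two partial derivatives with the
    nonnegative weights [x] and [y], and the chamber is star-shaped about the origin. *)
Lemma radially_decreasing_chamber j t x y : 0 <= t -> in_chamber x y ->
  radially_decreasing (heat_sum (modes_walk j 0 0) t) x y.
Proof.
  intros Ht Hc s s' Hs Hss Hs'. destruct Hc as [Hy [Hxy Hx]].
  apply (decreasing_of_derive (fun s => heat_sum (modes_walk j 0 0) t (s * x) (s * y))
    (fun s => heat_sum (derive_modes x y (modes_walk j 0 0)) t (s * x) (s * y)) s s' Hss).
  - intros r _. assert (H := heat_sum_derive (modes_walk j 0 0) x y t 0 0 r).
    apply (is_derive_value _ _ (heat_sum (derive_modes x y (modes_walk j 0 0)) t (0 + x * r) (0 + y * r))).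
    { now rewrite !Rplus_0_l, (Rmult_comm x), (Rmult_comm y). }
    apply (is_derive_ext (fun s => heat_sum (modes_walk j 0 0) t (0 + x * s) (0 + y * s)));
      [ | exact H].
    intros z. now rewrite !Rplus_0_l, (Rmult_comm x), (Rmult_comm y).
  - intros r Hr. rewrite heat_sum_derive_linear.
    destruct (chamber_maximum_principle (modes_walk j 0 0)
      (modes_walk_even_y j) (modes_walk_reflection_x j) (modes_walk_reflection_diagonal j)
      (modes_walk_initial_decreasing j) t (r * x) (r * y) Ht) as [H1 H2].
    { unfold in_chamber. repeat split; nra. }
    nra.
Qed.

(* The Voronoi cell of the origin, in the coordinates [x = 2 PI (a + b / 2)] and [y = PI b] of the point
   with lattice coordinates [a] and [b]. *)
Definition in_hexagon (x y : R) : Prop :=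
  - PI <= x <= PI /\ - PI <= x / 2 + 3 * y / 2 <= PI /\ - PI <= x / 2 - 3 * y / 2 <= PI.

(** Reflections fixing the origin fold the hexagon onto the chamber and carry rays to rays: absolute
    values reduce to a quadrant, then the diagonal reflection, again with an absolute value, reduces
    to the chamber. *)
Lemma radially_decreasing_hexagon j t x y : 0 <= t -> in_hexagon x y ->
  radially_decreasing (heat_sum (modes_walk j 0 0) t) x y.
Proof.
  intros Ht.
  assert (Hquad : forall x y, 0 <= x -> 0 <= y -> in_hexagon x y ->
    radially_decreasing (heat_sum (modes_walk j 0 0) t) x y).
  { intros a b Ha Hb [H1 [H2 H3]].
    destruct (Rle_dec (3 * b) a) as [H|H].
    - apply radially_decreasing_chamber; [exact Ht | unfold in_chamber; lra].
    - assert (Hr : radially_decreasing (heat_sum (modes_walk j 0 0) t)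
        (a / 2 + 3 * b / 2) (Rabs (a / 2 - b / 2))).
      { apply radially_decreasing_chamber; [exact Ht | ]. unfold in_chamber, Rabs.
        destruct Rcase_abs; lra. }
      intros s s' Hs Hss Hs'. specialize (Hr s s' Hs Hss Hs').
      assert (E : forall s, 0 <= s ->
        heat_sum (modes_walk j 0 0) t (s * (a / 2 + 3 * b / 2)) (s * Rabs (a / 2 - b / 2))
        = heat_sum (modes_walk j 0 0) t (s * a) (s * b)).
      { intros r Hr'. rewrite <- (modes_walk_reflection_diagonal j t (r * a) (r * b)).
        replace (r * a / 2 + 3 * (r * b) / 2) with (r * (a / 2 + 3 * b / 2)) by field.
        unfold Rabs. destruct Rcase_abs.
        - rewrite <- modes_walk_even_y. f_equal. field.
        - f_equal. field. }
      rewrite !E in Hr by lra. exact Hr. }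
  intros [H1 [H2 H3]].
  assert (Hr : radially_decreasing (heat_sum (modes_walk j 0 0) t) (Rabs x) (Rabs y)).
  { apply Hquad; [apply Rabs_pos | apply Rabs_pos | ]. unfold in_hexagon, Rabs.
    destruct (Rcase_abs x); destruct (Rcase_abs y); lra. }
  intros s s' Hs Hss Hs'. specialize (Hr s s' Hs Hss Hs').
  assert (E : forall s, heat_sum (modes_walk j 0 0) t (s * Rabs x) (s * Rabs y)
    = heat_sum (modes_walk j 0 0) t (s * x) (s * y)).
  { intros r. transitivity (heat_sum (modes_walk j 0 0) t (r * x) (r * Rabs y)).
    - unfold Rabs at 1. destruct (Rcase_abs x); [ | reflexivity].
      rewrite <- modes_walk_even_x. f_equal. ring.
    - unfold Rabs. destruct (Rcase_abs y); [ | reflexivity].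
      rewrite <- modes_walk_even_y. f_equal. ring. }
  rewrite !E in Hr. exact Hr.
Qed.

(** * Strict monotonicity along lines *)

(** The i-th derivative of the cosine is written as a shift by [INR i * (PI / 2)], which gives one
    formula for all orders. *)
Definition cos_taylor (X y : R) (J : nat) : R :=
  sum_f_R0 (fun i => y ^ i * cos (X + INR i * (PI / 2)) / INR (fact i)) J.

Lemma bounded_by_derivative (f f' g g' : R -> R) (y : R) : 0 <= y ->
  (forall z, is_derive f z (f' z)) -> (forall z, is_derive g z (g' z)) ->
  (forall z, 0 <= z -> Rabs (f' z) <= g' z) -> f 0 = 0 -> g 0 = 0 -> Rabs (f y) <= g y.
Proof.
  intros Hy Hf Hg Hle Hf0 Hg0.
  assert (H1 : f y - g y <= f 0 - g 0).
  { apply (decreasing_of_derive (fun z => f z - g z) (fun z => f' z - g' z) 0 y Hy).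
    - intros z _. apply is_derive_sub; auto.
    - intros z Hz. specialize (Hle z (proj1 Hz)). apply Rabs_le_between in Hle. lra. }
  assert (H2 : - f y - g y <= - f 0 - g 0).
  { apply (decreasing_of_derive (fun z => - f z - g z) (fun z => - f' z - g' z) 0 y Hy).
    - intros z _. apply is_derive_sub; auto.
      now apply (is_derive_opp (K := R_AbsRing) (V := R_NormedModule)).
    - intros z Hz. specialize (Hle z (proj1 Hz)). apply Rabs_le_between in Hle. lra. }
  apply Rabs_le. lra.
Qed.

Lemma is_derive_pow_div_fact z J :
  is_derive (fun y => y ^ S J / INR (fact (S J))) z (z ^ J / INR (fact J)).
Proof.
  apply (is_derive_value _ _ (/ INR (fact (S J)) * (INR (S J) * 1 * z ^ pred (S J)))).
  { rewrite fact_simpl, mult_INR. change (pred (S J)) with J.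
    set (k := INR (S J)). assert (Hk : k <> 0) by now apply not_0_INR.
    set (F := INR (fact J)). assert (HF : F <> 0) by apply INR_fact_neq_0.
    field. now split. }
  apply (is_derive_ext (fun y => / INR (fact (S J)) * y ^ S J)); [intros y; apply Rmult_comm | ].
  apply (is_derive_scal (fun y => y ^ S J)).
  apply (is_derive_pow (fun y => y) (S J) z 1). apply (is_derive_id (K := R_AbsRing)).
Qed.

Lemma cos_taylor_derive X J z :
  is_derive (fun y => cos_taylor X y (S J)) z (cos_taylor (X + PI / 2) z J).
Proof.
  induction J as [|J IH].
  - unfold cos_taylor; simpl. auto_derive; trivial.
    replace (X + PI / 2 + 0 * (PI / 2)) with (X + 1 * (PI / 2)) by ring. field.
  - change (is_derive (fun y => cos_taylor X y (S J) +
      y ^ S (S J) * cos (X + INR (S (S J)) * (PI / 2)) / INR (fact (S (S J)))) z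
      (cos_taylor (X + PI / 2) z J +
       z ^ S J * cos (X + PI / 2 + INR (S J) * (PI / 2)) / INR (fact (S J)))).
    apply (is_derive_plus (K := R_AbsRing) (V := R_NormedModule)); [exact IH | ].
    replace (X + PI / 2 + INR (S J) * (PI / 2)) with (X + INR (S (S J)) * (PI / 2))
      by (rewrite (S_INR (S J)); ring).
    set (c := cos (X + INR (S (S J)) * (PI / 2))).
    apply (is_derive_value _ _ (c * (z ^ S J / INR (fact (S J))))); [unfold Rdiv; ring | ].
    apply (is_derive_ext (fun y => c * (y ^ S (S J) / INR (fact (S (S J)))))).
    { intros y. unfold Rdiv. rewrite (Rmult_comm (y ^ _) c). symmetry. apply Rmult_assoc. }
    apply (is_derive_scal (fun y => y ^ S (S J) / INR (fact (S (S J))))).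
    apply is_derive_pow_div_fact.
Qed.

Lemma cos_taylor_at_0 X J : cos_taylor X 0 J = cos X.
Proof.
  unfold cos_taylor. induction J as [|J IH].
  - simpl. rewrite Rmult_0_l, Rplus_0_r. field.
  - rewrite tech5, IH. rewrite pow_i by lia. unfold Rdiv. ring.
Qed.

Lemma cos_half_turns X i :
  cos (- X + INR i * (PI / 2)) = (-1) ^ i * cos (X + INR i * (PI / 2)).
Proof.
  revert X. induction i as [|i IH]; intros X.
  - simpl. rewrite Rmult_0_l, !Rplus_0_r, cos_neg. ring.
  - rewrite S_INR.
    replace (- X + (INR i + 1) * (PI / 2)) with (- (X - PI / 2) + INR i * (PI / 2)) by ring.
    rewrite IH.
    replace (X + (INR i + 1) * (PI / 2)) with (X - PI / 2 + INR i * (PI / 2) + PI) by field.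
    rewrite neg_cos. simpl. ring.
Qed.

(** For [y >= 0] by induction, since the derivative of a remainder is the previous remainder at
    [X + PI / 2]; negative [y] reduces to this by evenness, changing the signs of both [X] and
    [y]. *)
Lemma cos_taylor_bound X y J :
  Rabs (cos (X + y) - cos_taylor X y J) <= Rabs y ^ S J / INR (fact (S J)).
Proof.
  assert (Hpos : forall X y, 0 <= y ->
    Rabs (cos (X + y) - cos_taylor X y J) <= y ^ S J / INR (fact (S J))).
  { clear X y. induction J as [|J IH]; intros X y Hy.
    - apply (bounded_by_derivative (fun y => cos (X + y) - cos_taylor X y 0) (fun y => - sin (X + y))
        (fun y => y ^ 1 / INR (fact 1)) (fun _ => 1) y Hy).
      + intros z. unfold cos_taylor; simpl. auto_derive; trivial. ring.
      + intros z. simpl. auto_derive; trivial. field.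
      + intros z _. rewrite Rabs_Ropp. apply Rabs_le, SIN_bound.
      + rewrite cos_taylor_at_0, Rplus_0_r. ring.
      + simpl. field.
    - apply (bounded_by_derivative (fun y => cos (X + y) - cos_taylor X y (S J))
        (fun y => cos (X + PI / 2 + y) - cos_taylor (X + PI / 2) y J)
        (fun y => y ^ S (S J) / INR (fact (S (S J)))) (fun y => y ^ S J / INR (fact (S J))) y Hy).
      + intros z. apply is_derive_sub;
          [ | apply cos_taylor_derive].
        auto_derive; trivial.
        replace (X + PI / 2 + z) with (X + z + PI / 2) by ring.
        rewrite cos_plus, cos_PI2, sin_PI2. ring.
      + intros z. apply is_derive_pow_div_fact.
      + intros z Hz. now apply IH.
      + rewrite cos_taylor_at_0, Rplus_0_r. ring.
      + rewrite pow_i by lia. unfold Rdiv. ring. }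
  destruct (Rle_dec 0 y) as [Hy|Hy].
  - rewrite (Rabs_pos_eq y Hy). now apply Hpos.
  - rewrite (Rabs_left y) by lra.
    assert (H := Hpos (- X) (- y) ltac:(lra)).
    replace (cos (- X + - y)) with (cos (X + y)) in H
      by (rewrite <- cos_neg; f_equal; ring).
    replace (cos_taylor (- X) (- y) J) with (cos_taylor X y J) in H; [exact H | ].
    unfold cos_taylor. apply sum_eq. intros i _. rewrite cos_half_turns.
    replace (- y) with (-1 * y) by ring. rewrite Rpow_mult_distr.
    transitivity ((-1) ^ i * (-1) ^ i * (y ^ i * cos (X + INR i * (PI / 2)) / INR (fact i)));
      [ | unfold Rdiv; ring].
    rewrite <- Rpow_mult_distr. replace (-1 * -1) with 1 by ring. rewrite pow1. ring.
Qed.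

Lemma pow_div_fact_le_exp (x : R) (i : nat) : 0 <= x -> x ^ i / INR (fact i) <= exp x.
Proof.
  intros Hx.
  assert (H : is_lim_seq (sum_n (fun k => x ^ k / INR (fact k))) (exp x)).
  { apply (is_lim_seq_ext (sum_n (fun k => scal (pow_n x k) (/ INR (fact k))))).
    - intros n. apply sum_n_ext. intros k. rewrite pow_n_pow. reflexivity.
    - exact (is_exp_Reals x). }
  assert (Hterm : forall k, 0 <= x ^ k / INR (fact k)).
  { intros k. apply Rle_mult_inv_pos; [now apply pow_le | apply INR_fact_lt_0]. }
  assert (Hincr : forall n, sum_n (fun k => x ^ k / INR (fact k)) n
    <= sum_n (fun k => x ^ k / INR (fact k)) (S n)).
  { intros n. rewrite sum_Sn. specialize (Hterm (S n)). unfold plus; simpl in *. lra. }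
  apply Rle_trans with (sum_n (fun k => x ^ k / INR (fact k)) i).
  - destruct i as [|i]; [rewrite sum_O; lra | ]. rewrite sum_Sn.
    assert (0 <= sum_n (fun k => x ^ k / INR (fact k)) i).
    { clear H Hincr. induction i as [|i IH]; [rewrite sum_O; apply Hterm | ].
      rewrite sum_Sn. specialize (Hterm (S i)). unfold plus; simpl in *. lra. }
    unfold plus; simpl in *. lra.
  - exact (is_lim_seq_incr_compare _ _ H Hincr i).
Qed.

(** Doubling the argument splits the error into a geometric factor in [J] and an exponential in the
    frequency, which rapid summability absorbs. *)
Lemma cos_taylor_geometric_bound X y J :
  Rabs (cos (X + y) - cos_taylor X y J) <= (1 / 2) ^ S J * exp (2 * Rabs y).
Proof.
  apply Rle_trans with (1 := cos_taylor_bound X y J).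
  assert (H := pow_div_fact_le_exp (2 * Rabs y) (S J)).
  assert (Hy := Rabs_pos y).
  replace (Rabs y ^ S J / INR (fact (S J)))
    with ((1 / 2) ^ S J * ((2 * Rabs y) ^ S J / INR (fact (S J)))).
  - apply Rmult_le_compat_l; [apply pow_le; lra | apply H; lra].
  - unfold Rdiv. rewrite <- Rmult_assoc, <- Rpow_mult_distr. f_equal. f_equal. field.
Qed.

Lemma cv_radius_pos (a : nat -> R) : (forall x, ex_pseries a x) -> Rbar_lt 0 (CV_radius a).
Proof.
  intros H. apply Rbar_not_le_lt. intros Hle.
  apply (CV_disk_outside a 1).
  - apply Rbar_le_lt_trans with (1 := Hle). simpl. rewrite Rabs_R1. lra.
  - apply ex_series_lim_0. destruct (H 1) as [l Hl]. exists l. now apply is_pseries_R in Hl.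
Qed.

(** The values near 0 determine the coefficients, hence all but the constant one vanish. *)
Lemma entire_locally_constant (a : nat -> R) (f : R -> R) (d : R) :
  0 < d -> (forall h, is_pseries a h (f h)) -> (forall h, Rabs h < d -> f h = f 0) ->
  forall h, f h = f 0.
Proof.
  intros Hd Ha Hconst.
  set (c := fun n : nat => match n with O => f 0 | S _ => 0 end).
  assert (Hc : forall x, is_pseries c x (f 0)).
  { intros x. apply is_pseries_R.
    apply (filterlim_ext (fun _ => f 0)); [ | apply filterlim_const].
    intros n. induction n as [|n IH]; [rewrite sum_O; simpl; ring | ].
    rewrite sum_Sn, <- IH. unfold plus; simpl. ring. }
  assert (E : forall n, a n = c n).
  { intros n. apply PSeries_ext_recip.
    - apply cv_radius_pos. intros x. eexists. apply Ha.
    - apply cv_radius_pos. intros x. eexists. apply Hc.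
    - exists (mkposreal d Hd). intros x Hx.
      rewrite (is_pseries_unique _ _ _ (Ha x)), (is_pseries_unique _ _ _ (Hc x)).
      apply Hconst. change (Rabs (x - 0) < d) in Hx. now rewrite Rminus_0_r in Hx. }
  intros h.
  rewrite <- (is_pseries_unique _ _ _ (Ha h)), <- (is_pseries_unique _ _ _ (Hc h)).
  now apply PSeries_ext.
Qed.

(** Exchange of two summations: the error at order [J] is summable in [N] and carries a uniform
    factor (1/2)^(J+1), so it tends to 0 after summation. *)
Lemma pseries_of_series (T : nat -> R -> R) (g : nat -> nat -> R) (B : R -> nat -> R) (B' : nat -> R) :
  (forall h N J, Rabs (T N h - sum_f_R0 (fun i => g i N * h ^ i) J) <= (1 / 2) ^ S J * B h N) ->
  (forall h, ex_series (B h)) -> (forall i N, Rabs (g i N) <= B' N) -> ex_series B' ->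
  (forall h, ex_series (fun N => T N h)) ->
  forall h, is_pseries (fun i => Series (g i)) h (Series (fun N => T N h)).
Proof.
  intros HT HB Hg HB' HTs h.
  assert (Hgs : forall i, ex_series (g i)).
  { intros i. apply (ex_series_dominated _ B');
      [apply Hg | exact HB']. }
  assert (Hsum : forall J, ex_series (fun N => sum_f_R0 (fun i => g i N * h ^ i) J) /\
    Series (fun N => sum_f_R0 (fun i => g i N * h ^ i) J)
    = sum_f_R0 (fun i => Series (g i) * h ^ i) J).
  { induction J as [|J [IH1 IH2]]; simpl sum_f_R0.
    - split; [now apply ex_series_scal_r | apply Series_scal_r].
    - assert (H : ex_series (fun N => g (S J) N * h ^ S J)) by now apply ex_series_scal_r.
      split.
      + exact (ex_series_plus (K := R_AbsRing) (V := R_NormedModule) _ _ IH1 H).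
      + rewrite Series_plus by assumption. rewrite IH2, Series_scal_r. reflexivity. }
  apply is_pseries_R.
  change (is_lim_seq (sum_n (fun n => Series (g n) * h ^ n)) (Series (fun N => T N h))).
  apply (is_lim_seq_ext (fun J => sum_f_R0 (fun i => Series (g i) * h ^ i) J)).
  { intros J. now rewrite sum_n_Reals. }
  assert (Hgeom : is_lim_seq (fun J => Series (B h) * (1 / 2 * (1 / 2) ^ J)) 0).
  { replace 0 with (Series (B h) * (1 / 2 * 0)) by ring.
    apply (is_lim_seq_scal_l _ (Series (B h)) (1 / 2 * 0)).
    apply (is_lim_seq_scal_l _ (1 / 2) 0). apply is_lim_seq_geom. rewrite Rabs_pos_eq; lra. }
  apply (is_lim_seq_le_le (fun J => Series (fun N => T N h) - Series (B h) * (1 / 2 * (1 / 2) ^ J)) _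
    (fun J => Series (fun N => T N h) + Series (B h) * (1 / 2 * (1 / 2) ^ J))).
  - intros J. destruct (Hsum J) as [H1 H2]. rewrite <- H2.
    assert (Hle : Rabs (Series (fun N => T N h) - Series (fun N => sum_f_R0 (fun i => g i N * h ^ i) J))
      <= Series (B h) * (1 / 2 * (1 / 2) ^ J)).
    { rewrite <- Series_minus by auto. rewrite Rmult_comm, <- Series_scal_l.
      assert (Hex : ex_series (fun N => 1 / 2 * (1 / 2) ^ J * B h N))
        by now apply ex_series_const_mul.
      apply Rle_trans with (Series (fun N => Rabs (T N h - sum_f_R0 (fun i => g i N * h ^ i) J))).
      - apply Series_Rabs.
        apply (ex_series_dominated _ _) with (2 := Hex).
        intros N. change (Rabs (Rabs (T N h - sum_f_R0 (fun i => g i N * h ^ i) J))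
          <= 1 / 2 * (1 / 2) ^ J * B h N). rewrite Rabs_Rabsolu. apply HT.
      - apply Series_le; [ | exact Hex]. intros N. split; [apply Rabs_pos | apply HT]. }
    apply Rabs_le_between in Hle. lra.
  - replace (Finite (Series (fun N => T N h))) with (Finite (Series (fun N => T N h) - 0))
      by (f_equal; ring).
    apply is_lim_seq_minus'; [apply is_lim_seq_const | exact Hgeom].
  - replace (Finite (Series (fun N => T N h))) with (Finite (Series (fun N => T N h) + 0))
      by (f_equal; ring).
    apply is_lim_seq_plus'; [apply is_lim_seq_const | exact Hgeom].
Qed.

Lemma rsum_sum_f_R0 {A : Type} (l : list A) (f : A -> nat -> R) J :
  rsum l (fun p => sum_f_R0 (f p) J) = sum_f_R0 (fun i => rsum l (fun p => f p i)) J.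
Proof.
  induction J as [|J IH]; simpl; [reflexivity | ]. now rewrite rsum_plus, IH.
Qed.

Lemma rsum_scal_r {A : Type} (l : list A) (c : R) (f : A -> R) :
  rsum l (fun p => f p * c) = rsum l f * c.
Proof. rewrite Rmult_comm, <- rsum_scal. apply rsum_ext. intros. ring. Qed.

Lemma fourier_series_line_pseries (e : Z -> Z -> R) (al be s0 : R) :
  (forall m n, 0 <= e m n) ->
  rapidly_summable e ->
  exists a, forall h, is_pseries a h (fourier_series e ((s0 + h) * al) ((s0 + h) * be)).
Proof.
  intros Hpos Hsum.
  set (om := fun p : Z * Z => 2 * PI * (IZR (fst p) * al + IZR (snd p) * be)).
  set (rho := 2 * PI * (Rabs al + Rabs be)).
  assert (Hpi := PI_RGT_0).
  assert (Hrho : forall p, Rabs (om p) <= rho * max_norm p).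
  { intros [m n]. unfold om, rho, max_norm. cbn [fst snd].
    rewrite Rabs_mult, (Rabs_pos_eq (2 * PI)), (Rmult_assoc (2 * PI) (_ + _)) by lra.
    apply Rmult_le_compat_l; [lra | ].
    apply Rle_trans with (1 := Rabs_triang _ _). rewrite !Rabs_mult, <- !abs_IZR.
    assert (H1 : IZR (Z.abs m) <= IZR (Z.max (Z.abs m) (Z.abs n))) by (apply IZR_le; lia).
    assert (H2 : IZR (Z.abs n) <= IZR (Z.max (Z.abs m) (Z.abs n))) by (apply IZR_le; lia).
    assert (H3 := Rabs_pos al). assert (H4 := Rabs_pos be). nra. }
  set (g := fun (i N : nat) => rsum (shell N) (fun p =>
    e (fst p) (snd p) * (om p ^ i * cos (om p * s0 + INR i * (PI / 2)) / INR (fact i)))).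
  exists (fun i => Series (g i)).
  apply (pseries_of_series (fun N h => shell_term e N ((s0 + h) * al) ((s0 + h) * be)) g
    (fun h N => rsum (shell N) (fun p => e (fst p) (snd p) * exp (2 * rho * Rabs h * max_norm p)))
    (fun N => rsum (shell N) (fun p => e (fst p) (snd p) * exp (rho * max_norm p)))).
  - intros h N J.
    assert (E : shell_term e N ((s0 + h) * al) ((s0 + h) * be) - sum_f_R0 (fun i => g i N * h ^ i) J
      = rsum (shell N) (fun p => e (fst p) (snd p) *
          (cos (om p * s0 + om p * h) - cos_taylor (om p * s0) (om p * h) J))).
    { transitivity (shell_term e N ((s0 + h) * al) ((s0 + h) * be) - rsum (shell N) (fun p =>
        e (fst p) (snd p) * cos_taylor (om p * s0) (om p * h) J)).
      - f_equal.
        transitivity (rsum (shell N) (fun p => sum_f_R0 (fun i => e (fst p) (snd p) *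
          (om p ^ i * cos (om p * s0 + INR i * (PI / 2)) / INR (fact i)) * h ^ i) J)).
        + rewrite rsum_sum_f_R0. apply sum_eq. intros i _. unfold g. now rewrite <- rsum_scal_r.
        + apply rsum_ext. intros p _. unfold cos_taylor. rewrite scal_sum.
          apply sum_eq. intros i _. rewrite Rpow_mult_distr. unfold Rdiv. ring.
      - unfold shell_term. unfold Rminus at 1. rewrite <- (Rmult_1_l (rsum _ (fun p => _ * cos_taylor _ _ _))).
        rewrite Ropp_mult_distr_l, <- rsum_scal, <- rsum_plus. apply rsum_ext. intros p _.
        unfold wave.
        replace (2 * PI * (IZR (fst p) * ((s0 + h) * al) + IZR (snd p) * ((s0 + h) * be)) + 0)
          with (om p * s0 + om p * h) by (unfold om; ring). ring. }
    rewrite E. apply Rle_trans with (1 := rsum_Rabs _ _). rewrite <- rsum_scal.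
    apply rsum_le. intros p _. rewrite Rabs_mult, (Rabs_pos_eq (e _ _)) by apply Hpos.
    rewrite <- Rmult_assoc, (Rmult_comm _ (e _ _)), Rmult_assoc.
    apply Rmult_le_compat_l; [apply Hpos | ].
    apply Rle_trans with (1 := cos_taylor_geometric_bound _ _ _).
    apply Rmult_le_compat_l; [apply pow_le; lra | ]. apply exp_le.
    rewrite Rabs_mult. specialize (Hrho p). assert (H := Rabs_pos h). nra.
  - intros h. apply Hsum.
  - intros i N. unfold g. apply Rle_trans with (1 := rsum_Rabs _ _). apply rsum_le.
    intros p _. rewrite Rabs_mult, (Rabs_pos_eq (e _ _)) by apply Hpos.
    apply Rmult_le_compat_l; [apply Hpos | ].
    apply Rle_trans with (Rabs (om p) ^ i / INR (fact i)).
    + unfold Rdiv. rewrite !Rabs_mult, RPow_abs, (Rabs_pos_eq (/ _))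
        by (left; apply Rinv_0_lt_compat, INR_fact_lt_0).
      apply Rmult_le_compat_r; [left; apply Rinv_0_lt_compat, INR_fact_lt_0 | ].
      assert (Hc : Rabs (cos (om p * s0 + INR i * (PI / 2))) <= 1) by apply Rabs_le, COS_bound.
      assert (H := Rabs_pos (om p ^ i)). nra.
    + apply Rle_trans with (1 := pow_div_fact_le_exp _ i (Rabs_pos _)). apply exp_le, Hrho.
  - apply Hsum.
  - intros h. apply (ex_series_dominated _ _)
      with (2 := Hsum 0).
    intros N. apply Rle_trans with (1 := shell_term_bound e Hpos N _ _). apply rsum_le.
    intros p _. rewrite Rmult_0_l, exp_0. lra.
Qed.

Lemma fourier_series_line_constant (e : Z -> Z -> R) (al be s1 s2 : R) :
  (forall m n, 0 <= e m n) ->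
  rapidly_summable e ->
  s1 < s2 ->
  (forall s, s1 <= s <= s2 -> fourier_series e (s * al) (s * be) = fourier_series e (s1 * al) (s1 * be)) ->
  forall s s', fourier_series e (s * al) (s * be) = fourier_series e (s' * al) (s' * be).
Proof.
  intros Hpos Hsum Hs Hconst. set (s0 := (s1 + s2) / 2).
  destruct (fourier_series_line_pseries e al be s0 Hpos Hsum) as [a Ha].
  assert (H : forall h, fourier_series e ((s0 + h) * al) ((s0 + h) * be)
    = fourier_series e ((s0 + 0) * al) ((s0 + 0) * be)).
  { apply (entire_locally_constant a (fun h => fourier_series e ((s0 + h) * al) ((s0 + h) * be))
      ((s2 - s1) / 2)); [lra | exact Ha | ].
    intros h Hh. apply Rabs_def2 in Hh. rewrite (Hconst (s0 + h)), (Hconst (s0 + 0)) by (unfold s0; lra). reflexivity. }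
  intros s s'. assert (H1 := H (s - s0)). assert (H2 := H (s' - s0)).
  replace (s0 + (s - s0)) with s in H1 by ring. replace (s0 + (s' - s0)) with s' in H2 by ring.
  congruence.
Qed.

(** The line meets a point where one of the first two waves equals -1. All coefficients are positive
    and every wave is 1 at the origin, so this one loss is not compensated. *)
Lemma fourier_series_not_constant (e : Z -> Z -> R) (al be : R) :
  (forall m n, 0 < e m n) -> (forall m n, e (- m)%Z (- n)%Z = e m n) ->
  ex_series (shell_sum e) ->
  al <> 0 \/ be <> 0 ->
  exists s, fourier_series e (s * al) (s * be) < fourier_series e 0 0.
Proof.
  intros Hpos Hsym Hsum Hne.
  assert (Hpos' : forall m n, 0 <= e m n) by (intros; now left).
  assert (Hlt : forall a b, wave 1 0 0 a b = -1 \/ wave 0 1 0 a b = -1 ->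
    fourier_series e a b < fourier_series e 0 0).
  { intros a b Hab. rewrite !fourier_series_head by assumption.
    assert (W0 : forall m n, wave m n 0 0 0 = 1).
    { intros m n. unfold wave. rewrite <- cos_0. f_equal. ring. }
    rewrite !W0.
    assert (Htail : fourier_tail e a b <= fourier_tail e 0 0).
    { apply Rle_trans with (1 := Rle_abs _).
      apply Rle_trans with (1 := fourier_tail_bound e e 1 a b Hpos'
        (fun N m n _ _ => Req_le _ _ (eq_sym (Rmult_1_l (e m n)))) Hsum).
      rewrite Rmult_1_l. right. apply Series_ext. intros N. apply rsum_ext. intros p _.
      rewrite W0. ring. }
    assert (H1 := wave_range 1 0 0 a b). assert (H2 := wave_range 0 1 0 a b).
    assert (H3 := wave_range 1 1 0 a b). assert (H4 := wave_range 1 (-1) 0 a b).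
    assert (P1 := Hpos 1%Z 0%Z). assert (P2 := Hpos 0%Z 1%Z). assert (P3 := Hpos 1%Z 1%Z).
    assert (P4 := Hpos 1%Z (-1)%Z).
    assert (e 1%Z 1%Z * wave 1 1 0 a b <= e 1%Z 1%Z * 1) by (apply Rmult_le_compat_l; lra).
    assert (e 1%Z (-1)%Z * wave 1 (-1) 0 a b <= e 1%Z (-1)%Z * 1) by (apply Rmult_le_compat_l; lra).
    assert (e 1%Z 0%Z * wave 1 0 0 a b <= e 1%Z 0%Z * 1) by (apply Rmult_le_compat_l; lra).
    assert (e 0%Z 1%Z * wave 0 1 0 a b <= e 0%Z 1%Z * 1) by (apply Rmult_le_compat_l; lra).
    destruct Hab as [E|E]; rewrite E in *; lra. }
  destruct Hne as [H|H].
  - exists (/ (2 * al)). apply Hlt. left. unfold wave.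
    replace (2 * PI * (1 * (/ (2 * al) * al) + 0 * (/ (2 * al) * be)) + 0) with PI by (field; lra).
    apply cos_PI.
  - exists (/ (2 * be)). apply Hlt. right. unfold wave.
    replace (2 * PI * (0 * (/ (2 * be) * al) + 1 * (/ (2 * be) * be)) + 0) with PI by (field; lra).
    apply cos_PI.
Qed.

Lemma fourier_series_strictly_decreasing (e : Z -> Z -> R) (al be : R) :
  (forall m n, 0 < e m n) -> (forall m n, e (- m)%Z (- n)%Z = e m n) ->
  rapidly_summable e ->
  al <> 0 \/ be <> 0 ->
  radially_decreasing (fourier_series e) al be ->
  forall s s', 0 <= s -> s < s' -> s' <= 1 ->
  fourier_series e (s' * al) (s' * be) < fourier_series e (s * al) (s * be).
Proof.
  intros Hpos Hsym Hsum Hne Hdec s s' Hs Hss Hs'.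
  assert (Hpos' : forall m n, 0 <= e m n) by (intros; now left).
  assert (Hsum0 := rapidly_summable_summable e Hsum).
  destruct (Hdec s s' Hs (Rlt_le _ _ Hss) Hs') as [H|H]; [exact H | exfalso].
  assert (Hc : forall r, s <= r <= s' ->
    fourier_series e (r * al) (r * be) = fourier_series e (s * al) (s * be)).
  { intros r Hr. apply Rle_antisym; [apply Hdec; lra | ]. rewrite <- H. apply Hdec; lra. }
  destruct (fourier_series_not_constant e al be Hpos Hsym Hsum0 Hne) as [r Hr].
  assert (E := fourier_series_line_constant e al be s s' Hpos' Hsum Hss Hc r 0).
  rewrite !Rmult_0_l in E. lra.
Qed.

(** * From the approximants to the heat kernel of the triangular lattice *)

Lemma hexagonal_walk_scal (c : R) f j m n :
  hexagonal_walk (fun m n => c * f m n) j m n = c * hexagonal_walk f j m n.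
Proof.
  revert m n. induction j as [|j IH]; intros m n; simpl; [reflexivity | ].
  unfold hexagonal_step. rewrite !IH. field.
Qed.

(** Negating [w] replaces the angle [2 * PI / 3] by [PI / 3], the position for which the frequencies
    of the kernel are the shortest dual vectors. *)
Lemma triangular_acute_basis Lam : regular_triangular Lam ->
  exists v w, lattice_basis Lam v w /\ dot w w = dot v v /\ dot v w = dot v v / 2.
Proof.
  intros [v [w [Hb [Hn Ha]]]]. assert (Hd := lattice_basis_det _ _ _ Hb).
  assert (HP := dot_self_pos v w Hd).
  rewrite !norm_sqrt_dot in Hn. apply sqrt_inj in Hn; try apply dot_nonneg.
  unfold angle in Ha. rewrite !norm_sqrt_dot, <- Hn, sqrt_sqrt in Ha by lra.
  assert (Hg := gram_det v w). assert (Hd2 := pow2_ge_0 (det v w)). rewrite <- Hn in Hg.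
  assert (Hq : -1 <= dot v w / dot v v <= 1).
  { split; [apply Rle_div_r | apply Rle_div_l]; nra. }
  assert (E : dot v w = - dot v v / 2).
  { assert (Hc := cos_acos _ Hq). rewrite Ha in Hc.
    replace (2 * PI / 3) with (2 * (PI / 3)) in Hc by field. rewrite cos_2PI3 in Hc.
    assert (H : dot v w = dot v w / dot v v * dot v v) by (field; lra).
    rewrite H, <- Hc. field. }
  exists (lattice_point v w 1 0), (lattice_point v w 0 (-1)).
  split; [exact (lattice_basis_change Lam v w 1 0 0 (-1) Hb eq_refl) | ].
  rewrite !dot_lattice_points. lra.
Qed.

(** Since det^2 = (3/4) |v|^4, the eigenvalues become those of the operator u_xx + u_yy / 3, up to
    the time scale 4 PI^2 / |v|^2. *)
Lemma triangular_walk v w t a b j : det v w <> 0 ->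
  dot w w = dot v v -> dot v w = dot v v / 2 ->
  hexagonal_walk (fun m n => heat_coefficient v w t m n * wave m n 0 a b) j 0 0
  = / Rabs (det v w) * heat_sum (modes_walk j 0 0) (4 * PI ^ 2 / dot v v * t)
      (2 * PI * (a + b / 2)) (PI * b).
Proof.
  intros Hd Hq Hr. assert (HP := dot_self_pos v w Hd).
  rewrite heat_sum_modes_walk, <- hexagonal_walk_scal. apply hexagonal_walk_ext.
  intros m n. rewrite heat_mode_wave. unfold heat_coefficient.
  assert (Hg : det v w ^ 2 = 3 / 4 * dot v v ^ 2) by (rewrite <- gram_det, Hq, Hr; field).
  replace (- eigenvalue v w m n * t) with
    (- (4 / 3 * (IZR m ^ 2 - IZR m * IZR n + IZR n ^ 2)) * (4 * PI ^ 2 / dot v v * t)).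
  - unfold Rdiv. ring.
  - unfold eigenvalue. rewrite Hg, Hq, Hr. field. lra.
Qed.

Lemma triangular_radially_decreasing v w t a b : det v w <> 0 -> 0 < t ->
  dot w w = dot v v -> dot v w = dot v v / 2 ->
  in_hexagon (2 * PI * (a + b / 2)) (PI * b) ->
  radially_decreasing (fourier_series (heat_coefficient v w t)) a b.
Proof.
  intros Hd Ht Hq Hr Hhex s s' Hs Hss Hs'.
  assert (HP := dot_self_pos v w Hd).
  assert (Hk := heat_series_coefficients v w t Hd Ht).
  refine (is_lim_seq_le _ _ (fourier_series (heat_coefficient v w t) (s' * a) (s' * b))
    (fourier_series (heat_coefficient v w t) (s * a) (s * b)) _
    (fourier_summation _ _ (s' * a) (s' * b) Hk) (fourier_summation _ _ (s * a) (s * b) Hk)).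
  intros j. unfold Rdiv. apply Rmult_le_compat_r.
  { left. apply Rinv_0_lt_compat, kernel_power_integral_pos. }
  rewrite !triangular_walk by assumption. apply Rmult_le_compat_l.
  { left. apply Rinv_0_lt_compat. now apply Rabs_pos_lt. }
  assert (Ht' : 0 <= 4 * PI ^ 2 / dot v v * t).
  { assert (H := pow_lt PI 2 PI_RGT_0). apply Rmult_le_pos; [apply Rle_mult_inv_pos; lra | lra]. }
  assert (H := radially_decreasing_hexagon j _ _ _ Ht' Hhex s s' Hs Hss Hs').
  replace (2 * PI * (s' * a + s' * b / 2)) with (s' * (2 * PI * (a + b / 2))) by field.
  replace (2 * PI * (s * a + s * b / 2)) with (s * (2 * PI * (a + b / 2))) by field.
  replace (PI * (s' * b)) with (s' * (PI * b)) by ring.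
  replace (PI * (s * b)) with (s * (PI * b)) by ring. exact H.
Qed.

(** The six half-planes come from comparison with the six shortest lattice vectors. *)
Lemma voronoi_in_hexagon v w a b : 0 < dot v v ->
  dot w w = dot v v -> dot v w = dot v v / 2 ->
  in_voronoi_cell v w a b ->
  in_hexagon (2 * PI * (a + b / 2)) (PI * b).
Proof.
  intros HP Hq Hr Hvor. assert (Hpi := PI_RGT_0).
  assert (H : forall m n : Z, 0 <= IZR m * (2 * a + b) + IZR n * (a + 2 * b)
    + (IZR m ^ 2 + IZR m * IZR n + IZR n ^ 2)).
  { intros m n. specialize (Hvor m n). rewrite !norm_sqrt_dot in Hvor.
    apply sqrt_le_0 in Hvor; try apply dot_nonneg.
    replace (plus (lattice_point v w a b) (lattice_point v w (IZR m) (IZR n)))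
      with (lattice_point v w (a + IZR m) (b + IZR n)) in Hvor by (point_ring; ring).
    rewrite !dot_lattice_point, Hq, Hr in Hvor.
    apply (Rmult_le_reg_l (dot v v)); [exact HP | ]. lra. }
  assert (H1 := H 1%Z 0%Z). assert (H2 := H (-1)%Z 0%Z). assert (H3 := H 0%Z 1%Z).
  assert (H4 := H 0%Z (-1)%Z). assert (H5 := H 1%Z (-1)%Z). assert (H6 := H (-1)%Z 1%Z).
  unfold in_hexagon. repeat split; nra.
Qed.

Lemma triangular_strictly_decreasing Lam K t :
  heat_kernel Lam K -> regular_triangular Lam -> 0 < t ->
  strictly_geodesically_decreasing Lam (K t).
Proof.
  intros HK Htri Ht x s0 gam [Hs0 [c [Hgam Hlen]]] Hnc Hx s s' Hs Hss Hs'.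
  destruct (triangular_acute_basis Lam Htri) as [v [w [Hb [Hq Hr]]]].
  assert (Hd := lattice_basis_det _ _ _ Hb). assert (HP := dot_self_pos v w Hd).
  assert (Hz := lattice_basis_zero _ _ _ Hb).
  assert (Hs0' : 0 < s0) by lra.
  set (y := scal s0 c : point).
  set (al := coord1 v w y). set (be := coord2 v w y).
  assert (Hy : lattice_point v w al be = y) by now apply lattice_point_coords.
  assert (Hpt : forall r, 0 <= r <= s0 -> gam r = plus x (lattice_point v w (r / s0 * al) (r / s0 * be))).
  { intros r Hr'. rewrite (Hgam r Hr'), Hx.
    transitivity (plus x (scal (r / s0) (lattice_point v w al be))); [ | point_ring; ring].
    rewrite Hy. unfold y. point_ring; field; lra. }
  (* Minimality says that the displacement [y] has the length of the torus distance, so no lattice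
     translate of it is shorter. *)
  assert (Hvor : in_voronoi_cell v w al be).
  { intros m n. rewrite Hy.
    destruct (torus_dist_glb Lam (gam 0) (gam s0) zero Hz) as [H1 _].
    specialize (H1 _ (lattice_basis_mem Lam v w m n Hb)). rewrite <- Hlen in H1.
    assert (E : minus (gam s0) (gam 0) = y).
    { rewrite (Hgam s0) by lra. unfold y, minus, opp; simpl. point_ring; unfold opp; simpl; ring. }
    rewrite E in H1.
    apply Rle_trans with (2 := H1). right. rewrite !norm_sqrt_dot.
    replace (dot y y) with (s0 ^ 2 * dot c c).
    - rewrite sqrt_mult_alt by apply pow2_ge_0. now rewrite sqrt_pow2.
    - unfold y, dot, scal; simpl; unfold scal; simpl; unfold mult; simpl. ring. }
  assert (Hne : al <> 0 \/ be <> 0).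
  { apply NNPP. intros Hno. destruct Hnc as [r [Hr' Hnl]]. apply Hnl.
    assert (Hal : al = 0) by tauto. assert (Hbe : be = 0) by tauto.
    replace (minus (gam r) (gam 0)) with (zero : point); [exact Hz | ].
    rewrite (Hpt r Hr'), Hx, Hal, Hbe. unfold minus, opp; simpl. point_ring; unfold opp; simpl; ring. }
  assert (Hdec := triangular_radially_decreasing v w t al be Hd Ht Hq Hr
    (voronoi_in_hexagon v w al be HP Hq Hr Hvor)).
  rewrite (Hpt s), (Hpt s') by lra.
  rewrite !(heat_kernel_series Lam K v w) by assumption.
  apply fourier_series_strictly_decreasing; trivial.
  - intros. now apply heat_coefficient_pos.
  - apply heat_coefficient_neg.
  - now apply heat_coefficient_rapidly_summable.
  - apply Rle_mult_inv_pos; lra.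
  - unfold Rdiv. apply Rmult_lt_compat_r; [now apply Rinv_0_lt_compat | exact Hss].
  - apply Rle_div_l; lra.
Qed.

Theorem theorem2p1 (Lam : point -> Prop) (K : R -> point -> point -> R)
    (hLam : rank_two_lattice Lam) (hK : heat_kernel Lam K) :
  (regular_triangular Lam ->
   forall t : R, 0 < t -> strictly_geodesically_decreasing Lam (K t)) /\
  ((exists t : nat -> R,
      (forall k, 0 < t k) /\ is_lim_seq t p_infty /\
      (forall k, geodesically_decreasing Lam (K (t k)))) ->
   rectangular Lam \/ regular_triangular Lam).
Proof.
  split.
  - intros Htri t Ht. now apply triangular_strictly_decreasing.
  - intros H. now apply (decreasing_at_large_times Lam K).
Qed.
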